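(* Let $\alpha > -1$ and $0 < \sigma < \alpha +1$. Let $a,b \in \mathbb{R}$ and assume that $1\le p,q \le \infty$. (i) $L^p(|x|^{ap}dw_{\alpha}) \subset \mathrm{Dom}\, \mathbb{I}^{\alpha,\sigma}$ if and only if $$2\sigma - \frac{2\alpha+2}{p} < a < \frac{2\alpha+2}{p'} \qquad \text{(both inequalities being $\le$ when $p=1$)}.$$ (ii) The estimate $$\big\||x|^{-b}\mathbb{I}^{\alpha,\sigma} f\big\|_{L^q(dw_\alpha)}\lesssim \big\||x|^af\big\|_{L^p(dw_\alpha)}$$ holds uniformly in $f \in L^p(|x|^{ap}dw_{\alpha})$ if and only if the following conditions are satisfied: (a) $p \le q$, (b) $\frac{1}{q} = \frac{1}p + \frac{a+b-2\sigma}{2\alpha+2}$, (c) $a < \frac{2\alpha+2}{p'}$ ($\le$ when $p = q'= 1$), (d) $b < \frac{2\alpha+2}q$ ($\le$ when $p = q'=1$), (e) $\frac{1}q \ge \frac{1}p - 2\sigma$ ($>$ when $p=1$ or $q=\infty$).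
   Context: For $\alpha>-1$ let $dw_\alpha(x)=|x|^{2\alpha+1}dx$ on $\mathbb R$, let $I_\alpha$ denote the modified Bessel function of the first kind of order $\alpha$, and for $t,x,y>0$ let $$W_t^{\alpha}(x,y)=\frac{1}{2t}\exp\Big(-\frac{x^2+y^2}{4t}\Big)(xy)^{-\alpha}I_\alpha\Big(\frac{xy}{2t}\Big),$$ extended to $x=0$ or $y=0$ by taking limits. Define $$\mathbb W_t^{\alpha}(x,y)=\frac12\Big[W_t^{\alpha}(|x|,|y|)+xy\,W_t^{\alpha+1}(|x|,|y|)\Big],\qquad x,y\in\mathbb R,\ t>0,$$ $$\mathbb K^{\alpha,\sigma}(x,y)=\frac1{\Gamma(\sigma)}\int_0^\infty \mathbb W_t^{\alpha}(x,y)\,t^{\sigma-1}\,dt,\qquad \mathbb I^{\alpha,\sigma}f(x)=\int_{\mathbb R}\mathbb K^{\alpha,\sigma}(x,y)f(y)\,dw_\alpha(y),\qquad x,y\in\mathbb R.$$ The natural domain $\mathrm{Dom}\,\mathbb I^{\alpha,\sigma}$ consists of those functions $f$ on $\mathbb R$ for which the last integral converges for a.e. $x\in\mathbb R$. $L^p(|x|^{ap}dw_\alpha)$ denotes the space of measurable $f$ with $|x|^af\in L^p(dw_\alpha)$, also for $p=\infty$. $p'$ is the conjugate exponent, $1/p+1/p'=1$, and $1/\infty=0$. $X\lesssim Y$ means $X\le CY$ with a constant $C>0$ independent of $f$. *)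

(* Defs.v *)
From HB Require Import structures.
From mathcomp Require Import all_boot all_order all_algebra.
From mathcomp Require Import all_classical all_reals all_analysis.
From mathcomp Require Import measurable_realfun.

Set Implicit Arguments.
Unset Strict Implicit.
Unset Printing Implicit Defensive.

Import Order.TTheory GRing.Theory Num.Theory.
Import numFieldNormedType.Exports.

Local Open Scope classical_set_scope.
Local Open Scope ring_scope.

Section weighted_measure.
Context {R : realType} (alpha : R).

Definition w_density (x : R) : R := `|x| `^ (2 * alpha + 1).

(* dw_alpha(x) = |x|^(2 alpha + 1) dx *)
Definition w_measure (A : set (measurableTypeR R)) : \bar R :=
  (\int[lebesgue_measure]_(x in A) (w_density x)%:E)%E.

Lemma measurable_w_density : measurable_fun [set: R] w_density.
Proof.
exact: (measurableT_comp (measurable_powR (2 * alpha + 1))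
  (@normr_measurable R setT)).
Qed.

Let w_measure0 : w_measure set0 = 0%E.
Proof. by rewrite /w_measure integral_set0. Qed.

Let w_measure_ge0 A : (0 <= w_measure A)%E.
Proof. by apply: integral_ge0 => x _; rewrite lee_fin powR_ge0. Qed.

Let w_measure_sigma_additive : semi_sigma_additive w_measure.
Proof.
move=> /= F mF tF mUF; rewrite /w_measure; apply: cvg_toP.
  apply: ereal_nondecreasing_is_cvgn => m n mn.
  apply: lee_sum_nneg_natr => // k _ _; apply: integral_ge0 => /= x Fkx.
  by rewrite lee_fin powR_ge0.
rewrite ge0_integral_bigcup//=.
- apply/measurable_funTS/measurableT_comp => //.
  exact: measurable_w_density.
- by move=> x _; rewrite lee_fin powR_ge0.
Qed.

HB.instance Definition _ := isMeasure.Build _ _ _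
  w_measure w_measure0 w_measure_ge0 w_measure_sigma_additive.

End weighted_measure.

Section potential_operator.
Context {R : realType}.
Implicit Types alpha sigma s t x y z a : R.
Implicit Types (p : \bar R) (f : R -> R).

(* Euler's integral; meaningful for s > 0, the only arguments used below. *)
Definition Gamma s : R :=
  \int[lebesgue_measure]_(t in `]0, +oo[) (t `^ (s - 1) * expR (- t)).

(* Power series of I_alpha(z), for z > 0 and alpha > -1. *)
Definition besselI alpha z : R :=
  limn (series (fun k : nat =>
    (z / 2) `^ (2 * k%:R + alpha) / (k`!%:R * Gamma (k%:R + alpha + 1)))).

(* W_t^alpha(x, y) for x, y > 0 *)
Definition heatW_pos alpha t x y : R :=
  (2 * t)^-1 * expR (- (x ^+ 2 + y ^+ 2) / (4 * t)) *
  (x * y) `^ (- alpha) * besselI alpha (x * y / (2 * t)).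

(* On the boundary of the quadrant x, y >= 0: limit from the open quadrant. *)
Definition heatW alpha t x y : R :=
  if (0 < x) && (0 < y) then heatW_pos alpha t x y
  else lim (heatW_pos alpha t z.1 z.2 @[z --> within
              [set z : R * R | 0 < z.1 /\ 0 < z.2] (nbhs (x, y))]).

Definition dunklW alpha t x y : R :=
  2^-1 * (heatW alpha t `|x| `|y| + x * y * heatW (alpha + 1) t `|x| `|y|).

(* Extended-real valued, as the integral can be +oo on the diagonal x = y. *)
Definition potentialK alpha sigma x y : \bar R :=
  (((Gamma sigma)^-1)%:E *
   \int[lebesgue_measure]_(t in `]0%R, +oo[)
      (dunklW alpha t x y * t `^ (sigma - 1))%:E)%E.

Definition potentialI alpha sigma f x : \bar R :=
  (\int[w_measure alpha]_y (potentialK alpha sigma x y * (f y)%:E))%E.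

(* The natural domain of potentialI, convergence being that of the Lebesgue
   integral; potentialI alpha sigma f is only meaningful for f in it. *)
Definition potential_dom alpha sigma : set (R -> R) :=
  [set f | {ae lebesgue_measure, forall x : R,
     (w_measure alpha).-integrable setT
       (fun y => (potentialK alpha sigma x y * (f y)%:E)%E)}].

(* L^p(|x|^(a p) dw_alpha), meaning |x|^a f in L^p(dw_alpha) when p = +oo *)
Definition weighted_Lp alpha a p : set (R -> R) :=
  [set f | measurable_fun [set: R] f /\
           (fun x : R => `|x| `^ a * f x) \in Lfun (w_measure alpha) p].

(* || |x|^a f ||_(L^p(dw_alpha)) for extended-real valued f *)
Definition weighted_norm alpha a p (f : R -> \bar R) : \bar R :=
  Lnorm (w_measure alpha) p (fun x : R => ((`|x| `^ a)%:E * f x)%E).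

(* || |x|^(-b) I^(alpha, sigma) f ||_q <= C || |x|^a f ||_p for all f in
   L^p(|x|^(a p) dw_alpha); it presupposes that I^(alpha, sigma) f is defined. *)
Definition two_weight_estimate alpha sigma a b p (q : \bar R) : Prop :=
  exists2 C : R, 0 < C & forall f : R -> R, weighted_Lp alpha a p f ->
    potential_dom alpha sigma f /\
    (weighted_norm alpha (- b) q (potentialI alpha sigma f)
      <= C%:E * weighted_norm alpha a p (EFin \o f))%E.

(* 1 / p as a real number, with 1 / +oo = 0 *)
Definition rcp p : R := fine (p^-1)%E.

End potential_operator.

(* Main.v *)
From HB Require Import structures.
Require Import Defs.
From mathcomp Require Import all_boot all_order all_algebra.
From mathcomp Require Import all_classical all_reals all_analysis.
From mathcomp Require Import measurable_realfun ess_sup_inf.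
From mathcomp Require Import ring lra.

Set Implicit Arguments.
Unset Strict Implicit.
Unset Printing Implicit Defensive.

Import Order.TTheory GRing.Theory Num.Theory.
Import numFieldNormedType.Exports.

Local Open Scope classical_set_scope.
Local Open Scope ring_scope.

(** Write $D = 2\alpha + 2$ and let $\mu$ be the measure $dx/|x|$, that is [w_measure (-1)],
    which is invariant under dilations.

    _The kernel._ The Bessel series is integrated against $t^{\sigma-1}$ term by term, each term
    being a Gamma integral. The two summands of the kernel become $(x^2+y^2)^{\sigma-\alpha-1}$,
    up to the bounded factor $xy/(x^2+y^2)$ for the odd one, times a power series in $\rho =
    2|xy|/(x^2+y^2)$ whose coefficients, being quotients of Gamma values, are comparable to
    $k^{-\sigma-1/2}$. As $1 - \rho = (|x|-|y|)^2/(x^2+y^2)$, the size of the series near $\rho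
    = 1$ is the size of the kernel near $|x| = |y|$. This gives [potentialK_le], where the
    singularity has order [th], any exponent with $\theta \ge 1-2\sigma$ ($\theta > 0$ if
    $2\sigma \le 1$), and the matching lower bound [potentialK_ge] in the quadrant $x, y > 0$,
    where both summands are positive.

    _The normalisation._ Multiplying the functions by powers of $|x|$ turns the two-weight
    estimate into an estimate from $L^p(\mu)$ to $L^q(\mu)$ for the kernel $|x|^A |y|^B K(x,y)$
    with $A = D/q - b$ and $B = D/p' - a$. The equation between $1/q$ and $1/p$ reads $A + B = D
    - 2\sigma$ and makes this kernel homogeneous of degree 0. The bounds on $a$ and $b$ read $B
    > 0$ and $A > 0$ (or $\ge 0$), which is decay (or boundedness) away from the diagonal in the
    variable $\ln|x|$. The local condition $1/q \ge 1/p - 2\sigma$ says that the singularity on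
    the diagonal is not worse than $1 - 1/p + 1/q$, the exponent allowed by Young's inequality.

    _Sufficiency._ The plane is cut into the sets [near_piece], where $|x|-|y|$ has relative
    size $2^{-j}$, and [low_piece], [high_piece], where the quotient of the moduli has size
    $2^j$. The kernel is at most $2^{\theta j}$, $2^{-Bj}$, $2^{-Aj}$ on them
    ([kernel_decomposition]), and their slices have measure at most a constant times $2^{-j}$,
    $1$, $1$. Young's inequality for the indicator of one piece ([set_op_young]) leaves
    geometric series when the local condition is strict ([series_op_strong]); in the endpoint
    case with $1 < p < q < \infty$ the series is critical, and [series_op_endpoint] is the
    Hardy-Littlewood-Sobolev argument. For $p = 1$, $q = \infty$ the normalised kernel is
    bounded. The inclusion in the domain follows from the estimate with $q = p$ and $b = 2\sigma
    - a$ when $p > 1$; when $p = 1$, boundedness of the kernel off the near pieces is enough,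
    since the normalised function is integrable.

    _Necessity._ The kernel being positive in the quadrant, everything is tested on nonnegative
    functions living on the half-line ([two_weight_test], [dom_test]). Indicators of $[r, 2r]$
    force the homogeneity, indicators of long logarithmic intervals force $p \le q$, and pairs
    of distant intervals force $A, B > 0$ when $q < \infty$. Short intervals force the local
    condition. Equality there is excluded for $p = 1$, $q < \infty$ or $p > 1$, $q = \infty$ by
    the logarithmic divergence of $\int dy/(y-1)$, and for $p = 1$, $q = \infty$ by the
    unboundedness of the kernel when $2\sigma \le 1$. The bounds on $a$ for the domain, which
    also serve for the estimate when $q = \infty$, come from the functions $1/(1+|\ln y|)$ on
    $(1,\infty)$ and on $(0,1)$, which are in $L^p(\mu)$ for $p > 1$ but not in $L^1(\mu)$, and
    from powers of $y$ when $p = 1$ ([dom_necessity_strict], [dom_necessity]). *)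

(** * Calculus on the half-line *)
Section calculus.
Context {R : realType}.
Implicit Types (a b s t : R).
Local Notation leb := (@lebesgue_measure R).

(** Degenerate intervals are included, so that no case distinction is left to the callers. *)
Lemma FTC_itv (F f : R -> R) a b : a <= b ->
  (forall x, a <= x <= b -> is_derive x 1 F (f x)) ->
  (forall x, a <= x <= b -> {for x, continuous f}) ->
  (\int[leb]_(x in `[a, b]) (f x)%:E = (F b - F a)%:E)%E.
Proof.
rewrite le_eqVlt => /predU1P[<- _ _|ab dF cf].
  by rewrite set_itv1 integral_set1 subrr.
have dF' x : a <= x <= b -> derivable F x 1 by move=> /dF[].
have cF x : a <= x <= b -> {for x, continuous F}.
  by move=> /dF' ?; apply/differentiable_continuous/derivable1_diffP.
rewrite (@continuous_FTC2 _ f F) ?EFinB//.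
- by apply: continuous_in_subspaceT => x; rewrite inE/= in_itv/= => /cf.
- split.
  + by move=> x; rewrite in_itv/= => /andP[ax xb]; apply: dF'; rewrite !ltW.
  + by apply: cvg_at_right_filter; apply: cF; rewrite lexx ltW.
  + by apply: cvg_at_left_filter; apply: cF; rewrite lexx ltW.
- move=> x; rewrite in_itv/= => /andP[ax xb]; rewrite derive1E.
  by have [_ ->] := dF x (introT andP (conj (ltW ax) (ltW xb))).
Qed.

(** The exhaustion is chosen so that $t \mapsto A/t$ maps each interval onto itself. *)
Lemma itv0y_bigcup (A : R) : 0 < A ->
  `]0, +oo[%classic = \bigcup_n `[A / n.+1%:R, n.+1%:R]%classic :> set R.
Proof.
move=> A0; apply/seteqP; split => x /=; last first.
  move=> [n _] /=; rewrite !in_itv/= => /andP[+ _]; rewrite andbT.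
  by apply: lt_le_trans; rewrite divr_gt0.
rewrite in_itv/= andbT => x0.
exists (maxn (Num.truncn x) (Num.truncn (A / x))) => //=; rewrite in_itv/=; apply/andP; split.
  rewrite ler_pdivrMr// mulrC -ler_pdivrMr//.
  apply: (le_trans (ltW (truncnS_gt _))).
  by rewrite ler_nat ltnS leq_maxr.
apply: (le_trans (ltW (truncnS_gt _))).
by rewrite ler_nat ltnS leq_maxl.
Qed.

Lemma cvg_integral_itv0y (f : R -> \bar R) (A : R) : 0 < A ->
  measurable_fun `](0:R), +oo[ f -> (forall x, 0 < x -> (0 <= f x)%E) ->
  (\int[leb]_(x in `[(A / n.+1%:R)%R, n.+1%:R]) f x @[n --> \oo] -->
   \int[leb]_(x in `]0%R, +oo[) f x)%E.
Proof.
move=> A0 mf f0.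
have sub n : (`[(A / n.+1%:R)%R, n.+1%:R]%classic : set R) `<=` `]0, +oo[%classic.
  by rewrite (itv0y_bigcup A0) => x ?; exists n.
rewrite (itv0y_bigcup A0); apply: ge0_nondecreasing_set_cvg_integral.
- move=> m n mn; apply/subsetPset => x /=; rewrite !in_itv/= => /andP[mx xm].
  have mn' : m.+1%:R <= n.+1%:R :> R by rewrite ler_nat.
  rewrite (le_trans xm)// andbT (le_trans _ mx)//.
  by rewrite ler_pM2l// lef_pV2 ?posrE.
- by [].
- by move=> n; apply: measurable_funS mf.
- by move=> n x /sub/=; rewrite in_itv/= andbT => /f0.
Qed.

(** By monotone convergence; this avoids improper integrals, only primitives on compact intervals
    being needed. *)
Lemma integral_itv0y_le (f : R -> \bar R) (M : \bar R) :
  measurable_fun `](0:R), +oo[ f -> (forall x, 0 < x -> (0 <= f x)%E) ->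
  (forall a b, 0 < a -> a <= b -> (\int[leb]_(x in `[a, b]) f x <= M)%E) ->
  (\int[leb]_(x in `]0%R, +oo[) f x <= M)%E.
Proof.
move=> mf f0 fM; have h := @cvg_integral_itv0y f 1 ltr01 mf f0.
rewrite -(cvg_lim _ h)//; apply: lime_le; first by apply/cvg_ex; eexists; exact: h.
apply: nearW => n; apply: fM; first by rewrite divr_gt0.
by rewrite ler_pdivrMr// -natrM (ler_nat _ 1).
Qed.

Lemma continuous_powR_pos s x : 0 < x -> {for x, continuous (@powR R ^~ s)}.
Proof.
move=> x0; apply/differentiable_continuous/derivable1_diffP.
by have [] := is_derive1_powR s x0.
Qed.

Lemma is_derive_powRl s (x : R) : 0 < x ->
  is_derive x 1 (fun y : R => y `^ s) (s * x `^ (s - 1)).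
Proof. exact: is_derive1_powR. Qed.

Lemma measurable_fun_pos (f : R -> R) :
  (forall x, 0 < x -> {for x, continuous f}) -> measurable_fun `](0:R), +oo[ f.
Proof.
move=> cf; apply: open_continuous_measurable_fun; first exact: interval_open.
by move=> x; rewrite inE/= in_itv/= andbT => /cf.
Qed.

(** Derivative rules for eta-expanded functions, so that the derivative of an explicit expression can be
    assembled as a term. *)
Lemma rderD (f g : R -> R) (x a b : R) : is_derive x 1 f a ->
  is_derive x 1 g b -> is_derive x 1 (fun y : R => f y + g y) (a + b).
Proof. by move=> *; exact: is_deriveD. Qed.

Lemma rderM (f g : R -> R) (x a b : R) : is_derive x 1 f a ->
  is_derive x 1 g b -> is_derive x 1 (fun y : R => f y * g y) (f x * b + g x * a).
Proof. by move=> *; exact: is_deriveM. Qed.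

Lemma rderN (f : R -> R) (x a : R) : is_derive x 1 f a ->
  is_derive x 1 (fun y : R => - f y) (- a).
Proof. by move=> ?; exact: is_deriveN. Qed.

Lemma rderV (f : R -> R) (x a : R) : f x != 0 -> is_derive x 1 f a ->
  is_derive x 1 (fun y : R => (f y)^-1) (- (f x) ^- 2 * a).
Proof. by move=> ? ?; exact: is_deriveV. Qed.

Lemma rder_cst (c x : R) : is_derive x 1 (fun _ : R => c) 0.
Proof. exact: is_derive_cst. Qed.

Lemma rder_id (x : R) : is_derive x 1 (fun y : R => y) 1.
Proof. exact: is_derive_id. Qed.

Lemma rder_comp (f g : R -> R) (x a b : R) : is_derive x 1 f a ->
  is_derive (f x) 1 g b -> is_derive x 1 (fun y : R => g (f y)) (b * a).
Proof. by move=> df dg; exact: (@is_derive1_comp R g f x b a dg df). Qed.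

Lemma rderE (f : R -> R) (x a b : R) : is_derive x 1 f a -> a = b ->
  is_derive x 1 f b.
Proof. by move=> + <-. Qed.

Lemma rder_continuous (f : R -> R) (x a : R) : is_derive x 1 f a ->
  {for x, continuous f}.
Proof. by move=> [? _]; exact/differentiable_continuous/derivable1_diffP. Qed.

(** From $e^u \ge 1 + u$ at $u = (1+t)/m$. *)
Lemma expRN_le_powR (m t : R) : 0 < m -> 0 <= t ->
  expR (- t) <= expR 1 * m `^ m * (1 + t) `^ (- m).
Proof.
move=> m0 t0; have t1 : 0 < 1 + t by rewrite ltr_pwDl.
have h : ((1 + t) / m) `^ m <= expR (1 + t).
  have -> : 1 + t = (1 + t) / m * m by rewrite divfK// gt_eqF.
  rewrite expRM mulfK ?gt_eqF//; apply: ge0_ler_powR; rewrite ?nnegrE ?expR_ge0 ?ltW ?divr_gt0//.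
  by apply: lt_le_trans (expR_ge1Dx _); rewrite ltrDr.
have E : ((1 + t) / m) `^ m = (1 + t) `^ m * m `^ (- m).
  rewrite powRM ?invr_ge0 ?ltW//; congr (_ * _).
  by rewrite -[m^-1]powR_inv1 ?ltW// -powRrM mulN1r.
rewrite E in h.
rewrite -mulrA -ler_pdivrMl ?expR_gt0// -expRN -expRD -opprD expRN.
rewrite !powRN ler_pdivlMr ?powR_gt0// mulrC ler_pdivrMr ?expR_gt0//.
by rewrite -ler_pdivrMl ?powR_gt0// mulrC -powRN.
Qed.

End calculus.

(** * The Gamma function *)
Section gamma.
Context {R : realType}.
Implicit Types (a b s t : R).
Local Notation leb := (@lebesgue_measure R).

Definition gamma_integrand s t : R := t `^ (s - 1) * expR (- t).

Lemma gamma_integrand_ge0 s t : 0 <= gamma_integrand s t.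
Proof. by rewrite mulr_ge0 ?powR_ge0 ?expR_ge0. Qed.

Lemma is_derive_expRN t : is_derive t 1 (fun y : R => expR (- y)) (- expR (- t)).
Proof.
have h : is_derive t 1 (fun y : R => - y) (-1) by exact: is_deriveN.
have := @is_derive1_comp R expR (fun y : R => - y) t _ _ (is_derive_expR (- t)) h.
by rewrite mulrN1.
Qed.

Lemma continuous_expRN t : {for t, continuous (fun y : R => expR (- y))}.
Proof.
apply/differentiable_continuous/derivable1_diffP.
by have [] := is_derive_expRN t.
Qed.

Lemma continuous_gamma_integrand s t : 0 < t ->
  {for t, continuous (gamma_integrand s)}.
Proof.
move=> t0; apply: (@continuousM _ _ (fun y => y `^ (s - 1)) (fun y => expR (- y))).
  exact: continuous_powR_pos.
exact: continuous_expRN.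
Qed.

Lemma measurable_gamma_integrand s :
  measurable_fun `](0:R), +oo[ (EFin \o gamma_integrand s).
Proof.
apply/measurable_EFinP; apply: measurable_fun_pos => x.
exact: continuous_gamma_integrand.
Qed.

(** The integrand is dominated by a multiple of the derivative of the bounded function
    $(t/(1+t))^s$. *)
Lemma gamma_integral_lty s : 0 < s ->
  (\int[leb]_(t in `]0%R, +oo[) (gamma_integrand s t)%:E < +oo)%E.
Proof.
move=> s0; pose C := expR 1 * (s + 1) `^ (s + 1).
have C0 : 0 < C by rewrite mulr_gt0 ?expR_gt0 ?powR_gt0// addr_gt0.
apply: (@le_lt_trans _ _ (C / s)%:E); last by rewrite ltry.
apply: integral_itv0y_le.
- exact: measurable_gamma_integrand.
- by move=> x x0; rewrite lee_fin gamma_integrand_ge0.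
move=> a b a0 ab.
pose H := fun t : R => C / s * (t / (1 + t)) `^ s.
pose h := fun t : R => C * (t `^ (s - 1) * (1 + t) `^ (- (s + 1))).
have dH t : 0 < t -> is_derive t 1 H (h t).
  move=> t0; have t1 : 1 + t != 0 by rewrite gt_eqF// addr_gt0.
  have dq := rderM (rder_id t) (rderV t1 (rderD (rder_cst 1 t) (rder_id t))).
  refine (rderE (rderM (rder_cst (C / s) t)
      (rder_comp dq (is_derive_powRl s (divr_gt0 t0 (addr_gt0 ltr01 t0))))) _).
  rewrite /= add0r mulr0 addr0 !mulr1.
  have -> : t * - (1 + t) ^- 2 + (1 + t)^-1 = (1 + t) ^- 2 by field.
  rewrite /h powRM ?invr_ge0 ?ltW ?addr_gt0//.
  rewrite -[(1 + t)^-1]powR_inv1 ?ltW ?addr_gt0// -powRrM.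
  rewrite -powR_mulrn ?ltW ?addr_gt0// -powRN.
  have -> : - (s + 1) = (-1 * (s - 1)) + (- 2%:R) by lra.
  rewrite [(1 + t) `^ (_ + _)]powRD ?t1 ?implybT//.
  by field; rewrite gt_eqF.
have hc t : 0 < t -> {for t, continuous h}.
  move=> t0; apply: continuousM; first exact: cst_continuous.
  apply: continuousM; first exact: continuous_powR_pos.
  exact: (rder_continuous (rder_comp (rderD (rder_cst 1 t) (rder_id t))
    (is_derive_powRl (- (s + 1)) (addr_gt0 ltr01 t0)))).
have pos t : a <= t <= b -> 0 < t by move=> /andP[+ _]; apply: lt_le_trans.
apply: (@le_trans _ _ (\int[leb]_(t in `[a, b]) (h t)%:E)%E).
  apply: ge0_le_integral => //.
  - by move=> x _; rewrite lee_fin gamma_integrand_ge0.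
  - apply: measurable_funS (measurable_gamma_integrand s) => //.
    by move=> x /=; rewrite !in_itv/= andbT => /pos.
  - apply/measurable_EFinP; apply: measurable_funS (measurable_fun_pos hc) => //.
    by move=> x /=; rewrite !in_itv/= andbT => /pos.
  - move=> x /=; rewrite in_itv/= => /pos x0; rewrite lee_fin /h mulrCA.
    by apply: ler_wpM2l; [exact: powR_ge0 | apply: expRN_le_powR; rewrite ?addr_gt0 ?ltW].
rewrite (FTC_itv ab (fun x hx => dH x (pos x hx)) (fun x hx => hc x (pos x hx))).
have b0 : 0 < b by exact: lt_le_trans ab.
have Cs : 0 <= C / s by rewrite ltW// divr_gt0.
rewrite lee_fin lerBlDr ler_wpDr//; first by rewrite mulr_ge0 ?powR_ge0.
rewrite /H ler_piMr// -[leRHS](congr1 (@^~ s) (powR1 R)).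
have b1 : 0 < 1 + b by rewrite addr_gt0.
by apply: ge0_ler_powR; rewrite ?nnegrE ?(ltW s0) ?(ltW (divr_gt0 b0 b1))// ler_pdivrMr// mul1r lerDr.
Qed.

(** [Gamma] is a real number by truncation; finiteness makes it the extended integral. *)
Lemma EFin_Gamma s : 0 < s ->
  (Gamma s)%:E = (\int[leb]_(t in `]0%R, +oo[) (gamma_integrand s t)%:E)%E.
Proof.
move=> s0; rewrite /Gamma /Rintegral fineK// ge0_fin_numE ?gamma_integral_lty//.
by apply: integral_ge0 => x _; rewrite lee_fin gamma_integrand_ge0.
Qed.

Lemma Gamma_gt0 s : 0 < s -> 0 < Gamma s.
Proof.
move=> s0; rewrite -lte_fin EFin_Gamma//.
pose m := Num.min (1 `^ (s - 1)) (2 `^ (s - 1)) * expR (- 2).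
have m0 : 0 < m by rewrite mulr_gt0 ?expR_gt0// lt_min !powR_gt0.
apply: (@lt_le_trans _ _ (\int[leb]_(t in `[1%R, 2%R]) m%:E)%E).
  by rewrite integral_cst//= lebesgue_measure_itv/= lte_fin ltr1n -EFinB -EFinM lte_fin mulr_gt0// subr_gt0 ltr1n.
have sub : (`[1%R, 2%R]%classic : set R) `<=` `]0%R, +oo[%classic.
  by move=> x /=; rewrite !in_itv/= andbT => /andP[+ _]; apply: lt_le_trans.
apply: (@le_trans _ _ (\int[leb]_(t in `[1%R, 2%R]) (gamma_integrand s t)%:E)%E).
  apply: ge0_le_integral => //.
  - by move=> x _; rewrite lee_fin ltW.
  - exact: measurable_funS (measurable_gamma_integrand s).
  move=> x /=; rewrite in_itv/= => /andP[x1 x2]; rewrite lee_fin.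
  apply: ler_pM; rewrite ?expR_ge0 ?ler_expR ?lerN2// ?le_min ?powR_ge0//.
  have x0 : 0 < x by exact: lt_le_trans x1.
  have [s1|s1] := leP 0 (s - 1).
    rewrite ge_min; apply/orP; left.
    by apply: ge0_ler_powR; rewrite ?nnegrE// ltW.
  rewrite ge_min; apply/orP; right.
  rewrite -[s - 1]opprK !(powRN _ (- (s - 1))) lef_pV2 ?posrE ?powR_gt0//.
  by apply: ge0_ler_powR; rewrite ?nnegrE ?oppr_ge0// ltW.
apply: ge0_subset_integral => //; first exact: measurable_gamma_integrand.
by move=> x _; rewrite lee_fin gamma_integrand_ge0.
Qed.

Lemma cvg_inv_at_right0 : (n.+1%:R^-1 : R) @[n --> \oo] --> (0 : R)^'+.
Proof.
move=> P [e /= e0 eP].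
have [N _ HN] := @cvgr0_norm_lt _ _ _ _ _ (@harmonic R) (@cvg_harmonic R) e e0.
exists N => // n /HN /=; rewrite /harmonic => h; apply: eP; last by rewrite invr_gt0.
by rewrite /ball_/= sub0r normrN.
Qed.

Lemma cvg_inv_powR s : 0 < s -> (n.+1%:R^-1 `^ s : R) @[n --> \oo] --> 0.
Proof. by move=> s0; exact: (@cvg_comp _ _ _ (fun n => n.+1%:R^-1 : R) (fun a => a `^ s) _ _ _ cvg_inv_at_right0 (powR_cvg0 s0)). Qed.

Lemma gamma_integrable s : 0 < s ->
  leb.-integrable `]0, +oo[ (EFin \o gamma_integrand s).
Proof.
move=> s0; apply/integrableP; split; first exact: measurable_gamma_integrand.
under eq_integral do rewrite /= ger0_norm ?gamma_integrand_ge0//.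
exact: gamma_integral_lty.
Qed.

(** Integration by parts over $[1/n, n]$, the boundary terms of $t^s e^{-t}$ tending to 0. *)
Lemma GammaS s : 0 < s -> Gamma (s + 1) = s * Gamma s.
Proof.
move=> s0; have s10 : 0 < s + 1 by rewrite addr_gt0.
pose H t := t `^ s * expR (- t).
have dH t : 0 < t -> is_derive t 1 H (s * gamma_integrand s t - gamma_integrand (s + 1) t).
  move=> t0.
  refine (rderE (rderM (is_derive_powRl s t0) (is_derive_expRN t)) _).
  by rewrite /gamma_integrand addrK; ring.
have H0 t : 0 <= H t by rewrite mulr_ge0 ?powR_ge0 ?expR_ge0.
pose I s' n := \int[leb]_(x in `[1 / n.+1%:R, n.+1%:R]) gamma_integrand s' x.
have sub n : (`[1 / n.+1%:R, n.+1%:R]%classic : set R) `<=` `]0, +oo[%classic.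
  by move=> x; rewrite (itv0y_bigcup ltr01) => ?; exists n.
have int s' n : 0 < s' -> leb.-integrable `[1 / n.+1%:R, n.+1%:R] (EFin \o gamma_integrand s').
  by move=> s'0; apply: integrableS (gamma_integrable s'0).
have cI s' : 0 < s' -> I s' @ \oo --> Gamma s'.
  move=> s'0; apply: (@fine_cvg _ _ _ _ (fun n => \int[leb]_(x in `[(1 / n.+1%:R)%R, n.+1%:R]) (gamma_integrand s' x)%:E)%E).
  rewrite EFin_Gamma//; apply: (cvg_integral_itv0y ltr01).
    exact: measurable_gamma_integrand.
  by move=> x _; rewrite lee_fin gamma_integrand_ge0.
have E n : s * I s n - I (s + 1) n = H n.+1%:R - H (n.+1%:R^-1).
  rewrite -[n.+1%:R^-1]div1r.
  rewrite /I -RintegralZl ?int// -RintegralB ?int//; last first.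
    exact: (@integrableZl _ _ _ leb _ _ s (EFin \o gamma_integrand s) (int _ _ s0)).
  rewrite /Rintegral (_ : integral _ _ _ = (H n.+1%:R - H (1 / n.+1%:R))%:E)//.
  apply: FTC_itv.
  - by rewrite ler_pdivrMr// -natrM (ler_nat _ 1).
  - by move=> x /andP[+ _] => /(lt_le_trans _) x0; apply: dH; apply: x0; rewrite divr_gt0.
  - move=> x /andP[+ _] => /(lt_le_trans _) x0.
    have {}x0 : 0 < x by apply: x0; rewrite divr_gt0.
    apply: continuousB; last exact: continuous_gamma_integrand.
    by apply: continuousM; [exact: cst_continuous|exact: continuous_gamma_integrand].
have c1 : (H n.+1%:R - H (n.+1%:R^-1)) @[n --> \oo] --> s * Gamma s - Gamma (s + 1).
  under eq_fun do rewrite -E.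
  by apply: cvgB; [apply: cvgMr; exact: cI | exact: cI].
have c2 : (H n.+1%:R - H (n.+1%:R^-1)) @[n --> \oo] --> (0 - 0 : R).
  apply: cvgB.
    pose C := expR 1 * (s + 1) `^ (s + 1).
    apply: (@squeeze_cvgr _ _ _ _ (fun=> 0) (fun n => C * n.+1%:R^-1)).
    + apply: nearW => n; rewrite H0/= /H.
      have n0 : 0 < n.+1%:R :> R by [].
      apply: le_trans (_ : n.+1%:R `^ s * (C * n.+1%:R `^ (- (s + 1))) <= _).
        apply: ler_wpM2l; first exact: powR_ge0.
        apply: (le_trans (expRN_le_powR s10 (ltW n0))).
        apply: ler_wpM2l; first by rewrite mulr_ge0 ?expR_ge0 ?powR_ge0.
        rewrite !powRN lef_pV2 ?posrE ?powR_gt0 ?addr_gt0//.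
        by apply: ge0_ler_powR; rewrite ?nnegrE ?lerDr ?ltW ?addr_gt0.
      rewrite mulrCA -powRD ?(gt_eqF n0) ?implybT//.
      by rewrite opprD addrA subrr add0r powR_inv1.
    + exact: cvg_cst.
    + by rewrite -(mulr0 C); apply: cvgMr; exact: cvg_harmonic.
  apply: (@squeeze_cvgr _ _ _ _ (fun=> 0) (fun n => n.+1%:R^-1 `^ s)).
  + apply: nearW => n; rewrite H0/= /H ler_piMr ?powR_ge0// ?expR_le1 ?oppr_le0 ?invr_ge0//.
  + exact: cvg_cst.
  + exact: cvg_inv_powR.
have /eqP : s * Gamma s - Gamma (s + 1) = 0 - 0.
  exact: (cvg_unique (@Rhausdorff R) c1 c2).
by rewrite subrr subr_eq0 => /eqP.
Qed.

(** The substitution $t = A/u$, made on the intervals $[A/n, n]$ that it preserves. *)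
Lemma integral_inv_gamma s A : 0 < s -> 0 < A ->
  (\int[leb]_(t in `]0%R, +oo[) (t `^ (- s - 1) * expR (- (A / t)))%:E =
   (A `^ (- s) * Gamma s)%:E)%E.
Proof.
move=> s0 A0.
pose g t := t `^ (- s - 1) * expR (- (A / t)).
have g0 t : 0 <= g t by rewrite mulr_ge0 ?powR_ge0 ?expR_ge0.
have dF t : 0 < t -> is_derive t 1 (fun y : R => A / y) (- (A / t ^+ 2)).
  move=> t0; have t1 : t != 0 by rewrite gt_eqF.
  refine (rderE (rderM (rder_cst A t) (rderV t1 (rder_id t))) _) => /=.
  by field.
have F'E t : 0 < t -> (fun y : R => A / y)^`()%classic t = - (A / t ^+ 2).
  by move=> t0; rewrite derive1E; have [_ ->] := dF t t0.
have cF' t : 0 < t -> {for t, continuous (fun y : R => - (A / y ^+ 2))}.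
  move=> t0; have t1 : t ^+ 2 != 0 by rewrite expf_neq0// gt_eqF.
  have d2 : is_derive t 1 (fun y : R => y ^+ 2) _ := rderM (rder_id t) (rder_id t).
  have d3 : is_derive t 1 (fun y : R => - (A / y ^+ 2)) _ :=
    rderN (rderM (rder_cst A t) (rderV (f := fun y : R => y ^+ 2) t1 d2)).
  exact: (rder_continuous d3).
have cF't t : 0 < t -> {for t, continuous (fun y : R => A / y)^`()%classic}.
  move=> t0; rewrite /prop_for /continuous_at F'E//.
  apply: cvg_trans (cF' t t0); apply: near_eq_cvg.
  near=> z; rewrite F'E//; near: z; exact: lt_nbhsr.
have gE t : 0 < t -> A `^ s * g t = (gamma_integrand s \o (fun y : R => A / y)) t * (A / t ^+ 2).
  move=> t0 /=; rewrite /g /gamma_integrand powRM ?invr_ge0 ?ltW//.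
  rewrite -[t^-1]powR_inv1 ?ltW// -[_ `^ (-1) `^ _]powRrM.
  rewrite -(powR_mulrn 2 (ltW t0)) -powRN.
  have -> : - s - 1 = (-1 * (s - 1) - 2) by lra.
  rewrite [t `^ (_ - 2)]powRD ?(gt_eqF t0) ?implybT//.
  have -> : A `^ s = A `^ (s - 1) * A.
    by rewrite -[X in _ * X](powRr1 (ltW A0)) -powRD ?subrK// (gt_eqF A0) implybT.
  by rewrite powR_inv1 ?ltW//; ring.
have cg t : 0 < t -> {for t, continuous g}.
  move=> t0; apply: continuousM; first exact: continuous_powR_pos.
  exact: (rder_continuous (rder_comp (dF t t0) (is_derive_expRN _))).
have step n : (\int[leb]_(x in `[(A / n.+1%:R)%R, n.+1%:R]) (gamma_integrand s x)%:E =
   (A `^ s)%:E * \int[leb]_(x in `[(A / n.+1%:R)%R, n.+1%:R]) (g x)%:E)%E.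
  have n0 : 0 < n.+1%:R :> R by [].
  have FF : n.+1%:R = A / (A / n.+1%:R) by field; rewrite gt_eqF//= (gt_eqF A0).
  have le : A / n.+1%:R <= n.+1%:R \/ n.+1%:R < A / n.+1%:R by case: leP; [left|right].
  have [{}le|gt] := le; last by rewrite set_itv_ge ?integral_set0 ?mule0// -leNgt bnd_simp.
  have pos x : x \in `[A / n.+1%:R, n.+1%:R] -> 0 < x.
    by rewrite in_itv/= => /andP[+ _]; apply: lt_le_trans; rewrite divr_gt0.
  have pos' x : x \in `]A / n.+1%:R, n.+1%:R[ -> 0 < x.
    by rewrite in_itv/= => /andP[+ _]; apply: lt_trans; rewrite divr_gt0.
  have a0 : 0 < A / n.+1%:R by rewrite divr_gt0.
  have := @integration_by_substitution_decreasing R (fun y : R => A / y)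
    (gamma_integrand s) _ _ le.
  rewrite -FF => ->; last 6 first.
  - by move=> x y /pos x0 /pos y0 xy; rewrite ltr_pM2l// ltf_pV2 ?posrE.
  - by move=> x /pos'/cF't.
  - by apply: cvgP; apply: cvg_at_right_filter; exact: cF't.
  - by apply: cvgP; apply: cvg_at_left_filter; exact: cF't.
  - split.
    + by move=> x /pos'/dF[].
    + by apply: cvg_at_right_filter; exact: (rder_continuous (dF _ a0)).
    + by apply: cvg_at_left_filter; exact: (rder_continuous (dF _ n0)).
  - apply: continuous_in_subspaceT => x; rewrite inE/= => /pos.
    exact: continuous_gamma_integrand.
  rewrite -ge0_integralZl//; last 3 first.
  - apply/measurable_EFinP; apply: (@measurable_funS _ _ _ _ `](0:R), +oo[%classic) => //.
      by move=> x /= /pos x0; rewrite in_itv/= andbT.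
    exact: measurable_fun_pos cg.
  - by move=> x _; rewrite lee_fin g0.
  - by rewrite lee_fin powR_ge0.
  apply: eq_integral => x; rewrite inE/= => /pos x0.
  rewrite -EFinM gE//; congr EFin.
  by rewrite -[LHS]/(gamma_integrand s (A / x) * - ((fun y : R => A / y)^`()%classic x)) F'E// opprK.
have mg : measurable_fun `](0:R), +oo[ (EFin \o g).
  by apply/measurable_EFinP; exact: measurable_fun_pos cg.
have c1 := cvg_integral_itv0y A0 (measurable_gamma_integrand s)
  (fun x _ => (gamma_integrand_ge0 s x : (0 <= (gamma_integrand s x)%:E)%E)).
have c2 := cvg_integral_itv0y A0 mg (fun x _ => (g0 x : (0 <= (g x)%:E)%E)).
have c3 : (\int[leb]_(x in `[(A / n.+1%:R)%R, n.+1%:R]) (gamma_integrand s x)%:E @[n --> \oo] -->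
   ((A `^ s)%:E * \int[leb]_(x in `]0%R, +oo[) (g x)%:E))%E.
  under eq_fun do rewrite step.
  exact: cvgeZl.
have := cvg_unique (@ereal_hausdorff R) c1 c3; rewrite -EFin_Gamma// EFinM => ->.
rewrite muleA -EFinM -powRD ?(gt_eqF A0) ?implybT//.
by rewrite addNr powRr0 mul1e.
Unshelve. all: by end_near.
Qed.

End gamma.

(** * Powers and geometric series *)
Section scalar.
Context {R : realType}.

Lemma exprn_powR (x e : R) n : 0 <= x -> (x ^+ n) `^ e = (x `^ e) ^+ n.
Proof. by move=> x0; rewrite -(powR_mulrn _ x0) powRAC powR_mulrn ?powR_ge0. Qed.

Lemma poweR_le (q : R) (x y : \bar R) : 0 <= q -> (x <= y)%E -> (0 <= x)%E ->
  (x `^ q <= y `^ q)%E.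
Proof.
move=> q0 xy x0; apply: gt0_ler_poweR => //; rewrite in_itv/= leey andbT//.
exact: le_trans xy.
Qed.

Lemma eseries_geometric (a c : R) : 0 <= a -> 0 <= c -> c < 1 ->
  (\sum_(0 <= j <oo) (a * c ^+ j)%:E = (a / (1 - c))%:E)%E.
Proof.
move=> a0 c0 c1; apply/cvg_lim => //.
under eq_fun do rewrite sumEFin.
apply: cvg_EFin; first by apply: nearW.
rewrite (_ : _ \o _ = series (geometric a c))//.
by apply: cvg_geometric_series; rewrite ger0_norm.
Qed.

(** A substitute for the triangle inequality in $\ell^q$, uniform in $q$: if the weighted $q$-sum is
    finite then each term is at most a geometric one. *)
Lemma powere_nneseries_le (h : nat -> R) (q c : R) : 0 < q -> 0 < c < 1 ->
  (forall j, 0 <= h j) ->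
  ((\sum_(0 <= j <oo) (h j)%:E) `^ q <=
   ((1 - c)^-1 `^ q)%:E * \sum_(0 <= j <oo) ((h j / c ^+ j) `^ q)%:E)%E.
Proof.
move=> q0 /andP[c0 c1] h0.
have C0 : 0 < (1 - c)^-1 by rewrite invr_gt0 subr_gt0.
set S := (\sum_(0 <= j <oo) ((h j / c ^+ j) `^ q)%:E)%E.
have S0 : (0 <= S)%E by apply: nneseries_ge0 => n _ _; rewrite lee_fin powR_ge0.
have [Sy|Sfin] := eqVneq S +oo%E.
  by rewrite Sy gt0_muley ?leey// lte_fin powR_gt0.
have Sr : S \is a fin_num by rewrite ge0_fin_numE// ltey.
have hj j : h j <= fine S `^ q^-1 * c ^+ j.
  rewrite -ler_pdivrMr ?exprn_gt0//.
  have : (h j / c ^+ j) `^ q <= fine S.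
    rewrite -lee_fin fineK// /S (nneseries_split 0 j.+1); last by move=> *; rewrite lee_fin powR_ge0.
    rewrite add0n big_nat_recr//=.
    rewrite (le_trans _ (leeDl _ _))//; last by apply: nneseries_ge0 => n _ _; rewrite lee_fin powR_ge0.
    by rewrite leeDr// sume_ge0// => i _; rewrite lee_fin powR_ge0.
  move=> /(ge0_ler_powR (r := q^-1)); rewrite -powRrM mulfV ?gt_eqF// powRr1 ?divr_ge0 ?exprn_ge0 ?(ltW c0)//.
  by apply; rewrite ?nnegrE ?invr_ge0 ?powR_ge0 ?(ltW q0) ?fine_ge0.
have : (\sum_(0 <= j <oo) (h j)%:E <= (fine S `^ q^-1 * (1 - c)^-1)%:E)%E.
  rewrite -eseries_geometric ?powR_ge0 ?(ltW c0)//.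
  by apply: lee_nneseries => // *; rewrite lee_fin.
move=> /(poweR_le (ltW q0)) le; apply: (le_trans (le _)).
  by apply: nneseries_ge0 => n _ _; rewrite lee_fin.
rewrite poweR_EFin powRM ?powR_ge0 ?(ltW C0)// -powRrM mulVf ?gt_eqF// powRr1 ?fine_ge0//.
by rewrite EFinM fineK// muleC.
Qed.

Lemma powR2_gt1 (e : R) : 0 < e -> 1 < 2 `^ e.
Proof.
by move=> e0; rewrite /powR pnatr_eq0/= -[ltLHS]expR0 ltr_expR mulr_gt0// ln_gt0// ltr1n.
Qed.

Lemma powR2N_lt1 (e : R) : 0 < e -> 2 `^ (- e) < 1.
Proof. by move=> e0; rewrite powRN invf_lt1 ?powR_gt0// powR2_gt1. Qed.

(** The partial sums of a geometric progression cut off at the level [X] are controlled by the last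
    term that survives. *)
Lemma sum_pow2_lt (X e : R) (N : nat) : 0 < X -> 0 < e ->
  (\sum_(0 <= n < N) (2 `^ e) ^+ n * (2 ^+ n < X)%R%:R) * (1 - 2 `^ (- e)) <= X `^ e.
Proof.
move=> X0 e0; pose s := 2 `^ e : R.
have s0 : 0 < s by rewrite powR_gt0.
have s1 : 1 < s by exact: powR2_gt1.
have sE : 2 `^ (- e) = s^-1 by rewrite powRN.
rewrite sE.
have -> : 1 - s^-1 = (s - 1) / s by field; rewrite gt_eqF.
rewrite mulrA ler_pdivrMr// -/s.
(* the second bound carries the induction *)
suff : \sum_(0 <= n < N) s ^+ n * (2 ^+ n < X)%R%:R * (s - 1) <= Num.min (X `^ e * s) (s ^+ N).
  by rewrite -mulr_suml le_min => /andP[].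
elim: N => [|N IH].
  by rewrite big_geq// le_min expr0 ler01 mulr_ge0 ?powR_ge0 ?ltW.
rewrite big_nat_recr//=; move: IH; rewrite !le_min => /andP[IH1 IH2].
have [NX|NX] := ltP (2 ^+ N) X; last first.
  have -> : s ^+ N * false%:R * (s - 1) = 0 by rewrite /= mulr0 mul0r.
  by rewrite addr0 IH1/= (le_trans IH2)// exprS ler_peMl ?exprn_ge0 ?(ltW s0) ?(ltW s1).
rewrite mulr1n.
have h : s ^+ N + s ^+ N * 1 * (s - 1) = s ^+ N.+1 by rewrite exprS; ring.
rewrite -[X in _ && (_ <= X)]h lerD2r IH2 andbT; apply: (le_trans (lerD IH2 (lexx _))).
rewrite h exprSr ler_pM2r// -exprn_powR//.
by apply: ge0_ler_powR; rewrite ?nnegrE ?exprn_ge0 ?(ltW e0) ?(ltW X0) ?(ltW NX).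
Qed.

Lemma nneseries_pow2_lt (X e : R) : 0 <= X -> 0 < e ->
  (\sum_(0 <= n <oo) ((2 `^ e) ^+ n * (2 ^+ n < X)%R%:R)%:E <=
    (X `^ e / (1 - 2 `^ (- e)))%:E)%E.
Proof.
move=> X0 e0.
have s1 : 0 < 1 - 2 `^ (- e) :> R by rewrite subr_gt0 powR2N_lt1.
move: X0; rewrite le_eqVlt => /predU1P[<-|X0].
  rewrite eseries0 => [|n _ _]; first by rewrite lee_fin divr_ge0 ?powR_ge0 ?ltW.
  by rewrite ltNge exprn_ge0// mulr0.
apply: lime_le; first by apply: is_cvg_nneseries => n _ _; rewrite lee_fin mulr_ge0// exprn_ge0// powR_ge0.
apply: nearW => N; rewrite sumEFin lee_fin ler_pdivlMr//.
exact: sum_pow2_lt.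
Qed.

Lemma eseries_geometric_tail (a c : R) n : 0 <= a -> 0 < c -> c < 1 ->
  (\sum_(0 <= j <oo) (a * c ^+ j * (n <= j)%N%:R)%:E <= (a * c ^+ n / (1 - c))%:E)%E.
Proof.
move=> a0 c0 c1; apply: lime_le.
  by apply: is_cvg_nneseries => j _ _; rewrite lee_fin !mulr_ge0// exprn_ge0// ltW.
apply: nearW => N; rewrite sumEFin lee_fin ler_pdivlMr ?subr_gt0//.
under eq_bigr do rewrite -mulrA; rewrite -mulr_sumr -mulrA; apply: ler_wpM2l => //.
suff -> : (\sum_(0 <= j < N) c ^+ j * (n <= j)%N%:R) * (1 - c) = c ^+ n - c ^+ maxn n N.
  by rewrite gerBl exprn_ge0// ltW.
elim: N => [|N IH]; first by rewrite big_geq// maxn0 mul0r subrr.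
rewrite big_nat_recr//= mulrDl IH; have [nN|Nn] := leqP n N.
  by rewrite (maxn_idPr (leqW nN)) exprS -[true%:R]/(1 : R); ring.
by rewrite (maxn_idPl Nn) -[false%:R]/(0 : R); ring.
Qed.

Lemma eseries_geometric_head (a r : R) n : 0 <= a -> 1 < r ->
  (\sum_(0 <= j <oo) (a * r ^+ j * (j < n)%N%:R)%:E <= (a * r ^+ n / (r - 1))%:E)%E.
Proof.
move=> a0 r1; have r0 : 0 < r by exact: lt_trans r1.
apply: lime_le.
  by apply: is_cvg_nneseries => j _ _; rewrite lee_fin !mulr_ge0// exprn_ge0// ltW.
apply: nearW => N; rewrite sumEFin lee_fin ler_pdivlMr ?subr_gt0//.
under eq_bigr do rewrite -mulrA; rewrite -mulr_sumr -mulrA; apply: ler_wpM2l => //.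
suff -> : (\sum_(0 <= j < N) r ^+ j * (j < n)%N%:R) * (r - 1) = r ^+ minn n N - 1.
  rewrite lerBlDr ler_wpDr//; apply: ler_weXn2l; rewrite ?geq_minl//; exact: ltW.
elim: N => [|N IH]; first by rewrite big_geq// minn0 mul0r subrr.
rewrite big_nat_recr//= mulrDl IH; have [nN|Nn] := leqP n N.
  by rewrite (minn_idPl (leqW nN)) -[false%:R]/(0 : R); ring.
by rewrite (minn_idPr Nn) exprS -[true%:R]/(1 : R); ring.
Qed.

Lemma pow2_bracket (u : R) : 1 < u -> exists n, 2 ^+ n < u <= 2 ^+ n.+1.
Proof.
move=> u1.
have ex : exists m, u <= 2 ^+ m.
  exists (Num.truncn u).+1; apply: (le_trans (ltW (truncnS_gt u))).
  by rewrite -natrX ler_nat ltnW// ltn_expl.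
case: (ex_minnP ex) => -[|m] um min; first by move: um; rewrite expr0 leNgt u1.
exists m; rewrite um andbT ltNge; apply/negP => /min; by rewrite ltnn.
Qed.

End scalar.

(** * Dyadic series of indicator kernels *)
Section kernel_operator.
Context d (T : measurableType d) (R : realType).
Context (mu : {sigma_finite_measure set T -> \bar R}).
Implicit Types (E : set (T * T)) (F : T -> R) (p q A : R).

Definition set_op E F (x : T) : \bar R := (\int[mu]_y (\1_E (x, y) * F y)%:E)%E.

Let mint E F : measurable E -> measurable_fun setT F ->
  measurable_fun [set: T * T] (fun z : T * T => (\1_E z * F z.2)%:E).
Proof.
move=> mE mF; apply/measurable_EFinP; apply: measurable_funM => //.
exact: measurableT_comp.
Qed.

Let mslice E F x : measurable E -> measurable_fun setT F ->
  measurable_fun [set: T] (fun y : T => (\1_E (x, y) * F y)%:E).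
Proof.
move=> mE mF.
exact: (measurableT_comp (mint mE mF) (measurable_pair1 x)).
Qed.

Lemma set_op_ge0 E F x : (forall y, 0 <= F y) -> (0 <= set_op E F x)%E.
Proof. by move=> F0; apply: integral_ge0 => y _; rewrite lee_fin mulr_ge0. Qed.

Lemma measurable_set_op E F : measurable E -> measurable_fun setT F ->
  (forall y, 0 <= F y) -> measurable_fun setT (set_op E F).
Proof.
move=> mE mF F0.
have := @measurable_fun_fubini_tonelli_F _ _ _ _ _ mu
  (fun z : T * T => (\1_E z * F z.2)%:E) (mint mE mF).
by apply => z; rewrite lee_fin mulr_ge0.
Qed.

Let slice_mu E x : measurable E ->
  (\int[mu]_y (\1_E (x, y))%:E = mu (xsection E x))%E.
Proof.
move=> mE; rewrite -(setIT (xsection E x)) -integral_indic//; last exact: measurable_xsection.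
by apply: eq_integral => y _; rewrite !indicE mem_xsection.
Qed.

Let yslice_mu E y : measurable E ->
  (\int[mu]_x (\1_E (x, y))%:E = mu (ysection E y))%E.
Proof.
move=> mE; rewrite -(setIT (ysection E y)) -integral_indic//; last exact: measurable_ysection.
by apply: eq_integral => x _; rewrite !indicE mem_ysection.
Qed.

(** Hoelder's inequality against the indicator of the slice, that is, Jensen's inequality for the
    normalised measure of the slice. *)
Lemma set_op_jensen E F p A x : measurable E -> measurable_fun setT F ->
  (forall y, 0 <= F y) -> 1 <= p -> 0 <= A -> (mu (xsection E x) <= A%:E)%E ->
  ((set_op E F x) `^ p <= (A `^ (p - 1))%:E * set_op E (fun y => (F y `^ p)%R) x)%E.
Proof.
move=> mE mF F0 p1 A0 muA.
have S0 : (0 <= set_op E (fun y => (F y `^ p)%R) x)%E by apply: set_op_ge0 => y; exact: powR_ge0.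
move: p1; rewrite le_eqVlt => /predU1P[<-|p1].
  rewrite subrr powRr0 mul1e poweRe1 ?set_op_ge0//.
  by under [leRHS]eq_integral do rewrite powRr1//.
have p0 : 0 < p by exact: lt_trans p1.
have pN0 : p != 0 by rewrite gt_eqF.
pose q := p / (p - 1).
have p10 : 0 < p - 1 by rewrite subr_gt0.
have q0 : 0 < q by rewrite divr_gt0.
have pq : p^-1 + q^-1 = 1 by rewrite /q; field; rewrite pN0 gt_eqF.
have mf1 : measurable_fun setT (fun y => \1_E (x, y) * F y) by exact/measurable_EFinP/mslice.
have m1 : measurable_fun setT (fun y => \1_E (x, y) : R).
  have := mslice (F := fun=> 1) x mE (measurable_cst _).
  by move=> /measurable_EFinP; under eq_fun do rewrite mulr1.
have := hoelder mu mf1 m1 p0 q0 pq.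
have -> : ('N[mu]_1[EFin \o ((fun y => \1_E (x, y) * F y) \* (fun y => \1_E (x, y)))%R] = set_op E F x)%E.
  rewrite Lnorm1; apply: eq_integral => y _ /=.
  by rewrite ger0_norm ?mulr_ge0// indicE; case: (_ \in _); rewrite ?mul1r ?mulr1 ?mul0r.
move=> /(poweR_le (ltW p0)) => /(_ (set_op_ge0 _ _ F0)) /le_trans; apply.
rewrite poweRM ?Lnorm_ge0// poweR_Lnorm//.
rewrite muleC; apply: lee_pmul; rewrite ?poweR_ge0//.
- by apply: integral_ge0 => y _; rewrite poweR_ge0.
- rewrite unlock -poweRrM.
  have -> : (\int[mu]_y `|(EFin \o (fun y => \1_E (x, y) : R)) y| `^ q = mu (xsection E x))%E.
    rewrite -slice_mu//; apply: eq_integral => y _ /=.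
    by rewrite indicE; case: (_ \in _); rewrite ?normr0 ?normr1 ?powR1// powR0 ?gt_eqF.
  have -> : q^-1 * p = p - 1 by rewrite /q; field; rewrite pN0 gt_eqF.
  by rewrite -poweR_EFin; apply: poweR_le; rewrite ?(ltW p10).
- rewrite le_eqVlt; apply/orP; left; apply/eqP; apply: eq_integral => y _ /=.
  rewrite indicE; case: (_ \in _); rewrite ?mul0r ?normr0 ?mul1r; first by rewrite ger0_norm.
  by rewrite powR0.
Qed.

(** Tonelli's theorem brings in the slices in the other direction. *)
Lemma set_op_L1 E F A : measurable E -> measurable_fun setT F ->
  (forall y, 0 <= F y) -> 0 <= A -> (forall y, mu (ysection E y) <= A%:E)%E ->
  (\int[mu]_x set_op E F x <= A%:E * \int[mu]_y (F y)%:E)%E.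
Proof.
move=> mE mF F0 A0 muA.
rewrite /set_op (@fubini_tonelli _ _ _ _ _ mu mu (fun z => (\1_E z * F z.2)%:E) (mint mE mF)); last first.
  by move=> z; rewrite lee_fin mulr_ge0.
rewrite -ge0_integralZl//; last 2 first.
- exact/measurable_EFinP.
- by move=> x _; rewrite lee_fin.
have m1 y : measurable_fun setT (fun x => (\1_E (x, y))%:E : \bar R).
  have := (measurableT_comp (mint (F := fun=> 1) mE (measurable_cst _)) (measurable_pair2 y)).
  by apply: eq_measurable_fun => x _ /=; rewrite mulr1.
have E1 y : (\int[mu]_x (\1_E (x, y) * F y)%:E = mu (ysection E y) * (F y)%:E)%E.
  rewrite -yslice_mu//; under eq_integral do rewrite EFinM.
  by rewrite ge0_integralZr// lee_fin.
rewrite [leLHS](@eq_integral _ _ _ mu setT (fun y => mu (ysection E y) * (F y)%:E)%E); last first.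
  by move=> y _; exact: E1.
apply: ge0_le_integral => //.
- by move=> y _; rewrite mule_ge0 ?lee_fin.
- apply: emeasurable_funM; last exact/measurable_EFinP.
  exact: measurable_fun_ysection.
- by apply: emeasurable_funM => //; exact/measurable_EFinP.
- by move=> y _; apply: lee_wpmul2r; rewrite ?lee_fin.
Qed.

Lemma set_op_sup E F p A x : measurable E -> measurable_fun setT F ->
  (forall y, 0 <= F y) -> 1 <= p -> 0 <= A -> (mu (xsection E x) <= A%:E)%E ->
  (\int[mu]_y (F y `^ p)%:E <= 1)%E ->
  (set_op E F x <= (A `^ (1 - p^-1))%:E)%E.
Proof.
move=> mE mF F0 p1 A0 muA F1.
have p0 : 0 < p by exact: lt_le_trans p1.
have mFp : measurable_fun setT (fun y => F y `^ p) by apply: (measurableT_comp (measurable_powR p)).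
have h : ((set_op E F x) `^ p <= (A `^ (p - 1))%:E)%E.
  apply: (le_trans (set_op_jensen mE mF F0 p1 A0 muA)).
  rewrite -[leRHS]mule1; apply: lee_wpmul2l; first by rewrite lee_fin powR_ge0.
  apply: le_trans F1; apply: ge0_le_integral => //.
  - by move=> y _; rewrite lee_fin mulr_ge0 ?powR_ge0.
  - exact: mslice.
  - exact/measurable_EFinP.
  - by move=> y _; rewrite lee_fin ler_piMl ?powR_ge0// indicE; case: (_ \in _).
have := poweR_le (q := p^-1) _ h; rewrite -poweRrM mulfV ?gt_eqF// poweRe1 ?set_op_ge0//.
rewrite poweR_EFin -powRrM mulrBl mulfV ?gt_eqF// mul1r; apply; rewrite ?poweR_ge0//.
by rewrite invr_ge0 ltW.
Qed.

(** Young's inequality: of the $q$ powers of the operator, $q - p$ are estimated uniformly, $p$ by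
    Jensen's inequality and Tonelli. *)
Lemma set_op_young E F p q A : measurable E -> measurable_fun setT F ->
  (forall y, 0 <= F y) -> 1 <= p -> p <= q -> 0 < A ->
  (forall x, mu (xsection E x) <= A%:E)%E ->
  (forall y, mu (ysection E y) <= A%:E)%E ->
  (\int[mu]_y (F y `^ p)%:E <= 1)%E ->
  (\int[mu]_x (set_op E F x) `^ q <= ((A `^ (1 - p^-1 + q^-1)) `^ q)%:E)%E.
Proof.
move=> mE mF F0 p1 pq A0 muA muA' F1.
have p0 : 0 < p by exact: lt_le_trans p1.
have q0 : 0 < q by exact: lt_le_trans pq.
have mFp : measurable_fun setT (fun y => F y `^ p) by apply: (measurableT_comp (measurable_powR p)).
have Fp0 y : 0 <= F y `^ p by exact: powR_ge0.
have mS := measurable_set_op mE mF F0.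
have mSp := measurable_set_op mE mFp Fp0.
pose B := (A `^ (1 - p^-1)) `^ (q - p) * A `^ (p - 1).
have B0 : 0 <= B by rewrite mulr_ge0 ?powR_ge0.
apply: (@le_trans _ _ (\int[mu]_x (B%:E * set_op E (fun y => (F y `^ p)%R) x))%E).
  apply: ge0_le_integral => //.
  - by move=> x _; exact: poweR_ge0.
  - exact: (measurableT_comp (measurable_poweR q)).
  - exact: measurable_funeM.
  move=> x _; rewrite /B EFinM -muleA.
  have -> : (set_op E F x `^ q = set_op E F x `^ (q - p) * set_op E F x `^ p)%E.
    by rewrite -poweRD ?subrK// ?add_neq0_poweRD_def// subrK gt_eqF.
  apply: lee_pmul; rewrite ?poweR_ge0//.
    rewrite -poweR_EFin; apply: poweR_le; rewrite ?subr_ge0 ?set_op_ge0//.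
    by apply: set_op_sup => //; exact: ltW.
  by apply: set_op_jensen => //; exact: ltW.
rewrite ge0_integralZl//; last by move=> x _; exact: set_op_ge0.
apply: (@le_trans _ _ (B%:E * (A%:E * 1))%E).
  apply: lee_wpmul2l; first by rewrite lee_fin.
  apply: (le_trans (set_op_L1 mE mFp Fp0 (ltW A0) muA')).
  by apply: lee_wpmul2l; rewrite ?lee_fin ?(ltW A0).
rewrite mule1 -EFinM lee_fin /B -mulrA -[X in _ * (_ * X)]powRr1 ?(ltW A0)//.
rewrite -!powRrM -!powRD ?(gt_eqF A0) ?implybT// le_eqVlt; apply/orP; left; apply/eqP.
by congr (_ `^ _); field; rewrite !gt_eqF.
Qed.

Definition series_op (w : nat -> R) (E : nat -> set (T * T)) F (x : T) : \bar R :=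
  (\sum_(0 <= j <oo) ((w j)%:E * set_op (E j) F x))%E.

Lemma series_op_ge0 (w : nat -> R) (E : nat -> set (T * T)) F x : (forall j, 0 <= w j) -> (forall y, 0 <= F y) ->
  (0 <= series_op w E F x)%E.
Proof.
by move=> w0 F0; apply: nneseries_ge0 => j _ _; rewrite mule_ge0 ?lee_fin ?set_op_ge0.
Qed.

Lemma measurable_series_op (w : nat -> R) (E : nat -> set (T * T)) F : (forall j, 0 <= w j) ->
  (forall j, measurable (E j)) -> measurable_fun setT F ->
  (forall y, 0 <= F y) -> measurable_fun setT (series_op w E F).
Proof.
move=> w0 mE mF F0.
apply: (@ge0_emeasurable_sum _ _ _ _ (fun j x => ((w j)%:E * set_op (E j) F x)%E) xpredT).
  by move=> j x _ _; rewrite mule_ge0 ?lee_fin ?set_op_ge0.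
by move=> j _; apply: measurable_funeM; exact: measurable_set_op.
Qed.

Lemma set_op_fin E F p A x : measurable E -> measurable_fun setT F ->
  (forall y, 0 <= F y) -> 1 <= p -> 0 <= A -> (mu (xsection E x) <= A%:E)%E ->
  (\int[mu]_y (F y `^ p)%:E <= 1)%E -> set_op E F x \is a fin_num.
Proof.
move=> mE mF F0 p1 A0 muA F1.
rewrite ge0_fin_numE ?set_op_ge0//.
by apply: le_lt_trans (set_op_sup mE mF F0 p1 A0 muA F1) _; rewrite ltry.
Qed.

(** Young bounds the [j]-th term by $M c^{2j}$; one factor $c^j$ is spent on summing in $L^q$, the
    other one makes the sum of the norms finite. *)
Lemma series_op_strong (w A : nat -> R) (E : nat -> set (T * T)) p q M c :
  (forall j, measurable (E j)) -> (forall j, 0 <= w j) -> (forall j, 0 < A j) ->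
  (forall j x, mu (xsection (E j) x) <= (A j)%:E)%E ->
  (forall j y, mu (ysection (E j) y) <= (A j)%:E)%E ->
  1 <= p -> p <= q -> 0 <= M -> 0 < c < 1 ->
  (forall j, w j * A j `^ (1 - p^-1 + q^-1) <= M * (c ^+ j * c ^+ j)) ->
  exists2 C : R, 0 < C & forall F, measurable_fun setT F -> (forall y, 0 <= F y) ->
    (\int[mu]_y (F y `^ p)%:E <= 1)%E ->
    (\int[mu]_x (series_op w E F x) `^ q <= C%:E)%E.
Proof.
move=> mE w0 A0 muA muA' p1 pq M0 c01 wA.
have /andP[c0 c1] := c01.
have p0 : 0 < p by exact: lt_le_trans p1.
have q0 : 0 < q by exact: lt_le_trans pq.
have cq1 : c `^ q < 1.
  by rewrite /powR gt_eqF// -[ltRHS]expR0 ltr_expR pmulr_rlt0// ln_lt0// c0.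
exists ((1 - c)^-1 `^ q * ((M `^ q + 1) / (1 - c `^ q))).
  by rewrite mulr_gt0 ?powR_gt0 ?divr_gt0 ?invr_gt0 ?subr_gt0// ltr_wpDl ?powR_ge0.
move=> F mF F0 F1.
have fin j x : set_op (E j) F x \is a fin_num.
  by apply: (set_op_fin _ _ _ p1 (ltW (A0 j))).
pose h j x := w j * fine (set_op (E j) F x).
have h0 j x : 0 <= h j x by rewrite mulr_ge0// fine_ge0// set_op_ge0.
have hE j x : ((w j)%:E * set_op (E j) F x = (h j x)%:E)%E by rewrite EFinM fineK.
have mh j : measurable_fun setT (h j).
  apply: measurable_funM => //.
  by apply: (measurableT_comp (fine_measurable measurableT)); exact: measurable_set_op.
have mg j : measurable_fun setT (fun x => ((h j x / c ^+ j) `^ q)%:E).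
  apply/measurable_EFinP; apply: (measurableT_comp (measurable_powR q)).
  exact: measurable_funM.
apply: (@le_trans _ _ (\int[mu]_x (((1 - c)^-1 `^ q)%:E *
    \sum_(0 <= j <oo) ((h j x / c ^+ j) `^ q)%:E))%E).
  apply: ge0_le_integral => //.
  - by move=> x _; exact: poweR_ge0.
  - by apply: (measurableT_comp (measurable_poweR q)); exact: measurable_series_op.
  - apply: measurable_funeM.
    apply: (@ge0_emeasurable_sum _ _ _ _ (fun j x => ((h j x / c ^+ j) `^ q)%:E) xpredT) => //.
    by move=> j x _ _; rewrite lee_fin powR_ge0.
  - move=> x _; rewrite /series_op; under eq_eseriesr do rewrite hE.
    exact: powere_nneseries_le.
rewrite ge0_integralZl//; last 3 first.
- apply: (@ge0_emeasurable_sum _ _ _ _ (fun j x => ((h j x / c ^+ j) `^ q)%:E) xpredT) => //.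
  by move=> j x _ _; rewrite lee_fin powR_ge0.
- by move=> x _; apply: nneseries_ge0 => j _ _; rewrite lee_fin powR_ge0.
- by rewrite lee_fin powR_ge0.
rewrite EFinM; apply: lee_wpmul2l; first by rewrite lee_fin powR_ge0.
rewrite integral_nneseries//; last by move=> j x _; rewrite lee_fin powR_ge0.
rewrite -eseries_geometric ?powR_ge0//; last by rewrite ler_wpDl ?powR_ge0.
apply: lee_nneseries => j _.
  by move=> _; apply: integral_ge0 => x _; rewrite lee_fin powR_ge0.
have cj0 : 0 < c ^+ j by rewrite exprn_gt0.
under eq_integral => x _.
  rewrite /h mulrAC powRM ?fine_ge0 ?set_op_ge0 ?divr_ge0 ?(ltW cj0)//.
  rewrite EFinM -(fine_poweR) fineK ?fin_num_poweR//.
  over.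
rewrite ge0_integralZl//; last 3 first.
- by apply: (measurableT_comp (measurable_poweR q)); exact: measurable_set_op.
- by move=> x _; exact: poweR_ge0.
- by rewrite lee_fin powR_ge0.
apply: (le_trans (lee_wpmul2l _ (set_op_young (mE j) mF F0 p1 pq (A0 j) (muA j) (muA' j) F1))).
  by rewrite lee_fin powR_ge0.
rewrite -EFinM lee_fin -powRM ?powR_ge0 ?divr_ge0 ?(ltW cj0)//.
apply: (@le_trans _ _ ((M * c ^+ j) `^ q)).
  apply: ge0_ler_powR; rewrite ?nnegrE ?(ltW q0) ?mulr_ge0 ?invr_ge0 ?powR_ge0 ?(ltW cj0)//.
  by rewrite mulrAC ler_pdivrMr// -mulrA.
rewrite powRM ?(ltW cj0)// exprn_powR ?(ltW c0)//.
by apply: ler_wpM2r; rewrite ?exprn_ge0 ?powR_ge0// lerDl.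
Qed.

Lemma series_op_sup (w A : nat -> R) (E : nat -> set (T * T)) p M c F x :
  (forall j, measurable (E j)) -> (forall j, 0 <= w j) -> (forall j, 0 < A j) ->
  (forall j, mu (xsection (E j) x) <= (A j)%:E)%E ->
  1 <= p -> 0 <= M -> 0 < c < 1 ->
  (forall j, w j * A j `^ (1 - p^-1) <= M * c ^+ j) ->
  measurable_fun setT F -> (forall y, 0 <= F y) -> (\int[mu]_y (F y `^ p)%:E <= 1)%E ->
  (series_op w E F x <= (M / (1 - c))%:E)%E.
Proof.
move=> mE w0 A0 muA p1 M0 /andP[c0 c1] wA mF F0 F1.
rewrite -eseries_geometric ?(ltW c0)//; apply: lee_nneseries => j _.
  by rewrite mule_ge0 ?lee_fin ?set_op_ge0.
apply: (@le_trans _ _ ((w j)%:E * (A j `^ (1 - p^-1))%:E)%E); last by rewrite -EFinM lee_fin.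
apply: lee_wpmul2l; first by rewrite lee_fin.
by apply: set_op_sup => //; exact: ltW.
Qed.

Lemma set_op_le E F m A x : measurable E -> measurable_fun setT F ->
  (forall y, 0 <= F y <= m) -> 0 <= A -> (mu (xsection E x) <= A%:E)%E ->
  (set_op E F x <= (m * A)%:E)%E.
Proof.
move=> mE mF Fm A0 muA.
have m0 : 0 <= m by have /andP[a b] := Fm point; exact: le_trans b.
apply: (@le_trans _ _ (m%:E * mu (xsection E x))%E); last first.
  by rewrite EFinM; apply: lee_wpmul2l.
have m1 : measurable_fun setT (fun y : T => (\1_E (x, y))%:E : \bar R).
  have := mslice (F := fun=> 1) x mE (measurable_cst _).
  by under eq_fun do rewrite mulr1.
rewrite -slice_mu// -ge0_integralZl//.
apply: ge0_le_integral => //.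
- by move=> y _; rewrite lee_fin mulr_ge0//; have /andP[] := Fm y.
- exact: mslice.
- exact: measurable_funeM.
- by move=> y _; rewrite -EFinM lee_fin mulrC ler_wpM2r//; have /andP[] := Fm y.
Qed.

Lemma set_opD E F (G : T -> R) x : measurable E -> measurable_fun setT F -> measurable_fun setT G ->
  (forall y, 0 <= F y) -> (forall y, 0 <= G y) ->
  set_op E (fun y => F y + G y) x = (set_op E F x + set_op E G x)%E.
Proof.
move=> mE mF mG F0 G0; rewrite /set_op -ge0_integralD//; last 4 first.
- by move=> y _; rewrite lee_fin mulr_ge0.
- exact: mslice.
- by move=> y _; rewrite lee_fin mulr_ge0.
- exact: mslice.
by apply: eq_integral => y _; rewrite mulrDr.
Qed.

(** The weights are critical for Young's inequality from $L^p$ to $L^q$, so summing the norms of the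
    pieces fails. Instead, at a point where the output is of size $2Kr^n$, with $r = 2^{1/q}$, the
    function is cut at the height $s^n$, with $s = 2^{1/p}$. The pieces [j < n], and the lower part of
    the function on the pieces [n <= j], contribute at most $K r^n$ (geometric series), so the upper
    part on the small pieces accounts for half of the output. It is estimated in $L^1$, and summing
    over [n] returns $\int F^p$. *)
Lemma series_op_endpoint (w : nat -> R) (E : nat -> set (T * T)) p q A :
  (forall j, measurable (E j)) -> 0 < A ->
  (forall j x, mu (xsection (E j) x) <= (A * 2^-1 ^+ j)%:E)%E ->
  (forall j y, mu (ysection (E j) y) <= (A * 2^-1 ^+ j)%:E)%E ->
  1 < p -> p < q ->
  (forall j, w j = (2 `^ (1 - p^-1 + q^-1)) ^+ j) ->
  exists2 C : R, 0 < C & forall F, measurable_fun setT F -> (forall y, 0 <= F y) ->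
    (\int[mu]_y (F y `^ p)%:E <= 1)%E ->
    (\int[mu]_x (series_op w E F x) `^ q <= C%:E)%E.
Proof.
move=> mE A0 muA muA' p1 pq wE.
have p0 : 0 < p by exact: lt_trans p1.
have q0 : 0 < q by exact: lt_trans pq.
have w0 j : 0 <= w j by rewrite wE exprn_ge0// powR_ge0.
pose r := 2 `^ q^-1 : R; pose s := 2 `^ p^-1 : R.
have r1 : 1 < r by rewrite powR2_gt1 ?invr_gt0.
have s1 : 1 < s by rewrite powR2_gt1 ?invr_gt0.
have r0 : 0 < r by exact: lt_trans r1.
have s0 : 0 < s by exact: lt_trans s1.
have rs : r < s.
  rewrite /r /s /powR pnatr_eq0/= ltr_expR ltr_pM2r ?ln_gt0 ?ltr1n//.
  by rewrite ltf_pV2.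
have rs1 : r / s < 1 by rewrite ltr_pdivrMr// mul1r.
have rs0 : 0 < r / s by rewrite divr_gt0.
have e0 : 0 < 1 - p^-1 by rewrite subr_gt0 invf_lt1.
have wE2 : 2 `^ (1 - p^-1 + q^-1) = 2 * (r / s) :> R.
  by rewrite /r /s -addrA [- _ + _]addrC !powRD ?pnatr_eq0 ?implybT// powRr1// powRN.
have eE : 2 `^ (1 - p^-1) = 2 / s :> R.
  by rewrite /s powRD ?pnatr_eq0 ?implybT// powRr1// powRN.
(* the off-critical bound L^p -> L^p is used where the operator is small *)
have [Cp Cp0 strong] : exists2 C : R, 0 < C & forall F, measurable_fun setT F -> (forall y, 0 <= F y) ->
    (\int[mu]_y (F y `^ p)%:E <= 1)%E -> (\int[mu]_x (series_op w E F x) `^ p <= C%:E)%E.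
  pose c := Num.sqrt (r / s).
  apply: (@series_op_strong w (fun j => A * 2^-1 ^+ j) E p p A c) => //.
  - by move=> j; rewrite mulr_gt0// exprn_gt0// invr_gt0.
  - exact: ltW.
  - exact: ltW.
  - rewrite sqrtr_gt0 rs0/= -[ltRHS]sqrtr1 ltr_sqrt//.
  - move=> j; rewrite subrK powRr1 ?mulr_ge0 ?exprn_ge0 ?invr_ge0 ?(ltW A0)//.
    rewrite -exprMn -expr2 sqr_sqrtr ?(ltW rs0)// wE wE2 mulrCA ler_wpM2l ?(ltW A0)//.
    by rewrite -exprMn mulrAC divff// mul1r.
pose A1 := A `^ (1 - p^-1); have A10 : 0 < A1 by rewrite powR_gt0.
(* the head of the series costs the first term, the lower part of the function the second *)
pose K := A1 / (r - 1) + A / (1 - r / s).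
have K0 : 0 < K by rewrite addr_gt0 ?divr_gt0 ?subr_gt0.
pose K2 := 2 * K; have K20 : 0 < K2 by rewrite mulr_gt0.
(* $d_n K r^n$ is the largest $q$-th power of the output at level [n] *)
pose dn (n : nat) := K2 `^ q * 2 ^+ n.+1 / (K * r ^+ n).
have dn0 n : 0 <= dn n by rewrite divr_ge0 ?mulr_ge0 ?powR_ge0 ?exprn_ge0 ?(ltW K0) ?(ltW r0).
pose C3 := K2 `^ q * 2 / K * (A / (1 - r / s)).
have C30 : 0 < C3 by rewrite mulr_gt0 ?divr_gt0 ?mulr_gt0 ?powR_gt0 ?subr_gt0.
exists (K2 `^ (q - p) * Cp + C3 / (1 - 2 `^ (- (1 - p^-1)))).
  by rewrite addr_gt0 ?mulr_gt0 ?powR_gt0 ?invr_gt0 ?subr_gt0 ?powR2N_lt1.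
move=> F mF F0 F1.
pose t x := series_op w E F x.
have t0 x : (0 <= t x)%E by exact: series_op_ge0.
have mt : measurable_fun setT t by exact: measurable_series_op.
pose Fgt n y := F y * (s ^+ n < F y)%R%:R.
pose Fle n y := F y * (F y <= s ^+ n)%R%:R.
have mgt n : measurable_fun setT (Fgt n).
  apply: measurable_funM => //.
  by apply: (measurableT_comp (f := fun b : bool => b%:R : R)) => //; exact: measurable_fun_ltr.
have mle n : measurable_fun setT (Fle n).
  apply: measurable_funM => //.
  by apply: (measurableT_comp (f := fun b : bool => b%:R : R)) => //; exact: measurable_fun_ler.
have Fgt0 n y : 0 <= Fgt n y by rewrite mulr_ge0.
have Fle0 n y : 0 <= Fle n y <= s ^+ n.
  rewrite mulr_ge0//=/Fle; have [|_] := leP (F y) (s ^+ n); first by rewrite mulr1.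
  by rewrite mulr0 exprn_ge0// ltW.
have FE n y : F y = Fle n y + Fgt n y.
  by rewrite /Fle /Fgt; case: leP => _; rewrite !(mulr0, mulr1, addr0, add0r).
pose V n x := series_op (fun j => w j * (n <= j)%N%:R) E (Fgt n) x.
have V0 n x : (0 <= V n x)%E by apply: series_op_ge0 => // j; rewrite mulr_ge0.
have mV n : measurable_fun setT (V n) by apply: measurable_series_op => // j; rewrite mulr_ge0.
have wgeo j : w j * (A * 2^-1 ^+ j) = A * (r / s) ^+ j.
  by rewrite wE wE2 mulrCA -exprMn mulrAC divff// mul1r.
(* the three contributions: large pieces, low part, and the remainder [V] *)
have split n x : (t x <= (K * r ^+ n)%:E + V n x)%E.
  rewrite /t /series_op.
  under eq_eseriesr => j _.
    rewrite (_ : (w j)%:E * set_op (E j) F x =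
      (w j * (j < n)%N%:R)%:E * set_op (E j) F x +
      ((w j * (n <= j)%N%:R)%:E * set_op (E j) (Fle n) x +
       (w j * (n <= j)%N%:R)%:E * set_op (E j) (Fgt n) x))%E; last first.
      have [nj|jn] := leqP n j.
        rewrite mulr0 mul0e add0e mulr1 -ge0_muleDr; last 2 first.
          by apply: set_op_ge0 => y; have /andP[] := Fle0 n y.
          exact: set_op_ge0.
        rewrite -set_opD//; last by move=> y; have /andP[] := Fle0 n y.
        by congr (_ * set_op _ _ _)%E; apply/funext => y; exact: FE.
      by rewrite !mulr0 !mul0e !adde0 mulr1.
    over.
  rewrite nneseriesD; last 2 first.
  - by move=> j _; rewrite mule_ge0 ?lee_fin ?mulr_ge0 ?set_op_ge0.
  - move=> j _; rewrite adde_ge0// mule_ge0 ?lee_fin ?mulr_ge0 ?set_op_ge0//.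
    by move=> y; have /andP[] := Fle0 n y.
  rewrite nneseriesD; last 2 first.
  - move=> j _; rewrite mule_ge0 ?lee_fin ?mulr_ge0 ?set_op_ge0//.
    by move=> y; have /andP[] := Fle0 n y.
  - by move=> j _; rewrite mule_ge0 ?lee_fin ?mulr_ge0 ?set_op_ge0.
  rewrite addeA; apply: leeD => //.
  rewrite /K mulrDl EFinD; apply: leeD.
    rewrite mulrAC; apply: le_trans (eseries_geometric_head n (ltW A10) r1).
    apply: lee_nneseries => j _; first by move=> _; rewrite mule_ge0 ?lee_fin ?mulr_ge0 ?set_op_ge0.
    rewrite [leRHS](_ : _ = (w j * (j < n)%N%:R)%:E * ((A * 2^-1 ^+ j) `^ (1 - p^-1))%:E)%E.
      apply: lee_wpmul2l; first by rewrite lee_fin mulr_ge0.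
      by apply: set_op_sup => //; rewrite ?mulr_ge0 ?exprn_ge0 ?invr_ge0 ?(ltW A0) ?(ltW p1).
    rewrite -EFinM powRM ?exprn_ge0 ?invr_ge0 ?(ltW A0)// exprn_powR ?invr_ge0//.
    rewrite -[2^-1]powR_inv1// -powRrM mulN1r powRN eE wE wE2 -/A1; congr EFin.
    have -> : r ^+ j = (2 * (r / s)) ^+ j * (2 / s)^-1 ^+ j.
      by rewrite -exprMn; congr (_ ^+ _); field; rewrite (gt_eqF s0).
    by ring.
  rewrite mulrAC; apply: le_trans (_ : (\sum_(0 <= j <oo)
      (s ^+ n * A * (r / s) ^+ j * (n <= j)%N%:R)%:E <= _)%E); last first.
    apply: le_trans (eseries_geometric_tail n _ rs0 rs1) _; first by rewrite mulr_ge0 ?exprn_ge0 ?(ltW A0) ?(ltW s0).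
    rewrite lee_fin ler_wpM2r ?invr_ge0 ?subr_ge0 ?(ltW rs1)//.
    rewrite mulrAC -exprMn mulrCA divff ?(gt_eqF s0)// mulr1 mulrC//.
  apply: lee_nneseries => j _.
    move=> _; rewrite mule_ge0 ?lee_fin ?mulr_ge0 ?set_op_ge0//.
    by move=> y; have /andP[] := Fle0 n y.
  rewrite [leRHS](_ : _ = (w j * (n <= j)%N%:R)%:E * (s ^+ n * (A * 2^-1 ^+ j))%:E)%E.
    apply: lee_wpmul2l; first by rewrite lee_fin mulr_ge0.
    by apply: set_op_le => //; rewrite ?mulr_ge0 ?exprn_ge0 ?invr_ge0 ?(ltW A0).
  by rewrite -EFinM -[s ^+ n * A * _]mulrA -wgeo; congr EFin; ring.
(* small outputs are left to the $L^p$ bound, large ones to the level that they reach *)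
have point x : (t x `^ q <= (K2 `^ (q - p))%:E * t x `^ p + \sum_(0 <= n <oo) ((dn n)%:E * V n x))%E.
  have S0 : (0 <= \sum_(0 <= n <oo) ((dn n)%:E * V n x))%E.
    by apply: nneseries_ge0 => n _ _; rewrite mule_ge0 ?lee_fin.
  have [ty|tfin] := eqVneq (t x) +oo%E.
    rewrite ty !poweRyr ?gt_eqF// gt0_muley ?lte_fin ?powR_gt0// addye ?leey//.
    by rewrite gt_eqF// (lt_le_trans _ S0)// ltNy0.
  have tr : t x \is a fin_num by rewrite ge0_fin_numE// ltey.
  pose u := (fine (t x) / K2) `^ q.
  have ft0 : 0 <= fine (t x) by rewrite fine_ge0.
  have tu : fine (t x) `^ q = K2 `^ q * u.
    by rewrite -powRM ?(ltW K20) ?divr_ge0 ?(ltW K20)// mulrC divfK// gt_eqF.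
  have tE : fine (t x) = K2 * u `^ q^-1.
    by rewrite -powRrM mulfV ?gt_eqF// powRr1 ?divr_ge0 ?(ltW K20)// mulrC divfK// gt_eqF.
  have [u1|u1] := leP u 1.
    rewrite (le_trans _ (leeDl _ _))//.
    have tK : fine (t x) <= K2.
      rewrite tE ler_piMr ?(ltW K20)// -[leRHS](congr1 (@^~ q^-1) (powR1 R)).
      by apply: ge0_ler_powR; rewrite ?nnegrE ?invr_ge0 ?(ltW q0) ?powR_ge0.
    rewrite -(fineK tr) !poweR_EFin -EFinM lee_fin.
    have -> : fine (t x) `^ q = fine (t x) `^ (q - p) * fine (t x) `^ p.
      by rewrite -powRD ?subrK ?(gt_eqF q0).
    apply: ler_wpM2r; first exact: powR_ge0.
    by apply: ge0_ler_powR; rewrite ?nnegrE ?subr_ge0 ?(ltW pq) ?(ltW K20).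
  have [n /andP[nu un]] := pow2_bracket u1.
  rewrite (le_trans _ (leeDr _ _))//; last by rewrite mule_ge0 ?poweR_ge0 ?lee_fin ?powR_ge0.
  have tn : K2 * r ^+ n < fine (t x).
    rewrite tE ltr_pM2l// -exprn_powR//.
    by apply: gt0_ltr_powR; rewrite ?nnegrE ?invr_gt0 ?exprn_ge0 ?powR_ge0.
  have Vn : ((K * r ^+ n)%:E <= V n x)%E.
    rewrite leNgt; apply/negP => Vlt.
    have := split n x; rewrite leNgt => /negP; apply.
    have Vf : V n x \is a fin_num by rewrite ge0_fin_numE// (lt_trans Vlt)// ltry.
    rewrite -(fineK Vf) -(fineK tr) -EFinD lte_fin; apply: lt_trans tn.
    have -> : K2 * r ^+ n = K * r ^+ n + K * r ^+ n by rewrite /K2; ring.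
    by rewrite ltrD2l -lte_fin fineK.
  apply: (@le_trans _ _ ((dn n)%:E * V n x)%E); last first.
    rewrite (nneseries_split 0 n.+1); last by move=> *; rewrite mule_ge0 ?lee_fin.
    rewrite add0n big_nat_recr//=.
    rewrite (le_trans _ (leeDl _ _))//; last by apply: nneseries_ge0 => k _ _; rewrite mule_ge0 ?lee_fin.
    by rewrite leeDr// sume_ge0// => i _; rewrite mule_ge0 ?lee_fin.
  apply: (@le_trans _ _ ((dn n)%:E * (K * r ^+ n)%:E)%E); last by rewrite lee_wpmul2l ?lee_fin.
  rewrite -EFinM /dn divfK; last by rewrite mulf_neq0 ?expf_neq0 ?gt_eqF.
  rewrite -(fineK tr) poweR_EFin lee_fin tu.
  by rewrite ler_wpM2l ?powR_ge0.
have I1 n : (\int[mu]_y (Fgt n y)%:E <= 1)%E.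
  apply: le_trans F1; apply: ge0_le_integral => //.
  - by move=> y _; rewrite lee_fin.
  - exact/measurable_EFinP.
  - by apply/measurable_EFinP; apply: (measurableT_comp (measurable_powR p)).
  - move=> y _; rewrite lee_fin /Fgt; case: ltP => [sF|_]; last by rewrite mulr0 powR_ge0.
    rewrite mulr1; apply: le1r_powR; rewrite ?(ltW p1)//.
    by apply: le_trans (ltW sF); rewrite exprn_ege1// ltW.
have I0 n : (0 <= \int[mu]_y (Fgt n y)%:E)%E by apply: integral_ge0 => y _; rewrite lee_fin.
have Ifin n : (\int[mu]_y (Fgt n y)%:E)%E \is a fin_num.
  by rewrite ge0_fin_numE// (le_lt_trans (I1 n))// ltry.
have intV n : (\int[mu]_x V n x <= (A * (r / s) ^+ n / (1 - r / s))%:E * \int[mu]_y (Fgt n y)%:E)%E.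
  rewrite /V /series_op integral_nneseries//; last 2 first.
  - by move=> j; apply: measurable_funeM; exact: measurable_set_op.
  - by move=> j x _; rewrite mule_ge0 ?set_op_ge0 ?lee_fin ?mulr_ge0.
  apply: (@le_trans _ _ (\sum_(0 <= j <oo) ((fine (\int[mu]_y (Fgt n y)%:E))%:E *
      (A * (r / s) ^+ j * (n <= j)%N%:R)%:E))%E).
    apply: lee_nneseries => j _.
      move=> _; apply: integral_ge0 => x _.
      by rewrite mule_ge0 ?set_op_ge0 ?lee_fin ?mulr_ge0.
    rewrite fineK// ge0_integralZl//; last 3 first.
    - exact: measurable_set_op.
    - by move=> x _; exact: set_op_ge0.
    - by rewrite lee_fin mulr_ge0.
    rewrite [leRHS](_ : _ = (w j * (n <= j)%N%:R)%:E *
       ((A * 2^-1 ^+ j)%:E * \int[mu]_y (Fgt n y)%:E))%E; last first.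
      by rewrite -wgeo mulrAC EFinM muleC muleA.
    apply: lee_wpmul2l; first by rewrite lee_fin mulr_ge0.
    apply: set_op_L1 => //.
    by rewrite mulr_ge0 ?exprn_ge0 ?invr_ge0 ?(ltW A0).
  rewrite nneseriesZl; last by move=> j _; rewrite lee_fin !mulr_ge0 ?exprn_ge0 ?(ltW A0) ?(ltW rs0).
  rewrite fineK// muleC; apply: lee_wpmul2r => //.
  exact: eseries_geometric_tail (ltW A0) rs0 rs1.
have G0 n : 0 <= C3 * (2 / s) ^+ n.
  by rewrite mulr_ge0 ?(ltW C30)// exprn_ge0// divr_ge0// ltW.
have mdV n : measurable_fun setT (fun x => ((dn n)%:E * V n x)%E) by exact: measurable_funeM.
have dV0 n x : (0 <= (dn n)%:E * V n x)%E by rewrite mule_ge0 ?lee_fin.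
have mtp (e : R) : measurable_fun setT (fun x => (t x `^ e)%E).
  exact: (measurableT_comp (measurable_poweR e)).
have mS : measurable_fun setT (fun x => \sum_(0 <= n <oo) ((dn n)%:E * V n x))%E.
  by apply: (@ge0_emeasurable_sum _ _ _ _ (fun n x => ((dn n)%:E * V n x)%E) xpredT).
have S0 x : (0 <= \sum_(0 <= n <oo) ((dn n)%:E * V n x))%E by apply: nneseries_ge0.
have kp0 x : (0 <= (K2 `^ (q - p))%:E * t x `^ p)%E by rewrite mule_ge0 ?poweR_ge0 ?lee_fin ?powR_ge0.
apply: (@le_trans _ _ (\int[mu]_x ((K2 `^ (q - p))%:E * t x `^ p +
    \sum_(0 <= n <oo) ((dn n)%:E * V n x)))%E).
  apply: ge0_le_integral => //.
  - by move=> x _; exact: poweR_ge0.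
  - by apply: emeasurable_funD => //; exact: measurable_funeM.
rewrite ge0_integralD//; last exact: measurable_funeM.
rewrite EFinD; apply: leeD.
  rewrite ge0_integralZl//; last 2 first.
  - by move=> x _; exact: poweR_ge0.
  - by rewrite lee_fin powR_ge0.
  by rewrite EFinM; apply: lee_wpmul2l; [rewrite lee_fin powR_ge0 | exact: strong].
rewrite integral_nneseries//.
apply: (@le_trans _ _ (\sum_(0 <= n <oo) \int[mu]_y ((C3 * (2 / s) ^+ n)%:E * (Fgt n y)%:E))%E).
  apply: lee_nneseries => n _.
    by move=> _; apply: integral_ge0 => x _.
  rewrite ge0_integralZl//; last by rewrite lee_fin.
  rewrite ge0_integralZl//; last 3 first.
  - exact/measurable_EFinP.
  - by move=> y _; rewrite lee_fin.
  - by rewrite lee_fin mulr_ge0 ?exprn_ge0 ?divr_ge0 ?(ltW C30) ?(ltW s0).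
  rewrite [leRHS](_ : _ = (dn n)%:E * ((A * (r / s) ^+ n / (1 - r / s))%:E * \int[mu]_y (Fgt n y)%:E))%E.
    by apply: lee_wpmul2l; rewrite ?lee_fin.
  rewrite muleA -EFinM; congr (_%:E * _)%E.
  rewrite /dn /C3 exprS !exprMn !exprVn; field.
  by rewrite !expf_neq0 ?(gt_eqF r0) ?(gt_eqF s0) ?(gt_eqF K0)//= subr_eq0 gt_eqF.
rewrite -integral_nneseries//; last 2 first.
- by move=> n; apply: measurable_funeM; exact/measurable_EFinP.
- by move=> n y _; rewrite mule_ge0 ?lee_fin ?G0 ?Fgt0.
pose C4 := C3 / (1 - 2 `^ (- (1 - p^-1))).
have C40 : 0 <= C4 by rewrite divr_ge0 ?(ltW C30)// subr_ge0 ltW// powR2N_lt1.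
have mFp : measurable_fun setT (fun y => F y `^ p) by apply: (measurableT_comp (measurable_powR p)).
apply: (@le_trans _ _ (\int[mu]_y (C4%:E * (F y `^ p)%:E))%E); last first.
  rewrite ge0_integralZl//; last 2 first.
  - exact/measurable_EFinP.
  - by move=> y _; rewrite lee_fin powR_ge0.
  by rewrite -[leRHS]mule1; apply: lee_wpmul2l; rewrite ?lee_fin.
apply: ge0_le_integral => //.
- move=> y _; apply: nneseries_ge0 => n _ _.
  by rewrite mule_ge0 ?lee_fin ?G0 ?Fgt0.
- apply: (@ge0_emeasurable_sum _ _ _ _ (fun n y => ((C3 * (2 / s) ^+ n)%:E * (Fgt n y)%:E)%E) xpredT).
    by move=> n y _ _; rewrite mule_ge0 ?lee_fin ?G0 ?Fgt0.
  by move=> n _; apply: measurable_funeM; exact/measurable_EFinP.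
- by apply: measurable_funeM; exact/measurable_EFinP.
move=> y _.
apply: (@le_trans _ _ (\sum_(0 <= n <oo) ((C3 * F y)%:E * ((2 `^ (1 - p^-1)) ^+ n * (2 ^+ n < F y `^ p)%R%:R)%:E))%E).
  apply: lee_nneseries => n _.
    by move=> _; rewrite mule_ge0 ?lee_fin ?G0 ?Fgt0.
  rewrite -!EFinM lee_fin eE /Fgt mulrACA mulrA [leRHS]mulrA; apply: ler_wpM2l.
    by rewrite mulrAC mulr_ge0.
  case: ltP => // sF; rewrite (_ : 2 ^+ n < F y `^ p)//.
  have -> : 2 = s `^ p :> R by rewrite /s -powRrM mulVf ?powRr1// gt_eqF.
  by rewrite -exprn_powR ?(ltW s0)//; apply: gt0_ltr_powR; rewrite ?nnegrE ?exprn_ge0 ?(ltW s0).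
rewrite nneseriesZl; last by move=> n _; rewrite lee_fin mulr_ge0 ?exprn_ge0 ?powR_ge0.
apply: (le_trans (lee_wpmul2l _ (nneseries_pow2_lt (powR_ge0 _ _) e0))).
  by rewrite lee_fin mulr_ge0 ?(ltW C30).
rewrite -EFinM -EFinM lee_fin /C4 -powRrM mulrBr mulr1 mulfV ?gt_eqF//.
rewrite le_eqVlt; apply/orP; left; apply/eqP.
have -> : F y `^ p = F y * F y `^ (p - 1) by rewrite mulr_powRB1.
by ring.
Qed.

End kernel_operator.

(** * Quotients of Gamma values *)
Section pochhammer.
Context {R : realType}.
Implicit Types (u v : R) (k : nat).

Lemma ln_le_subr1 (x : R) : 0 < x -> ln x <= x - 1.
Proof.
move=> x0; have := @le_ln1Dx R (x - 1).
by rewrite [1 + _]addrC subrK; apply; rewrite ltrBrDr addNr.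
Qed.

(** The shifted logarithms and harmonic sums differ from the unshifted ones by a bounded amount; this is
    all that is used about the growth of Gamma quotients. *)
Lemma ln_natD_bound v : 0 < v ->
  exists2 C : R, 0 <= C & forall k, `|ln (k%:R + v) - ln k.+1%:R| <= C.
Proof.
move=> v0; exists (v + v^-1); first by rewrite ltW// addr_gt0 ?invr_gt0.
move=> k; have kv : 0 < k%:R + v by rewrite ltr_wpDl.
have k1 : 0 < k.+1%:R :> R by [].
have k0 : 0 <= k%:R :> R by [].
have kS : k.+1%:R = k%:R + 1 :> R by rewrite -natr1.
rewrite -ln_div ?posrE//.
rewrite ler_norml; apply/andP; split.
  rewrite lerNl -lnV ?posrE ?divr_gt0// invf_div.
  apply: (le_trans (ln_le_subr1 _)); first by rewrite divr_gt0.
  rewrite -[X in _ - X](@divff _ (k%:R + v)) ?gt_eqF// -mulrBl ler_pdivrMr//.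
  have vi : 0 < v^-1 by rewrite invr_gt0.
  have vvi : v^-1 * v = 1 by rewrite mulVf ?gt_eqF.
  nra.
apply: (le_trans (ln_le_subr1 _)); first by rewrite divr_gt0.
rewrite -[X in _ - X](@divff _ k.+1%:R) ?gt_eqF// -mulrBl ler_pdivrMr//.
have vi : 0 < v^-1 by rewrite invr_gt0.
nra.
Qed.

Lemma harmonic_shift_bound v : 0 < v ->
  exists2 C : R, 0 <= C & forall k, `|\sum_(j < k) (j%:R + v)^-1 - ln k.+1%:R| <= C.
Proof.
move=> v0; have [C C0 HC] := ln_natD_bound v0.
have pos j : 0 < j%:R + v by rewrite ltr_wpDl.
have lo k : ln (k%:R + v) - ln v <= \sum_(j < k) (j%:R + v)^-1.
  elim: k => [|k IH]; first by rewrite big_ord0 add0r subrr.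
  rewrite big_ord_recr/=; apply: le_trans (lerD IH (lexx _)).
  have : ln (k.+1%:R + v) - ln (k%:R + v) <= (k%:R + v)^-1.
    rewrite -ln_div ?posrE//.
    apply: (le_trans (ln_le_subr1 _)); first by rewrite divr_gt0.
    rewrite -[X in _ - X](@divff _ (k%:R + v)) ?gt_eqF// -mulrBl -natr1.
    by rewrite (_ : k%:R + 1 + v - (k%:R + v) = 1) ?mul1r//; ring.
  by lra.
have hi k : \sum_(j < k.+1) (j%:R + v)^-1 <= v^-1 + (ln (k%:R + v) - ln v).
  elim: k => [|k IH]; first by rewrite big_ord1 add0r subrr addr0.
  rewrite big_ord_recr/=.
  have : ln (k%:R + v) - ln (k.+1%:R + v) <= - (k.+1%:R + v)^-1.
    rewrite -ln_div ?posrE//.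
    apply: (le_trans (ln_le_subr1 _)); first by rewrite divr_gt0.
    rewrite -[X in _ - X](@divff _ (k.+1%:R + v)) ?gt_eqF// -mulrBl.
    rewrite (_ : k%:R + v - (k.+1%:R + v) = -1) ?mulN1r//.
    by rewrite -[k.+1%:R]natr1; ring.
  by lra.
exists (C + v^-1 + `|ln v|); first by rewrite !addr_ge0 ?invr_ge0 ?(ltW v0).
move=> k; have := HC k; have := lo k; have := hi k; rewrite big_ord_recr/= !ler_norml.
have : 0 < (k%:R + v)^-1 by rewrite invr_gt0.
have := ler_norm (ln v); have := ler_norm (- ln v); rewrite normrN.
have : 0 < v^-1 by rewrite invr_gt0.
move=> ? ? ? ? ? ? /andP[? ?]; apply/andP; split; lra.
Qed.

Definition poch_ratio u v k : R := \prod_(j < k) ((j%:R + u) / (j%:R + v)).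

Lemma poch_ratio_gt0 u v k : 0 < u -> 0 < v -> 0 < poch_ratio u v k.
Proof. by move=> u0 v0; apply: prodr_gt0 => j _; rewrite divr_gt0 ?ltr_wpDl. Qed.

Lemma poch_ratioV u v k : 0 < u -> 0 < v -> poch_ratio v u k = (poch_ratio u v k)^-1.
Proof.
by move=> u0 v0; rewrite /poch_ratio -prodfV; apply: eq_bigr => j _; rewrite invf_div.
Qed.

(** From $1 + u \le e^u$ factor by factor; the exponent is a shifted harmonic sum. *)
Lemma poch_ratio_le u v : 0 < u -> 0 < v ->
  exists2 C : R, 0 < C & forall k, poch_ratio u v k <= C * k.+1%:R `^ (u - v).
Proof.
move=> u0 v0; have [C C0 HC] := harmonic_shift_bound v0.
exists (expR (`|u - v| * C)); first exact: expR_gt0.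
move=> k; apply: (@le_trans _ _ (expR ((u - v) * \sum_(j < k) (j%:R + v)^-1))).
  rewrite mulr_sumr expR_sum; apply: ler_prod => j _; apply/andP; split.
    by rewrite divr_ge0// addr_ge0// ltW.
  apply: le_trans (expR_ge1Dx _).
  have jv : j%:R + v != 0 by rewrite gt_eqF// ltr_wpDl.
  by rewrite le_eqVlt; apply/orP; left; apply/eqP; field.
rewrite /powR pnatr_eq0/= -expRD ler_expR -lerBlDr -mulrBr.
by apply: (le_trans (ler_norm _)); rewrite normrM; apply: ler_wpM2l; [exact: normr_ge0|exact: HC].
Qed.

(** The upper bound with [u] and [v] exchanged. *)
Lemma poch_ratio_ge u v : 0 < u -> 0 < v ->
  exists2 c : R, 0 < c & forall k, c * k.+1%:R `^ (u - v) <= poch_ratio u v k.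
Proof.
move=> u0 v0; have [C C0 HC] := poch_ratio_le v0 u0.
exists C^-1; first by rewrite invr_gt0.
move=> k; have := HC k; rewrite (poch_ratioV _ u0 v0) => h.
rewrite -[leRHS]invrK -[u - v]opprB powRN -invfM lef_pV2 ?posrE ?invr_gt0 ?poch_ratio_gt0//.
by rewrite mulr_gt0// powR_gt0.
Qed.

End pochhammer.

(** * The potential kernel as a power series *)
Local Opaque Gamma.

Section heat_series.
Context {R : realType}.
Local Notation leb := (@lebesgue_measure R).
Implicit Types (b s t x y : R) (k : nat).

(** The Taylor coefficients of the part of order [b] of the potential kernel in
    $\rho = 2xy/(x^2+y^2)$; see [potential_term]. *)
Definition kcoef b s k : R :=
  Gamma (2 * k%:R + (b + 1 - s)) / (4 ^+ k * (k`!%:R * Gamma (k%:R + b + 1))).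

Lemma Gamma_nat_gt0 b k : -1 < b -> 0 < Gamma (k%:R + b + 1).
Proof. by move=> b1; apply: Gamma_gt0; rewrite -addrA ltr_wpDl// -ltrBlDr sub0r. Qed.

Lemma kcoef_gt0 b s k : -1 < b -> s < b + 1 -> 0 < kcoef b s k.
Proof.
move=> b1 sb; apply: divr_gt0.
  by apply: Gamma_gt0; rewrite ltr_wpDl ?subr_gt0// mulr_ge0.
apply: mulr_gt0; first exact: exprn_gt0.
by apply: mulr_gt0; [rewrite ltr0n fact_gt0|exact: Gamma_nat_gt0].
Qed.

(** The duplication formula in disguise: the step from [k] to [k.+1] multiplies the Gamma argument
    $2k + b + 1 - s$ by two consecutive factors, one for each Pochhammer ratio. *)
Lemma kcoefE b s k : -1 < b -> s < b + 1 ->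
  kcoef b s k = kcoef b s 0 * (poch_ratio ((b + 1 - s) / 2) 1 k *
                               poch_ratio ((b + 1 - s + 1) / 2) (b + 1) k).
Proof.
move=> b1 sb; elim: k => [|k IH]; first by rewrite /poch_ratio !big_ord0 !mulr1.
have tau0 : 0 < b + 1 - s by rewrite subr_gt0.
have k0 : 0 <= k%:R :> R by [].
have E : kcoef b s k.+1 = kcoef b s k *
   ((k%:R + (b + 1 - s) / 2) / (k%:R + 1) * ((k%:R + (b + 1 - s + 1) / 2) / (k%:R + (b + 1)))).
  have kS : k.+1%:R = k%:R + 1 :> R by rewrite -natr1.
  rewrite /kcoef kS.
  have -> : 2 * (k%:R + 1) + (b + 1 - s) = 2 * k%:R + (b + 1 - s) + 1 + 1 by ring.
  rewrite (@GammaS _ (2 * k%:R + (b + 1 - s) + 1)); last lra.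
  rewrite (@GammaS _ (2 * k%:R + (b + 1 - s))); last lra.
  have -> : k%:R + 1 + b + 1 = k%:R + b + 1 + 1 by ring.
  rewrite (@GammaS _ (k%:R + b + 1)); last lra.
  rewrite factS natrM exprS kS.
  have ? := Gamma_nat_gt0 k b1.
  have ? : 0 < (k`!)%:R :> R by rewrite ltr0n fact_gt0.
  have ? : 0 < 4 ^+ k :> R by rewrite exprn_gt0.
  field; rewrite !gt_eqF//; lra.
by rewrite E IH /poch_ratio !big_ord_recr/=; ring.
Qed.

Lemma kcoef_le b s : -1 < b -> s < b + 1 ->
  exists2 C : R, 0 < C & forall k, kcoef b s k <= C * k.+1%:R `^ (- s - 2^-1).
Proof.
move=> b1 sb.
have h1 : 0 < (b + 1 - s) / 2 by lra.
have h2 : 0 < (b + 1 - s + 1) / 2 by lra.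
have h3 : 0 < b + 1 by lra.
have [C1 C10 H1] := poch_ratio_le h1 ltr01.
have [C2 C20 H2] := poch_ratio_le h2 h3.
have a0 := kcoef_gt0 0 b1 sb.
exists (kcoef b s 0 * (C1 * C2)); first by apply: mulr_gt0 => //; exact: mulr_gt0.
move=> k; rewrite (kcoefE k b1 sb) -[leRHS]mulrA; apply: ler_wpM2l; first exact: (ltW a0).
apply: le_trans (ler_pM (ltW (poch_ratio_gt0 _ h1 ltr01)) (ltW (poch_ratio_gt0 _ h2 h3)) (H1 k) (H2 k)) _.
rewrite mulrACA -powRD ?pnatr_eq0 ?implybT//.
by rewrite le_eqVlt; apply/orP; left; apply/eqP; congr (_ * _ `^ _); field.
Qed.

Lemma kcoef_ge b s : -1 < b -> s < b + 1 ->
  exists2 c : R, 0 < c & forall k, c * k.+1%:R `^ (- s - 2^-1) <= kcoef b s k.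
Proof.
move=> b1 sb.
have h1 : 0 < (b + 1 - s) / 2 by lra.
have h2 : 0 < (b + 1 - s + 1) / 2 by lra.
have h3 : 0 < b + 1 by lra.
have [C1 C10 H1] := poch_ratio_ge h1 ltr01.
have [C2 C20 H2] := poch_ratio_ge h2 h3.
have a0 := kcoef_gt0 0 b1 sb.
exists (kcoef b s 0 * (C1 * C2)); first by apply: mulr_gt0 => //; exact: mulr_gt0.
move=> k; rewrite (kcoefE k b1 sb) -[leLHS]mulrA; apply: ler_wpM2l; first exact: (ltW a0).
have p1 : 0 <= C1 * k.+1%:R `^ ((b + 1 - s) / 2 - 1) by rewrite mulr_ge0 ?powR_ge0 ?ltW.
have p2 : 0 <= C2 * k.+1%:R `^ ((b + 1 - s + 1) / 2 - (b + 1)) by rewrite mulr_ge0 ?powR_ge0 ?ltW.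
apply: le_trans _ (ler_pM p1 p2 (H1 k) (H2 k)).
rewrite mulrACA -powRD ?pnatr_eq0 ?implybT//.
by rewrite le_eqVlt; apply/orP; left; apply/eqP; congr (_ * _ `^ _); field.
Qed.

Definition bessel_term b z k : R :=
  (z / 2) `^ (2 * k%:R + b) / (k`!%:R * Gamma (k%:R + b + 1)).

Lemma Gamma_nat_ge b k : -1 < b ->
  Num.min 1 (b + 1) * Gamma (b + 1) <= Gamma (k%:R + b + 1).
Proof.
move=> b1; have b10 : 0 < b + 1 by lra.
have G0 := Gamma_gt0 b10.
have m1 : Num.min 1 (b + 1) <= 1 by rewrite ge_min lexx.
have m0 : 0 < Num.min 1 (b + 1) by rewrite lt_min ltr01.
have Gm : Num.min 1 (b + 1) * Gamma (b + 1) <= Gamma (b + 1) by rewrite ler_piMl// ltW.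
case: k => [|k]; first by rewrite add0r.
elim: k => [|k IH].
  rewrite (_ : 1%:R + b + 1 = b + 1 + 1); last by ring.
  rewrite (GammaS b10).
  by apply: ler_wpM2r; [exact: ltW|rewrite ge_min lexx orbT].
apply: (le_trans IH).
have -> : k.+2%:R + b + 1 = k.+1%:R + b + 1 + 1 by rewrite -[k.+2%:R]natr1; ring.
have kb : 1 <= k.+1%:R + b + 1 by rewrite -natr1; have : 0 <= k%:R :> R by []; lra.
rewrite (@GammaS _ (k.+1%:R + b + 1)); last lra.
exact: (ler_peMl (ltW (Gamma_nat_gt0 _ b1)) kb).
Qed.

Lemma bessel_term_ge0 b z k : -1 < b -> 0 <= bessel_term b z k.
Proof.
by move=> b1; rewrite divr_ge0 ?powR_ge0 ?mulr_ge0// ltW// Gamma_nat_gt0.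
Qed.

(** Compared with the exponential series, the Gamma values in the denominators being bounded below. *)
Lemma is_cvg_besselI b z : -1 < b -> 0 < z -> cvgn (series (bessel_term b z)).
Proof.
move=> b1 z0; have b10 : 0 < b + 1 by lra.
have zz : 0 < z / 2 by lra.
pose m := Num.min 1 (b + 1) * Gamma (b + 1).
have m0 : 0 < m by rewrite mulr_gt0 ?Gamma_gt0// lt_min ltr01.
pose C := (z / 2) `^ b / m.
have C0 : 0 < C by rewrite divr_gt0 ?powR_gt0.
apply: (@series_le_cvg _ _ (fun k => C * exp_coeff ((z / 2) ^+ 2) k)).
- by move=> k; exact: bessel_term_ge0.
- by move=> k; rewrite mulr_ge0 ?(ltW C0)// /exp_coeff/= divr_ge0// exprn_ge0// sqr_ge0.
- move=> k; rewrite /bessel_term /exp_coeff/= /C.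
  rewrite powRD ?(gt_eqF zz) ?implybT//.
  rewrite (_ : 2 * k%:R = (2 * k)%:R :> R); last by rewrite natrM.
  rewrite powR_mulrn ?(ltW zz)// exprM.
  have -> : (z / 2) `^ b / m * ((z / 2) ^+ 2 ^+ k / k`!%:R) =
            (z / 2) ^+ 2 ^+ k * (z / 2) `^ b / k`!%:R * m^-1 by ring.
  rewrite invfM mulrA; apply: ler_wpM2l.
    by rewrite !mulr_ge0 ?invr_ge0 ?powR_ge0 ?exprn_ge0 ?(ltW zz).
  by rewrite lef_pV2 ?posrE ?Gamma_nat_gt0// Gamma_nat_ge.
- have -> : series (fun k => C * exp_coeff ((z / 2) ^+ 2) k) = C \*: (series (exp_coeff ((z / 2) ^+ 2))).
    by apply/funext => n; rewrite /series/= /GRing.scale/= mulr_sumr.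
  by apply: is_cvgZr; exact: is_cvg_series_exp_coeff.
Qed.

Lemma EFin_besselI b z : -1 < b -> 0 < z ->
  (besselI b z)%:E = (\sum_(0 <= k <oo) (bessel_term b z k)%:E)%E.
Proof.
move=> b1 z0; rewrite /besselI -EFin_lim; last exact: is_cvg_besselI.
by congr (limn _); apply/funext => n /=; rewrite sumEFin.
Qed.

Definition heat_term b s x y t k : R :=
  (2 * t)^-1 * expR (- (x ^+ 2 + y ^+ 2) / (4 * t)) * (x * y) `^ (- b) *
  bessel_term b (x * y / (2 * t)) k * t `^ (s - 1).

Definition potential_term b s x y k : R :=
  2^-1 * 4 `^ (1 - s) * (x ^+ 2 + y ^+ 2) `^ (s - b - 1) *
  (kcoef b s k * (2 * (x * y) / (x ^+ 2 + y ^+ 2)) ^+ (2 * k)).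

Definition potential_series b s x y : \bar R :=
  (\sum_(0 <= k <oo) (potential_term b s x y k)%:E)%E.

(** As a function of [t], a term of the heat kernel is a power times $e^{-A/t}$ with
    $A = (x^2+y^2)/4$. *)
Lemma heat_termE b s x y t k : 0 < x -> 0 < y -> 0 < t ->
  heat_term b s x y t k =
  2^-1 * (x * y) ^+ (2 * k) / 4 `^ (2 * k%:R + b) / (k`!%:R * Gamma (k%:R + b + 1)) *
  (t `^ (- (2 * k%:R + (b + 1 - s)) - 1) * expR (- ((x ^+ 2 + y ^+ 2) / 4 / t))).
Proof.
move=> x0 y0 t0; have xy0 : 0 < x * y by rewrite mulr_gt0.
rewrite /heat_term /bessel_term.
have -> : - (x ^+ 2 + y ^+ 2) / (4 * t) = - ((x ^+ 2 + y ^+ 2) / 4 / t) by field; rewrite gt_eqF.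
move: (expR _) (x * y) xy0 => e P P0.
have -> : P / (2 * t) / 2 = P * 4^-1 * t^-1 by field; rewrite gt_eqF.
rewrite !powRM ?mulr_ge0 ?invr_ge0 ?(ltW P0) ?(ltW t0)//.
rewrite -[4^-1]powR_inv1// -[t^-1]powR_inv1 ?(ltW t0)// -!powRrM !mulN1r.
have -> : P `^ (2 * k%:R + b) = P ^+ (2 * k) * P `^ b.
  by rewrite powRD ?(gt_eqF P0) ?implybT// -natrM powR_mulrn// ltW.
have -> : - (2 * k%:R + (b + 1 - s)) - 1 = - (2 * k%:R + b) + (s - 1) + -1 by ring.
have -> : t `^ (- (2 * k%:R + b) + (s - 1) + -1) =
    t `^ (- (2 * k%:R + b)) * t `^ (s - 1) * t^-1.
  by rewrite -[t^-1](powR_inv1 (ltW t0)) -!powRD ?(gt_eqF t0) ?implybT.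
rewrite ![_ `^ - _]powRN invfM.
have Pb : P `^ b != 0 by rewrite gt_eqF ?powR_gt0.
move: (P `^ b) Pb (t `^ (s - 1)) => Z Z0 ts.
by transitivity (2^-1 * P ^+ (2 * k) / 4 `^ (2 * k%:R + b) /
  (k`!%:R * Gamma (k%:R + b + 1)) * ((t `^ (2 * k%:R + b))^-1 * ts / t * e) *
  (Z^-1 * Z)); [ring | rewrite mulVf// mulr1].
Qed.

Lemma heat_posE b s x y t : -1 < b -> 0 < x -> 0 < y -> 0 < t ->
  ((heatW_pos b t x y * t `^ (s - 1))%:E =
   \sum_(0 <= k <oo) (heat_term b s x y t k)%:E)%E.
Proof.
move=> b1 x0 y0 t0; pose c := (2 * t)^-1 * expR (- (x ^+ 2 + y ^+ 2) / (4 * t)) * (x * y) `^ (- b).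
have z0 : 0 < x * y / (2 * t) by rewrite divr_gt0 ?mulr_gt0.
have -> : heatW_pos b t x y * t `^ (s - 1) = c * t `^ (s - 1) * besselI b (x * y / (2 * t)).
  by rewrite /heatW_pos -/c; ring.
rewrite EFinM EFin_besselI// -nneseriesZl; last by move=> k _; rewrite lee_fin bessel_term_ge0.
by apply: eq_eseriesr => k _; rewrite -EFinM /heat_term -/c; congr EFin; ring.
Qed.

Lemma heat_term_ge0 b s x y t k : -1 < b -> 0 < t -> 0 <= heat_term b s x y t k.
Proof.
move=> b1 t0; apply: mulr_ge0; last exact: powR_ge0.
apply: mulr_ge0; last exact: bessel_term_ge0.
by rewrite !mulr_ge0 ?powR_ge0 ?expR_ge0// invr_ge0 mulr_ge0// ltW.
Qed.

Lemma potential_term_ge0 b s x y k : -1 < b -> s < b + 1 -> 0 <= x * y ->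
  0 <= potential_term b s x y k.
Proof.
move=> b1 sb xy0; have := kcoef_gt0 k b1 sb => k0.
apply: mulr_ge0; first by rewrite !mulr_ge0 ?powR_ge0.
apply: mulr_ge0; first exact: ltW.
apply: exprn_ge0; apply: divr_ge0; first exact: mulr_ge0.
by rewrite addr_ge0 ?sqr_ge0.
Qed.

Lemma measurable_inv_gamma (r A : R) :
  measurable_fun `](0:R), +oo[ (fun t => (t `^ r * expR (- (A / t)))%:E).
Proof.
apply/measurable_EFinP; apply: measurable_fun_pos => t t0.
apply: continuousM; first exact: continuous_powR_pos.
have t1 : t != 0 by rewrite gt_eqF.
have d1 : is_derive t 1 (fun t : R => - (A / t)) _ :=
  rderN (rderM (rder_cst A t) (rderV t1 (rder_id t))).
exact: (rder_continuous (rder_comp d1 (is_derive_expR _))).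
Qed.

Lemma measurable_heat_term b s x y k : 0 < x -> 0 < y ->
  measurable_fun `](0:R), +oo[ (fun t => (heat_term b s x y t k)%:E).
Proof.
move=> x0 y0; apply/measurable_EFinP.
pose B := 2^-1 * (x * y) ^+ (2 * k) / 4 `^ (2 * k%:R + b) / (k`!%:R * Gamma (k%:R + b + 1)).
apply: (eq_measurable_fun (fun t => B * (t `^ (- (2 * k%:R + (b + 1 - s)) - 1) *
   expR (- ((x ^+ 2 + y ^+ 2) / 4 / t))))).
  by move=> t; rewrite inE/= in_itv/= andbT => t0; rewrite heat_termE.
apply: measurable_funM => //; apply/measurable_EFinP.
exact: measurable_inv_gamma.
Qed.

Lemma integral_heat_term b s x y k : -1 < b -> s < b + 1 -> 0 < x -> 0 < y ->
  (\int[leb]_(t in `]0%R, +oo[) (heat_term b s x y t k)%:E =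
   (potential_term b s x y k)%:E)%E.
Proof.
move=> b1 sb x0 y0.
have S0 : 0 < x ^+ 2 + y ^+ 2 by rewrite addr_gt0 ?exprn_gt0.
have G0 := Gamma_nat_gt0 k b1.
have F0 : 0 < k`!%:R :> R by rewrite ltr0n fact_gt0.
pose tau := 2 * k%:R + (b + 1 - s).
have tau0 : 0 < tau by rewrite /tau ltr_wpDl ?mulr_ge0// subr_gt0.
pose B := 2^-1 * (x * y) ^+ (2 * k) / 4 `^ (2 * k%:R + b) / (k`!%:R * Gamma (k%:R + b + 1)).
have B0 : 0 <= B.
  by rewrite /B !mulr_ge0 ?invr_ge0 ?powR_ge0 ?exprn_ge0 ?mulr_ge0 ?(ltW x0) ?(ltW y0) ?(ltW G0) ?(ltW F0).
under eq_integral => t.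
  rewrite inE/= in_itv/= andbT => t0.
  rewrite heat_termE// -/B -/tau EFinM.
  over.
rewrite ge0_integralZl//; last 2 first.
- exact: measurable_inv_gamma.
- by move=> t _; rewrite lee_fin mulr_ge0 ?powR_ge0 ?expR_ge0.
rewrite integral_inv_gamma ?divr_gt0// -EFinM; congr EFin.
rewrite /potential_term /kcoef -/tau /B.
rewrite powRM ?invr_ge0 ?(ltW S0)// -[4^-1]powR_inv1// -powRrM mulN1r opprK.
have -> : 4 `^ tau = 4 `^ (2 * k%:R + b) * 4 `^ (1 - s) :> R.
  by rewrite -powRD ?pnatr_eq0 ?implybT//; congr (_ `^ _); rewrite /tau; ring.
have -> : (x ^+ 2 + y ^+ 2) `^ (- tau) =
    (x ^+ 2 + y ^+ 2) `^ (s - b - 1) / (x ^+ 2 + y ^+ 2) ^+ (2 * k).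
  have -> : - tau = (s - b - 1) - (2 * k)%:R by rewrite /tau natrM; ring.
  by rewrite powRD ?(gt_eqF S0) ?implybT// powR_invn ?(ltW S0).
have Q0 : 0 < 4 `^ (2 * k%:R + b) :> R by rewrite powR_gt0.
have -> : (2 * (x * y) / (x ^+ 2 + y ^+ 2)) ^+ (2 * k) =
   4 ^+ k * (x * y) ^+ (2 * k) / (x ^+ 2 + y ^+ 2) ^+ (2 * k).
  by rewrite !exprMn exprVn (exprM 2) -natrX.
have ? : 0 < 4 ^+ k :> R by rewrite exprn_gt0.
have ? : 0 < (x ^+ 2 + y ^+ 2) ^+ (2 * k) :> R by rewrite exprn_gt0.
move: (Gamma tau) ((x ^+ 2 + y ^+ 2) `^ (s - b - 1)) (4 `^ (1 - s)) (Gamma (k%:R + b + 1)) G0 => g1 g2 g3 g4 g40.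
by field; rewrite !gt_eqF.
Qed.

(** All terms being nonnegative, sum and integral commute, whether finite or not. *)
Lemma integral_heatW_pos b s x y : -1 < b -> s < b + 1 -> 0 < x -> 0 < y ->
  (\int[leb]_(t in `]0%R, +oo[) (heatW_pos b t x y * t `^ (s - 1))%:E =
   potential_series b s x y)%E.
Proof.
move=> b1 sb x0 y0.
under eq_integral => t.
  rewrite inE/= in_itv/= andbT => t0; rewrite heat_posE//; over.
rewrite integral_nneseries//.
- by apply: eq_eseriesr => k _; rewrite integral_heat_term.
- by move=> k; exact: measurable_heat_term.
- by move=> k t /=; rewrite in_itv/= andbT => t0; rewrite lee_fin heat_term_ge0.
Qed.

Lemma heatW_pos_ge0 b t x y : -1 < b -> 0 < x -> 0 < y -> 0 < t ->
  0 <= heatW_pos b t x y.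
Proof.
move=> b1 x0 y0 t0; apply: mulr_ge0.
  by rewrite !mulr_ge0 ?powR_ge0 ?expR_ge0// invr_ge0 mulr_ge0// ltW.
rewrite -lee_fin EFin_besselI ?divr_gt0 ?mulr_gt0//.
by apply: nneseries_ge0 => k _ _; rewrite lee_fin bessel_term_ge0.
Qed.

Lemma heat_pow_ge0 b s t x y : -1 < b -> 0 < x -> 0 < y -> 0 < t ->
  (0 <= (heatW_pos b t x y * t `^ (s - 1))%:E)%E.
Proof.
by move=> *; rewrite lee_fin; apply: mulr_ge0; [exact: heatW_pos_ge0|exact: powR_ge0].
Qed.

Lemma measurable_heatW_pos b s x y : -1 < b -> 0 < x -> 0 < y ->
  measurable_fun `](0:R), +oo[ (fun t => (heatW_pos b t x y * t `^ (s - 1))%:E).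
Proof.
move=> b1 x0 y0.
apply: (eq_measurable_fun (fun t => \sum_(0 <= k <oo) (heat_term b s x y t k)%:E)%E).
  by move=> t; rewrite inE/= in_itv/= andbT => t0; rewrite heat_posE.
apply: (@ge0_emeasurable_sum _ _ _ _ (fun k t => (heat_term b s x y t k)%:E) xpredT).
  by move=> k t /=; rewrite in_itv/= andbT => t0 _; rewrite lee_fin heat_term_ge0.
by move=> k _; exact: measurable_heat_term.
Qed.

End heat_series.

Lemma integral_EFin_lin d (T : measurableType d) (R : realType)
    (mu : {measure set T -> \bar R}) (D : set T) (f g : T -> R) (u v : R) :
  measurable D -> mu.-integrable D (EFin \o f) -> mu.-integrable D (EFin \o g) ->
  (\int[mu]_(t in D) (u%:E * ((f t)%:E + v%:E * (g t)%:E)) =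
   u%:E * (\int[mu]_(t in D) (f t)%:E + v%:E * \int[mu]_(t in D) (g t)%:E))%E.
Proof.
move=> mD fi gi.
have vi : mu.-integrable D (fun t => v%:E * (g t)%:E)%E by exact: integrableZl.
by rewrite integralZl ?integralD// ?integralZl//; exact: integrableD.
Qed.

Local Opaque heatW_pos.

Section dunkl_kernel.
Context {R : realType}.
Local Notation leb := (@lebesgue_measure R).
Implicit Types (a s t x y : R) (k : nat).

Lemma heatW_posE b t x y : 0 < x -> 0 < y -> heatW b t x y = heatW_pos b t x y.
Proof. by move=> x0 y0; rewrite /heatW x0 y0. Qed.

Lemma dunkl_integrandE a s t x y : 0 < `|x| -> 0 < `|y| ->
  ((dunklW a t x y * t `^ (s - 1))%:E =
   2^-1%:E * ((heatW_pos a t `|x| `|y| * t `^ (s - 1))%:E +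
              (x * y)%:E * (heatW_pos (a + 1) t `|x| `|y| * t `^ (s - 1))%:E))%E.
Proof.
move=> x0 y0; rewrite (_ : dunklW a t x y * t `^ (s - 1) =
  2^-1 * (heatW_pos a t `|x| `|y| * t `^ (s - 1) +
          x * y * (heatW_pos (a + 1) t `|x| `|y| * t `^ (s - 1)))).
  by [].
rewrite /dunklW (heatW_posE a t x0 y0) (heatW_posE (a + 1) t x0 y0).
by move: (heatW_pos a t _ _) (heatW_pos (a + 1) t _ _) (t `^ _) => u v w; ring.
Qed.

(** For operands of the same sign both parts of the kernel are nonnegative, so the formula holds with
    infinite values allowed. *)
Lemma potentialK_pos a s x y : -1 < a -> 0 < s -> s < a + 1 -> 0 < x * y ->
  (potentialK a s x y = ((Gamma s)^-1 / 2)%:E *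
     (potential_series a s `|x| `|y| + (x * y)%:E * potential_series (a + 1) s `|x| `|y|))%E.
Proof.
move=> a1 s0 sa xy0.
have x0 : 0 < `|x| by rewrite normr_gt0; apply: contraTN xy0 => /eqP ->; rewrite mul0r ltxx.
have y0 : 0 < `|y| by rewrite normr_gt0; apply: contraTN xy0 => /eqP ->; rewrite mulr0 ltxx.
have a11 : -1 < a + 1 by lra.
have sa1 : s < a + 1 + 1 by lra.
rewrite /potentialK EFinM -muleA; congr (_ * _)%E.
under eq_integral => t _.
  rewrite dunkl_integrandE//; over.
rewrite ge0_integralZl//; first last.
- move=> t /=; rewrite in_itv/= andbT => t0.
  apply: adde_ge0; first exact: heat_pow_ge0.
  by apply: mule_ge0; [rewrite lee_fin ltW | exact: heat_pow_ge0].
- apply: emeasurable_funD; first exact: measurable_heatW_pos.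
  by apply: measurable_funeM; exact: measurable_heatW_pos.
congr (_ * _)%E; rewrite ge0_integralD//; first last.
- by apply: measurable_funeM; exact: measurable_heatW_pos.
- move=> t /=; rewrite in_itv/= andbT => t0.
  by apply: mule_ge0; [rewrite lee_fin ltW | exact: heat_pow_ge0].
- exact: measurable_heatW_pos.
- move=> t /=; rewrite in_itv/= andbT => t0.
  exact: heat_pow_ge0.
rewrite integral_heatW_pos//; congr (_ + _)%E.
rewrite ge0_integralZl//; first last.
- by rewrite lee_fin ltW.
- move=> t /=; rewrite in_itv/= andbT => t0.
  exact: heat_pow_ge0.
- exact: measurable_heatW_pos.
by rewrite integral_heatW_pos.
Qed.

(** For operands of opposite signs the two parts have opposite signs, and the difference makes sense
    once both are finite. *)
Lemma potentialK_neg a s x y : -1 < a -> 0 < s -> s < a + 1 -> x * y < 0 ->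
  potential_series a s `|x| `|y| \is a fin_num ->
  potential_series (a + 1) s `|x| `|y| \is a fin_num ->
  (potentialK a s x y = ((Gamma s)^-1 / 2)%:E *
     (potential_series a s `|x| `|y| + (x * y)%:E * potential_series (a + 1) s `|x| `|y|))%E.
Proof.
move=> a1 s0 sa xy0 fin1 fin2.
have x0 : 0 < `|x| by rewrite normr_gt0; apply: contraTN xy0 => /eqP ->; rewrite mul0r ltxx.
have y0 : 0 < `|y| by rewrite normr_gt0; apply: contraTN xy0 => /eqP ->; rewrite mulr0 ltxx.
have a11 : -1 < a + 1 by lra.
have sa1 : s < a + 1 + 1 by lra.
have int (b : R) : -1 < b -> s < b + 1 -> potential_series b s `|x| `|y| \is a fin_num ->
    leb.-integrable `]0, +oo[ (EFin \o (fun t => heatW_pos b t `|x| `|y| * t `^ (s - 1))).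
  move=> b1 sb fin; apply/integrableP; split; first exact: measurable_heatW_pos.
  rewrite (@eq_integral _ _ _ leb `](0:R), +oo[%classic
      (fun t => (heatW_pos b t `|x| `|y| * t `^ (s - 1))%:E)).
    by rewrite integral_heatW_pos//; case/fin_numPlt/andP: fin.
  move=> t; rewrite inE/= in_itv/= andbT => t0.
  by rewrite ger0_norm// -lee_fin heat_pow_ge0.
have i1 := int a a1 sa fin1; have i2 := int (a + 1) a11 sa1 fin2.
rewrite /potentialK EFinM -muleA; congr (_ * _)%E.
under eq_integral => t _.
  rewrite dunkl_integrandE//; over.
rewrite (integral_EFin_lin _ _ _ i1 i2)//.
by congr (_ * (_ + _ * _))%E; exact: integral_heatW_pos.
Qed.

End dunkl_kernel.

(** * Power series with power coefficients *)
Section power_series_bounds.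
Context {R : realType}.
Implicit Types (e rho : R).

(** Discrete forms of $(x^e)' = e x^{e-1}$, so that sums of powers telescope. *)
Lemma powR_sub_ge e k : 0 < e -> e < 1 ->
  e * k.+1%:R `^ (e - 1) <= k.+1%:R `^ e - k%:R `^ e :> R.
Proof.
move=> e0 e1; have k1 : 0 < k.+1%:R :> R by [].
have kS : k.+1%:R = k%:R + 1 :> R by rewrite -natr1.
have k0 : 0 <= k%:R :> R by [].
have p0 : 0 < k.+1%:R `^ (e - 1) :> R by rewrite powR_gt0.
(* concavity of the power, an instance of Young's inequality *)
have conc : (k%:R / k.+1%:R) `^ e <= e * (k%:R / k.+1%:R) + (1 - e) :> R.
  have r0 : 0 <= (k%:R / k.+1%:R) `^ e :> R by exact: powR_ge0.
  have h := @conjugate_powR R _ 1 e^-1 (1 - e)^-1 r0 ler01.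
  have := h _ _ _; rewrite !invrK mulr1 -powRrM mulfV ?gt_eqF// powRr1 ?divr_ge0// powR1 mul1r [_ * e]mulrC; apply.
  - by rewrite invr_gt0.
  - by rewrite invr_gt0 subr_gt0.
  - by ring.
have E1 : k.+1%:R `^ e = k.+1%:R * k.+1%:R `^ (e - 1) :> R by rewrite mulr_powRB1.
have E2 : k%:R `^ e = (k%:R / k.+1%:R) `^ e * (k.+1%:R * k.+1%:R `^ (e - 1)) :> R.
  by rewrite mulr_powRB1// -powRM ?divr_ge0// divfK.
rewrite E2 E1.
have h : (k%:R / k.+1%:R) `^ e * (k.+1%:R * k.+1%:R `^ (e - 1)) <=
   (e * (k%:R / k.+1%:R) + (1 - e)) * (k.+1%:R * k.+1%:R `^ (e - 1)) :> R.
  by apply: ler_wpM2r => //; rewrite mulr_ge0// ltW.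
rewrite -subr_ge0 in h; rewrite -subr_ge0; apply: (le_trans h).
rewrite le_eqVlt; apply/orP; left; apply/eqP; rewrite kS; field.
by rewrite -kS gt_eqF.
Qed.

(** Up to $N \approx 1/(1-\rho)$ the powers of $\rho$ are dropped and the sum telescopes; beyond, the
    coefficients are at most the [N]-th one and the geometric series remains. *)
Lemma nneseries_powR_subcritical e : 0 < e -> e < 1 ->
  exists2 C : R, 0 < C & forall rho, 0 <= rho -> rho < 1 ->
  (\sum_(0 <= k <oo) (k.+1%:R `^ (e - 1) * rho ^+ k)%:E <= (C * (1 - rho) `^ (- e))%:E)%E.
Proof.
move=> e0 e1; exists ((e^-1 + 1) * 2 `^ e).
  by rewrite mulr_gt0 ?powR_gt0// addr_gt0 ?invr_gt0.
move=> rho rho0 rho1; pose M := (1 - rho)^-1.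
have r1 : 0 < 1 - rho by rewrite subr_gt0.
have M0 : 0 < M by rewrite invr_gt0.
have M1 : 1 <= M by rewrite invf_ge1// gerBl.
pose N := (Num.truncn M).+1.
have MN : M <= N%:R by exact: (ltW (truncnS_gt _)).
have NM : N%:R <= 2 * M.
  have : (Num.truncn M)%:R <= M by rewrite truncn_le ltW.
  by rewrite /N -natr1; lra.
have N0 : 0 < N%:R :> R by rewrite ltr0n.
apply: lime_le.
  by apply: is_cvg_nneseries => k _ _; rewrite lee_fin mulr_ge0 ?powR_ge0 ?exprn_ge0.
apply: nearW => n; rewrite sumEFin lee_fin.
pose g k : R := k%:R `^ e.
have term k : k.+1%:R `^ (e - 1) * rho ^+ k <=
    e^-1 * ((g k.+1 - g k) * (k < N)%N%:R) + N%:R `^ (e - 1) * rho ^+ k.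
  have [kN|Nk] := ltnP k N.
    rewrite mulr1; apply: ler_wpDr; first by rewrite mulr_ge0 ?powR_ge0 ?exprn_ge0.
    rewrite [e^-1 * _]mulrC ler_pdivlMr// mulrC.
    apply: le_trans (powR_sub_ge k e0 e1); rewrite ler_wpM2l ?(ltW e0)//.
    by rewrite ler_piMr ?powR_ge0// exprn_ile1// ltW.
  rewrite -[false%:R]/(0 : R) !mulr0 add0r; apply: ler_wpM2r; first exact: exprn_ge0.
  rewrite -[e - 1]opprB !powRN lef_pV2 ?posrE ?powR_gt0//.
  by apply: ge0_ler_powR; rewrite ?nnegrE ?subr_ge0 ?(ltW e1)// ler_nat leqW.
have tele m : \sum_(0 <= k < m) ((g k.+1 - g k) * (k < N)%N%:R) = g (minn N m).
  elim: m => [|m IH]; first by rewrite big_geq// minn0 /g powR0// gt_eqF.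
  rewrite big_nat_recr//= IH; have [Nm|mN] := leqP N m.
    by rewrite (minn_idPl (leqW Nm)) -[false%:R]/(0 : R) mulr0 addr0.
  by rewrite (minn_idPr mN) mulr1 addrC subrK.
apply: le_trans (ler_sum _ (fun k _ => term k)) _.
rewrite big_split/= -!mulr_sumr tele.
have geo : \sum_(0 <= k < n) rho ^+ k <= M.
  have [->|rn] := eqVneq rho 0.
    case: n => [|n]; first by rewrite big_geq// ltW.
    rewrite big_nat_recl//= expr0 big1 ?addr0// => k _; by rewrite exprS mul0r.
  have rp : 0 < rho by rewrite lt_def rn.
  have := @geometric_le_lim R n 1 rho ler01 rp; rewrite ger0_norm// => /(_ rho1).
  by rewrite /series/= mul1r; under eq_bigr do rewrite mul1r.
have gN : g (minn N n) <= N%:R `^ e.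
  by apply: ge0_ler_powR; rewrite ?nnegrE ?(ltW e0)// ler_nat geq_minl.
have NN : N%:R `^ (e - 1) * \sum_(0 <= k < n) rho ^+ k <= N%:R `^ e.
  rewrite -[X in _ <= X](mulr_powRB1 (ltW N0) e0) mulrC.
  by apply: ler_wpM2r; [exact: powR_ge0|exact: le_trans MN].
apply: (@le_trans _ _ ((e^-1 + 1) * N%:R `^ e)).
  by rewrite mulrDl mul1r; apply: lerD => //; rewrite ler_wpM2l// invr_ge0 ltW.
rewrite -mulrA; apply: ler_wpM2l; first by rewrite addr_ge0// invr_ge0 ltW.
rewrite powRN -[_^-1]powR_inv1 ?powR_ge0// powRAC powR_inv1 ?(ltW r1)// -/M.
rewrite -powRM ?(ltW M0)//.
by apply: ge0_ler_powR; rewrite ?nnegrE ?(ltW e0) ?(ltW N0)// mulr_ge0// ltW.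
Qed.

Lemma powRN_sub_ge e k : 0 < e ->
  e * k.+2%:R `^ (- 1 - e) <= k.+1%:R `^ (- e) - k.+2%:R `^ (- e) :> R.
Proof.
move=> e0; have k2 : 0 < k.+2%:R :> R by [].
have r0 : 0 < k.+1%:R / k.+2%:R :> R by rewrite divr_gt0.
have h : 1 + e / k.+2%:R <= (k.+1%:R / k.+2%:R) `^ (- e) :> R.
  rewrite /powR gt_eqF//; apply: le_trans (expR_ge1Dx _).
  rewrite lerD2l mulNr -mulrN ler_wpM2l ?(ltW e0)// lerNr.
  apply: (le_trans (ln_le_subr1 r0)); rewrite -[X in _ - X](@divff _ k.+2%:R) ?gt_eqF//.
  rewrite -mulrBl (_ : k.+1%:R - k.+2%:R = -1) ?mulN1r//.
  by rewrite -[k.+2%:R]natr1; ring.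
have -> : k.+1%:R `^ (- e) = (k.+1%:R / k.+2%:R) `^ (- e) * k.+2%:R `^ (- e) :> R.
  by rewrite -powRM ?divr_ge0// divfK.
have p0 : 0 <= k.+2%:R `^ (- e) :> R by exact: powR_ge0.
have := ler_wpM2r p0 h; rewrite mulrDl mul1r => h2.
rewrite lerBrDl; apply: le_trans h2; rewrite lerD2l le_eqVlt; apply/orP; left; apply/eqP.
by rewrite powRD ?pnatr_eq0 ?implybT// powR_inv1// mulrA.
Qed.

Lemma nneseries_powR_convergent e rho : 0 < e -> 0 <= rho -> rho <= 1 ->
  (\sum_(0 <= k <oo) (k.+1%:R `^ (- 1 - e) * rho ^+ k)%:E <= (1 + e^-1)%:E)%E.
Proof.
move=> e0 rho0 rho1; apply: lime_le.
  by apply: is_cvg_nneseries => k _ _; rewrite lee_fin mulr_ge0 ?powR_ge0 ?exprn_ge0.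
apply: nearW => n; rewrite sumEFin lee_fin.
apply: (@le_trans _ _ (\sum_(0 <= k < n) k.+1%:R `^ (- 1 - e))).
  by apply: ler_sum => k _; rewrite ler_piMr ?powR_ge0// exprn_ile1.
have ei : 0 < e^-1 by rewrite invr_gt0.
case: n => [|n]; first by rewrite big_geq// addr_ge0// ltW.
apply: (@le_trans _ _ (1 + e^-1 * (1 - n.+1%:R `^ (- e)))); last first.
  by rewrite lerD2l ler_piMr ?(ltW ei)// gerBl powR_ge0.
elim: n => [|n IH].
  by rewrite big_nat1 !(congr1 (@^~ _) (powR1 R)) subrr mulr0 addr0.
rewrite big_nat_recr//=; apply: (le_trans (lerD IH (lexx _))).
have := powRN_sub_ge n e0; rewrite -(ler_pM2l ei) mulrA mulVf ?gt_eqF// mul1r.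
by rewrite !mulrBr mulr1; lra.
Qed.

End power_series_bounds.

(** * Size of the potential kernel *)
Local Opaque kcoef.

Section kernel_bounds.
Context {R : realType}.
Implicit Types (a b s x y th : R).

Lemma one_sub_rho x y : 0 < x -> 0 < y ->
  1 - 2 * (x * y) / (x ^+ 2 + y ^+ 2) = (x - y) ^+ 2 / (x ^+ 2 + y ^+ 2).
Proof.
move=> x0 y0; have S0 : 0 < x ^+ 2 + y ^+ 2 by rewrite addr_gt0 ?exprn_gt0.
by field; rewrite gt_eqF.
Qed.

Lemma rho_itv x y : 0 < x -> 0 < y -> 0 < 2 * (x * y) / (x ^+ 2 + y ^+ 2) <= 1.
Proof.
move=> x0 y0; have S0 : 0 < x ^+ 2 + y ^+ 2 by rewrite addr_gt0 ?exprn_gt0.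
rewrite divr_gt0 ?mulr_gt0//= -subr_ge0 one_sub_rho//.
by rewrite divr_ge0 ?sqr_ge0// ltW.
Qed.

Lemma potential_series_ge0 b s x y : -1 < b -> s < b + 1 -> 0 <= x * y ->
  (0 <= potential_series b s x y)%E.
Proof.
by move=> *; apply: nneseries_ge0 => k _ _; rewrite lee_fin potential_term_ge0.
Qed.

Lemma measurable_potential_term b s k :
  measurable_fun [set: R * R] (fun z : R * R => potential_term b s `|z.1| `|z.2| k).
Proof.
have m1 : measurable_fun [set: R * R] (fun z : R * R => `|z.1|) by apply: measurableT_comp.
have m2 : measurable_fun [set: R * R] (fun z : R * R => `|z.2|) by apply: measurableT_comp.
have mS : measurable_fun [set: R * R] (fun z : R * R => `|z.1| ^+ 2 + `|z.2| ^+ 2).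
  by apply: measurable_funD; apply: measurable_funX.
rewrite /potential_term; apply: measurable_funM.
  apply: measurable_funM => //.
  exact: (measurableT_comp (measurable_powR (s - b - 1)) mS).
apply: measurable_funM => //; apply: measurable_funX; apply: measurable_funM.
  by apply: measurable_funM => //; exact: measurable_funM.
apply: (eq_measurable_fun (fun z : R * R => (`|z.1| ^+ 2 + `|z.2| ^+ 2) `^ (- 1))).
  by move=> z _; rewrite powR_inv1// addr_ge0 ?sqr_ge0.
exact: (measurableT_comp (measurable_powR (-1)) mS).
Qed.

Lemma measurable_potential_series b s x : -1 < b -> s < b + 1 ->
  measurable_fun [set: R] (fun y : R => potential_series b s `|x| `|y|).
Proof.
move=> b1 sb.
apply: (@ge0_emeasurable_sum _ _ _ _ (fun k y => (potential_term b s `|x| `|y| k)%:E) xpredT).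
  by move=> k y _ _; rewrite lee_fin potential_term_ge0// mulr_ge0.
move=> k _; apply/measurable_EFinP.
exact: (measurableT_comp (measurable_potential_term b s k) (measurable_pair1 x)).
Qed.

(** The exponent [th] may exceed $1 - 2s$, the order of the singularity for $2s < 1$: this absorbs
    the logarithm that occurs for $2s = 1$. *)
Lemma potential_series_le b s th : -1 < b -> s < b + 1 -> 0 <= th -> th < 1 ->
  1 - 2 * s <= th -> (0 < th \/ 1 < 2 * s) ->
  exists2 C : R, 0 < C & forall x y, 0 < x -> 0 < y -> x != y ->
   (potential_series b s x y <= (C * (x ^+ 2 + y ^+ 2) `^ (s - b - 1) *
      ((x - y) ^+ 2 / (x ^+ 2 + y ^+ 2)) `^ (- (th / 2)))%:E)%E.
Proof.
move=> b1 sb th0 th1 sth hth.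
have [Ck Ck0 HCk] := kcoef_le b1 sb.
(* a power series in $\rho^2$, where $1 - \rho \le 1 - \rho^2$ *)
suff [C C0 HC] : exists2 C : R, 0 < C & forall rho, 0 < rho -> rho < 1 ->
    (\sum_(0 <= k <oo) (k.+1%:R `^ (- s - 2^-1) * rho ^+ k)%:E <= (C * (1 - rho) `^ (- (th / 2)))%:E)%E.
  exists (2^-1 * 4 `^ (1 - s) * (Ck * C)).
    by rewrite !mulr_gt0 ?powR_gt0.
  move=> x y x0 y0 xy; have /andP[r0 r1] := rho_itv x0 y0.
  have S0 : 0 < x ^+ 2 + y ^+ 2 by rewrite addr_gt0 ?exprn_gt0.
  pose rho := 2 * (x * y) / (x ^+ 2 + y ^+ 2).
  pose c := 2^-1 * 4 `^ (1 - s) * (x ^+ 2 + y ^+ 2) `^ (s - b - 1).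
  have c0 : 0 < c by rewrite !mulr_gt0 ?powR_gt0.
  have rho1 : rho < 1.
    rewrite -subr_gt0 one_sub_rho// divr_gt0// lt_def sqr_ge0 andbT.
    by rewrite expf_neq0// subr_eq0.
  have rr : rho ^+ 2 < 1 by rewrite exprn_ilt1// ltW.
  have rr0 : 0 < rho ^+ 2 by rewrite exprn_gt0.
  apply: (@le_trans _ _ (\sum_(0 <= k <oo) ((c * Ck)%:E * (k.+1%:R `^ (- s - 2^-1) * (rho ^+ 2) ^+ k)%:E))%E).
    apply: lee_nneseries => k _.
      by move=> _; rewrite lee_fin potential_term_ge0// mulr_ge0// ltW.
    rewrite -EFinM lee_fin /potential_term -/c -/rho exprM -[leRHS]mulrA ler_wpM2l ?(ltW c0)//.
    rewrite mulrA; apply: ler_wpM2r; first by rewrite exprn_ge0// ltW.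
    exact: HCk.
  rewrite nneseriesZl; last first.
    by move=> k _; rewrite lee_fin; apply: mulr_ge0; [exact: powR_ge0|exact/exprn_ge0/ltW].
  apply: (le_trans (lee_wpmul2l _ (HC _ rr0 rr))); first by rewrite lee_fin mulr_ge0 ?ltW.
  rewrite -EFinM lee_fin -one_sub_rho// -/rho.
  have -> : 2^-1 * 4 `^ (1 - s) * (Ck * C) * (x ^+ 2 + y ^+ 2) `^ (s - b - 1) *
     (1 - rho) `^ (- (th / 2)) = c * Ck * (C * (1 - rho) `^ (- (th / 2))) by rewrite /c; ring.
  apply: ler_wpM2l; first by rewrite mulr_ge0 ?ltW.
  apply: ler_wpM2l; first exact: ltW.
  rewrite !powRN lef_pV2 ?posrE ?powR_gt0 ?subr_gt0//.
  apply: ge0_ler_powR; rewrite ?nnegrE ?subr_ge0 ?(ltW rr) ?(ltW rho1) ?divr_ge0//.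
  by rewrite lerD2l lerN2 expr2 ger_pMr// ltW.
have [thp|thn] := ltP 0 th.
  have [||C C0 HC] := @nneseries_powR_subcritical R (th / 2).
  - by rewrite divr_gt0.
  - by rewrite ltr_pdivrMr// mul1r (lt_le_trans th1)// ler1n.
  exists C => // rho r0 r1; apply: le_trans (HC rho (ltW r0) r1).
  apply: lee_nneseries => k _; first by move=> _; rewrite lee_fin mulr_ge0 ?powR_ge0 ?exprn_ge0 ?(ltW r0).
  rewrite lee_fin; apply: ler_wpM2r; first by rewrite exprn_ge0 ?(ltW r0).
  by apply: ler_powR; rewrite ?ler1n//; lra.
have s2 : 0 < s - 2^-1 by case: hth; lra.
exists (1 + (s - 2^-1)^-1); first by rewrite addr_gt0 ?invr_gt0.
have thz : th = 0 by apply/eqP; rewrite eq_le thn th0.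
move=> rho r0 r1; rewrite thz mul0r oppr0 powRr0 mulr1; apply: le_trans (nneseries_powR_convergent s2 (ltW r0) (ltW r1)).
apply: lee_nneseries => k _; first by move=> _; rewrite lee_fin mulr_ge0 ?powR_ge0 ?exprn_ge0 ?(ltW r0).
by rewrite (_ : - 1 - (s - 2^-1) = - s - 2^-1)//; lra.
Qed.

(** The first $m$ terms already have the right size if $\rho^{2m}$ is at least one half, which follows
    from the hypothesis on [m] by Bernoulli's inequality. *)
Lemma potential_series_ge b s : -1 < b -> s < b + 1 ->
  exists2 c : R, 0 < c & forall x y m, 0 < x -> 0 < y ->
   4 * m%:R * ((x - y) ^+ 2 / (x ^+ 2 + y ^+ 2)) <= 1 ->
   ((c * (x ^+ 2 + y ^+ 2) `^ (s - b - 1) * \sum_(k < m.+1) k.+1%:R `^ (- s - 2^-1))%:E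
      <= potential_series b s x y)%E.
Proof.
move=> b1 sb; have [Ck Ck0 HCk] := kcoef_ge b1 sb.
exists (2^-1 * 4 `^ (1 - s) * Ck / 2).
  by rewrite divr_gt0 ?mulr_gt0 ?powR_gt0.
move=> x y m x0 y0 hm; have /andP[r0 r1] := rho_itv x0 y0.
have S0 : 0 < x ^+ 2 + y ^+ 2 by rewrite addr_gt0 ?exprn_gt0.
rewrite -one_sub_rho// in hm.
pose rho := 2 * (x * y) / (x ^+ 2 + y ^+ 2); rewrite -/rho in hm r0 r1.
pose c := 2^-1 * 4 `^ (1 - s) * (x ^+ 2 + y ^+ 2) `^ (s - b - 1).
have c0 : 0 < c by rewrite !mulr_gt0 ?powR_gt0.
have pge0 k : 0 <= potential_term b s x y k.
  by apply: potential_term_ge0 => //; rewrite mulr_ge0// ltW.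
apply: (@le_trans _ _ (\sum_(0 <= k < m.+1) (potential_term b s x y k)%:E)%E); last first.
  by apply: nneseries_lim_ge => k _ _; rewrite lee_fin.
rewrite sumEFin lee_fin big_mkord.
have -> : 2^-1 * 4 `^ (1 - s) * Ck / 2 * (x ^+ 2 + y ^+ 2) `^ (s - b - 1) *
   \sum_(k < m.+1) k.+1%:R `^ (- s - 2^-1) =
   \sum_(k < m.+1) c * (Ck * k.+1%:R `^ (- s - 2^-1) * 2^-1).
  by rewrite mulr_sumr; apply: eq_bigr => k _; rewrite /c; ring.
apply: ler_sum => k _; rewrite /potential_term -/c -/rho; apply: ler_wpM2l; first exact: ltW.
apply: ler_pM => //; first by rewrite mulr_ge0 ?powR_ge0 ?ltW.
have bern n : 1 - n%:R * (1 - rho) <= rho ^+ n.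
  elim: n => [|n IH]; first by rewrite mul0r subr0 expr0.
  rewrite exprS; apply: le_trans (ler_wpM2l (ltW r0) IH).
  have : 0 <= n%:R :> R by []; have nS : n.+1%:R = n%:R + 1 :> R by rewrite -natr1.
  rewrite nS => n0; rewrite -subr_ge0.
  rewrite (_ : _ - _ = n%:R * (1 - rho) ^+ 2); last by ring.
  by rewrite mulr_ge0 ?sqr_ge0.
apply: le_trans (bern _).
have km : k%:R <= m%:R :> R by rewrite ler_nat -ltnS.
have k0 : 0 <= k%:R :> R by [].
rewrite natrM; nra.
Qed.

Local Opaque potential_series.

Lemma fin_num_ex (x : \bar R) : x \is a fin_num -> exists u, x = u%:E.
Proof. by case: x => // r _; exists r. Qed.

(** The odd part carries an additional factor $xy/(x^2+y^2)$, hence obeys the same bound as the even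
    part. *)
Lemma potentialK_le a s th : -1 < a -> 0 < s -> s < a + 1 -> 0 <= th -> th < 1 ->
  1 - 2 * s <= th -> (0 < th \/ 1 < 2 * s) ->
  exists2 C : R, 0 < C & forall x y, x != 0 -> y != 0 -> `|x| != `|y| ->
   (`|potentialK a s x y| <= (C * (x ^+ 2 + y ^+ 2) `^ (s - a - 1) *
      ((`|x| - `|y|) ^+ 2 / (x ^+ 2 + y ^+ 2)) `^ (- (th / 2)))%:E)%E.
Proof.
move=> a1 s0 sa th0 th1 sth hth.
have a11 : -1 < a + 1 by lra.
have sa1 : s < a + 1 + 1 by lra.
have [C1 C10 H1] := potential_series_le a1 sa th0 th1 sth hth.
have [C2 C20 H2] := potential_series_le a11 sa1 th0 th1 sth hth.
have G0 := Gamma_gt0 s0.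
exists ((Gamma s)^-1 / 2 * (C1 + C2)).
  by rewrite mulr_gt0 ?divr_gt0 ?invr_gt0 ?addr_gt0.
move=> x y x0 y0 xy.
have x0' : 0 < `|x| by rewrite normr_gt0.
have y0' : 0 < `|y| by rewrite normr_gt0.
have {}H1 := H1 _ _ x0' y0' xy; have {}H2 := H2 _ _ x0' y0' xy.
rewrite !real_normK ?num_real// in H1 H2.
have S0 : 0 < x ^+ 2 + y ^+ 2 by rewrite ltr_pwDl ?sqr_ge0// exprn_even_gt0.
pose Q := ((`|x| - `|y|) ^+ 2 / (x ^+ 2 + y ^+ 2)) `^ (- (th / 2)).
have Q0 : 0 <= Q by exact: powR_ge0.
rewrite -/Q in H1 H2 *.
have xy0 : 0 <= `|x| * `|y| by rewrite mulr_ge0.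
have P1 := potential_series_ge0 a1 sa xy0.
have P2 := potential_series_ge0 a11 sa1 xy0.
have F1 : potential_series a s `|x| `|y| \is a fin_num.
  by rewrite (ge0_fin_numE P1); exact: le_lt_trans H1 (ltry _).
have F2 : potential_series (a + 1) s `|x| `|y| \is a fin_num.
  by rewrite (ge0_fin_numE P2); exact: le_lt_trans H2 (ltry _).
have -> : (potentialK a s x y = ((Gamma s)^-1 / 2)%:E *
     (potential_series a s `|x| `|y| + (x * y)%:E * potential_series (a + 1) s `|x| `|y|))%E.
  have [xyp|] := ltP 0 (x * y); first exact: potentialK_pos.
  rewrite le_eqVlt mulf_eq0 (negbTE x0) (negbTE y0)/= => xyn; exact: potentialK_neg.
have [u1 e1] : exists u, potential_series a s `|x| `|y| = u%:E.
  exact: (fin_num_ex F1).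
have [u2 e2] : exists u, potential_series (a + 1) s `|x| `|y| = u%:E.
  exact: (fin_num_ex F2).
rewrite e1 in P1 H1 *; rewrite e2 in P2 H2 *; rewrite !lee_fin in P1 P2 H1 H2.
have -> : (((Gamma s)^-1 / 2)%:E * (u1%:E + (x * y)%:E * u2%:E) =
   ((Gamma s)^-1 / 2 * (u1 + x * y * u2))%:E)%E by [].
rewrite abse_EFin lee_fin.
rewrite normrM [`|_ / 2|]ger0_norm; last by rewrite divr_ge0// invr_ge0 ltW.
have g0 : 0 <= (Gamma s)^-1 / 2 by rewrite divr_ge0// invr_ge0 ltW.
move: ((Gamma s)^-1 / 2) g0 => g g0; rewrite -[leRHS]mulrA -[leRHS]mulrA.
apply: ler_wpM2l => //.
apply: (le_trans (ler_normD _ _)); rewrite normrM.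
rewrite (ger0_norm P1) (ger0_norm P2) mulrDl; apply: lerD; first by rewrite mulrA.
apply: (le_trans (ler_wpM2l (normr_ge0 _) H2)).
have -> : s - (a + 1) - 1 = (s - a - 1) - 1 by ring.
rewrite powRD ?(gt_eqF S0) ?implybT// powR_inv1 ?(ltW S0)//.
have -> : `|x * y| * (C2 * ((x ^+ 2 + y ^+ 2) `^ (s - a - 1) / (x ^+ 2 + y ^+ 2)) * Q) =
   (`|x * y| / (x ^+ 2 + y ^+ 2)) * (C2 * (x ^+ 2 + y ^+ 2) `^ (s - a - 1) * Q) by ring.
rewrite [leRHS]mulrA -[leRHS]mul1r; apply: ler_wpM2r.
  by rewrite !mulr_ge0 ?powR_ge0// ltW.
rewrite ler_pdivrMr// mul1r normrM -(real_normK (num_real x)) -(real_normK (num_real y)).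
have := sqr_ge0 (`|x| - `|y|); rewrite sqrrB.
by rewrite -[_ *+ 2]mulr_natl; lra.
Qed.

(** In the quadrant the odd part is nonnegative and can be dropped. *)
Lemma potentialK_ge a s : -1 < a -> 0 < s -> s < a + 1 ->
  exists2 c : R, 0 < c & forall x y m, 0 < x -> 0 < y ->
   4 * m%:R * ((x - y) ^+ 2 / (x ^+ 2 + y ^+ 2)) <= 1 ->
   ((c * (x ^+ 2 + y ^+ 2) `^ (s - a - 1) * \sum_(k < m.+1) k.+1%:R `^ (- s - 2^-1))%:E
      <= potentialK a s x y)%E.
Proof.
move=> a1 s0 sa; have [c c0 Hc] := potential_series_ge a1 sa.
have G0 := Gamma_gt0 s0.
have g0 : 0 < (Gamma s)^-1 / 2 by rewrite divr_gt0 ?invr_gt0.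
exists ((Gamma s)^-1 / 2 * c); first by rewrite mulr_gt0.
move=> x y m x0 y0 hm; rewrite potentialK_pos ?mulr_gt0// !gtr0_norm//.
rewrite -[_ * c * _ * _]mulrA -[_ * c * _]mulrA EFinM; apply: lee_wpmul2l; first by rewrite lee_fin ltW.
rewrite mulrA (le_trans (Hc _ _ _ x0 y0 hm))// leeDl// mule_ge0 ?lee_fin ?mulr_ge0 ?(ltW x0) ?(ltW y0)//.
by apply: potential_series_ge0; rewrite ?mulr_ge0 ?(ltW x0) ?(ltW y0)//; lra.
Qed.

(** The series formula may fail for $y \in \{0, x, -x\}$, a finite set. *)
Lemma measurable_potentialK a s x : -1 < a -> 0 < s -> s < a + 1 -> x != 0 ->
  measurable_fun [set: R] (fun y : R => potentialK a s x y).
Proof.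
move=> a1 s0 sa x0.
have a11 : -1 < a + 1 by lra.
have sa1 : s < a + 1 + 1 by lra.
pose K y := (((Gamma s)^-1 / 2)%:E * (potential_series a s `|x| `|y| +
  (x * y)%:E * potential_series (a + 1) s `|x| `|y|))%E.
have mK : measurable_fun [set: R] K.
  apply: measurable_funeM; apply: emeasurable_funD; first exact: measurable_potential_series.
  apply: emeasurable_funM; last exact: measurable_potential_series.
  by apply/measurable_EFinP; exact: measurable_funM.
pose N := [set 0; x; - x] : set R.
have mN : measurable N by apply: measurableU; [apply: measurableU|].
rewrite -(setUv N); apply/measurable_funU => //; first exact: measurableC.
split.
  apply/measurable_funU => //; first exact: measurableU.
  by split; [apply/measurable_funU => //; split|]; exact: measurable_fun_set1.
apply: (eq_measurable_fun K); last exact: measurable_funS mK.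
move=> y; rewrite inE /N/= => /not_orP[/not_orP[/eqP y0 /eqP yx] /eqP yNx].
have xy : `|x| != `|y|.
  apply/negP => /eqP e; have : y ^+ 2 == x ^+ 2.
    by rewrite -(real_normK (num_real x)) -(real_normK (num_real y)) e.
  by rewrite eqf_sqr (negbTE yx) (negbTE yNx).
have [thm [th0 th1 sth hth]] : exists th : R, [/\ 0 < th, th < 1, 1 - 2 * s <= th & 0 < th \/ 1 < 2 * s].
  exists (Num.max (1 / 2) (1 - s)); split.
  - by rewrite lt_max divr_gt0.
  - by rewrite gt_max; apply/andP; split; lra.
  - by rewrite le_max; apply/orP; right; lra.
  - by left; rewrite lt_max divr_gt0.
have x0' : 0 < `|x| by rewrite normr_gt0.
have y0' : 0 < `|y| by rewrite normr_gt0.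
have xy0 : 0 <= `|x| * `|y| by rewrite mulr_ge0.
have fin b : -1 < b -> s < b + 1 -> potential_series b s `|x| `|y| \is a fin_num.
  move=> b1 sb; have [C C0 HC] := potential_series_le b1 sb (ltW th0) th1 sth hth.
  rewrite ge0_fin_numE ?potential_series_ge0//.
  by rewrite (le_lt_trans (HC _ _ x0' y0' xy))// ltry.
have [xyp|] := ltP 0 (x * y); first by rewrite potentialK_pos.
rewrite le_eqVlt mulf_eq0 (negbTE x0) (negbTE y0)/= => xyn.
by rewrite potentialK_neg// fin.
Qed.

End kernel_bounds.

(** * Integration against the weighted measures *)
Section integral_monotone.
Context d (T : measurableType d) (R : realType) (mu : {measure set T -> \bar R}).
Implicit Types g h : T -> \bar R.

(** From the definition of the integral as a supremum over simple functions. *)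
Lemma ge0_le_integralT g h : (forall x, 0 <= g x)%E -> (forall x, g x <= h x)%E ->
  (\int[mu]_x g x <= \int[mu]_x h x)%E.
Proof.
move=> g0 gh; have h0 x : (0 <= h x)%E by exact: le_trans (gh x).
rewrite !ge0_integralTE//; apply: le_ereal_sup => _ [f fg <-]; exists f => // x.
exact: le_trans (gh x).
Qed.

(** The majorant carries the measurability (and in the next lemma the minorant), as the other side will
    be a potential, which is not known to be measurable in [x]. *)
Lemma integral_le_ae g h : (forall x, 0 <= g x)%E -> (forall x, 0 <= h x)%E ->
  measurable_fun setT h -> {ae mu, forall x, g x <= h x}%E ->
  (\int[mu]_x g x <= \int[mu]_x h x)%E.
Proof.
move=> g0 h0 mh [N [mN N0 hN]].
pose k x := (h x + (+oo)%E * (\1_N x)%:E)%E.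
have k0 x : (0 <= k x)%E by rewrite adde_ge0// mule_ge0// lee_fin.
have mk : measurable_fun setT k.
  by apply: emeasurable_funD => //; apply: measurable_funeM; exact/measurable_EFinP.
have -> : (\int[mu]_x h x = \int[mu]_x k x)%E.
  apply: ge0_ae_eq_integral => //; exists N; split=> // x /= nx.
  apply: contrapT => Nx; apply: nx => _; rewrite /k indicE memNset// mule0 adde0//.
apply: ge0_le_integralT => // x; rewrite /k.
have [Nx|Nx] := pselect (N x).
  by rewrite indicE mem_set// mule1 addey ?leey// gt_eqF// (lt_le_trans _ (h0 x))// ltNy0.
rewrite indicE memNset// mule0 adde0; apply: contrapT => ngh.
by apply: Nx; apply: hN.
Qed.

Lemma integral_ge_ae g h : (forall x, 0 <= g x)%E -> (forall x, 0 <= h x)%E ->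
  measurable_fun setT h -> {ae mu, forall x, h x <= g x}%E ->
  (\int[mu]_x h x <= \int[mu]_x g x)%E.
Proof.
move=> g0 h0 mh [N [mN N0 hN]].
pose k x := (h x * (\1_(~` N) x)%:E)%E.
have k0 x : (0 <= k x)%E by rewrite mule_ge0// lee_fin.
have mk : measurable_fun setT k.
  by apply: emeasurable_funM => //; exact/measurable_EFinP/measurable_indic/measurableC.
have -> : (\int[mu]_x h x = \int[mu]_x k x)%E.
  apply: ge0_ae_eq_integral => //; exists N; split=> // x /= nx.
  by apply: contrapT => Nx; apply: nx => _; rewrite /k indicE mem_set// mule1.
apply: ge0_le_integralT => // x; rewrite /k.
have [Nx|Nx] := pselect (N x).
  by rewrite indicE memNset ?mule0//=; exact.
rewrite indicE mem_set// mule1; apply: contrapT => ngh.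
by apply: Nx; apply: hN.
Qed.

End integral_monotone.

Section weighted.
Context {R : realType}.
Implicit Types (a alpha x y c : R) (f g : R -> \bar R).
Local Notation leb := (@lebesgue_measure R).
Local Notation mT := (measurableTypeR R).

Lemma w_density_ge0 alpha x : 0 <= w_density alpha x.
Proof. exact: powR_ge0. Qed.

Lemma measurable_mul_density alpha (f : mT -> \bar R) : measurable_fun setT f ->
  measurable_fun setT (fun x => f x * (w_density alpha x)%:E)%E.
Proof.
by move=> mf; apply: emeasurable_funM => //; apply/measurable_EFinP; exact: measurable_w_density.
Qed.

Import HBNNSimple.

(** By monotone convergence from indicators, where it is the definition of the measure. *)
Lemma integral_w_measure alpha (f : mT -> \bar R) : (forall x, 0 <= f x)%E ->
  measurable_fun setT f ->
  (\int[w_measure alpha]_x f x = \int[leb]_x (f x * (w_density alpha x)%:E))%E.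
Proof.
move=> f0 mf; pose h := nnsfun_approx measurableT mf.
have den0 x : (0 <= (w_density alpha x)%:E)%E by rewrite lee_fin w_density_ge0.
have mden : measurable_fun setT (fun x : mT => (w_density alpha x)%:E).
  by apply/measurable_EFinP; exact: measurable_w_density.
have -> : (\int[w_measure alpha]_x f x =
    lim ((\int[w_measure alpha]_x (EFin \o h n) x)%E @[n --> \oo]))%E.
  have fE x : f x = lim ((EFin \o h n) x @[n --> \oo]).
    by apply/esym/cvg_lim => //; exact: cvg_nnsfun_approx.
  under eq_integral => x _ do rewrite fE.
  apply: monotone_convergence => //.
  - by move=> n; apply/measurable_EFinP.
  - by move=> n x _ //=; rewrite lee_fin.
  - by move=> x _ a b ab; rewrite lee_fin; exact/lefP/nd_nnsfun_approx.
have -> : (\int[leb]_x (f x * (w_density alpha x)%:E) =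
    lim ((\int[leb]_x ((EFin \o h n) x * (w_density alpha x)%:E))%E @[n --> \oo]))%E.
  have fE x : (f x * (w_density alpha x)%:E =
      lim ((EFin \o h n) x * (w_density alpha x)%:E @[n --> \oo]))%E.
    by apply/esym/cvg_lim => //; apply: cvgeZr => //; exact: cvg_nnsfun_approx.
  under eq_integral => x _ do rewrite fE.
  apply: monotone_convergence => //.
  - by move=> n; apply: measurable_mul_density; exact/measurable_EFinP.
  - by move=> n x _ /=; rewrite mule_ge0// lee_fin.
  - by move=> x _ a b ab/=; rewrite lee_wpmul2r ?den0// lee_fin; exact/lefP/nd_nnsfun_approx.
suff suf n : (\int[w_measure alpha]_x (EFin \o h n) x =
    \int[leb]_x ((EFin \o h n) x * (w_density alpha x)%:E))%E.
  by under eq_fun do rewrite suf.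
rewrite /=.
under eq_integral do rewrite fimfunE -fsumEFin//.
rewrite ge0_integral_fsum//=; last 2 first.
- move=> r; apply/measurable_EFinP; apply: measurable_funM => //.
- by move=> m x _; exact: nnfun_muleindic_ge0.
under [RHS]eq_integral => x _.
  rewrite fimfunE -fsumEFin// ge0_mule_fsuml; last by move=> r; exact: nnfun_muleindic_ge0.
  over.
rewrite ge0_integral_fsum//=; last 2 first.
- by move=> r; apply: measurable_mul_density; apply/measurable_EFinP; exact: measurable_funM.
- by move=> r x _; rewrite mule_ge0 ?den0//; exact: nnfun_muleindic_ge0.
apply: eq_fsbigr => r rhn.
have r0 : 0 <= r by move: rhn; rewrite inE => -[t _ <-].
under eq_integral do rewrite EFinM.
rewrite (@ge0_integralZl_EFin _ _ _ _ _ measurableT) //; [|exact/measurable_EFinP].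
rewrite integral_indic// setIT.
under [RHS]eq_integral do rewrite EFinM -muleA.
rewrite [RHS](@ge0_integralZl_EFin _ _ _ _ _ measurableT)//; last 2 first.
- by move=> x _; rewrite mule_ge0 ?den0// lee_fin.
- by apply: emeasurable_funM => //; exact/measurable_EFinP.
congr (_ * _)%E; rewrite /w_measure [LHS]integral_mkcond; apply: eq_integral => x _.
by rewrite patchE indicE; case: ifPn => _; rewrite ?mul1e ?mul0e.
Qed.

Lemma w_measure_le alpha c (A : set mT) : measurable A -> 0 <= c ->
  (forall x, A x -> w_density alpha x <= c) -> (w_measure alpha A <= c%:E * leb A)%E.
Proof.
move=> mA c0 Ac; rewrite /w_measure -(integral_cst _ mA); apply: ge0_le_integral => //.
- by move=> x _; rewrite lee_fin w_density_ge0.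
- apply/measurable_EFinP; apply: measurable_funTS; exact: measurable_w_density.
Qed.

(** The sets are bounded in [x] and in the density, which is unbounded at 0 when $2\alpha + 1 < 0$. *)
Lemma w_measure_sigma_finite alpha : sigma_finite setT (w_measure alpha : set mT -> \bar R).
Proof.
pose F n := `[- n%:R, n%:R]%classic `&` [set x | w_density alpha x <= n%:R] : set mT.
have mF n : measurable (F n).
  apply: measurableI => //.
  have := @measurable_w_density R alpha measurableT _ (@measurable_itv R `]-oo, n%:R]).
  by rewrite setTI; congr (measurable _); apply/seteqP; split => x; rewrite /= in_itv.
exists F => [|n]; last first.
  split=> //; apply: (@le_lt_trans _ _ (n%:R%:E * leb (F n))%E).
    by apply: w_measure_le => // x [].
  pose I : set R := [set` `[- n%:R, n%:R] ].
  apply: (@le_lt_trans _ _ (n%:R%:E * leb I)%E).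
    apply: lee_wpmul2l; first by rewrite lee_fin.
    apply: (@le_measure _ _ _ lebesgue_measure (F n) I); last exact: subIsetl.
      exact: (mem_set (mF n)).
    exact: (mem_set (measurable_itv `[- n%:R, n%:R])).
  by rewrite /I lebesgue_measure_itv/=; case: ifP => _; rewrite -?EFinB -?EFinM ?mule0 ltry.
apply/seteqP; split => x //= _.
exists (Num.trunc (Num.max `|x| (w_density alpha x))).+1 => //.
have := truncnS_gt (Num.max `|x| (w_density alpha x)).
rewrite gt_max => /andP[h1 h2]; split; last exact: ltW.
by rewrite /= in_itv/= -ler_norml ltW.
Qed.

HB.instance Definition _ alpha := @Measure_isSigmaFinite.Build _ _ _
  (w_measure alpha : set mT -> \bar R) (w_measure_sigma_finite alpha).

(** The density vanishes at most at 0. *)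
Lemma w_measure_null alpha (A : set mT) : measurable A ->
  (w_measure alpha A = 0 <-> leb A = 0)%E.
Proof.
move=> mA; have md : measurable_fun A (fun x : mT => (w_density alpha x)%:E).
  by apply/measurable_EFinP; apply: measurable_funTS; exact: measurable_w_density.
split=> [w0|l0]; last exact: null_set_integral.
have : (\int[leb]_(x in A) `|(w_density alpha x)%:E| = 0)%E.
  rewrite -[RHS]w0; apply: eq_integral => x _; rewrite gee0_abs// lee_fin.
  exact: w_density_ge0.
move=> /(ae_eq_integral_abs leb mA md)[N [mN N0 hN]].
apply: (@subset_measure0 _ _ _ leb A (N `|` [set 0])) => //.
- exact: measurableU.
- move=> x Ax; have [->|x0] := eqVneq x 0; [by right|left].
  apply: hN => /= /(_ Ax)[] /eqP; rewrite /w_density powR_eq0 normr_eq0 (negbTE x0)//.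
apply/eqP; rewrite eq_le measure_ge0 andbT (le_trans (measureU2 _ _ _))//.
by rewrite [X in (X + _)%E]N0 add0e [leLHS]lebesgue_measure_set1.
Qed.

Lemma ae_w_measure alpha (P : mT -> Prop) :
  {ae w_measure alpha, forall x, P x} <-> {ae leb, forall x, P x}.
Proof.
by split=> -[N [mN N0 hN]]; exists N; split => //; exact/(w_measure_null alpha mN).
Qed.

End weighted.

(** * Dyadic pieces of the plane *)
Section kernel_pieces.
Context {R : realType}.
Local Notation mT := (measurableTypeR R).
Local Notation leb := (@lebesgue_measure R).
Local Notation mu := (@w_measure R (-1)).
Implicit Types (x y m c : R) (j : nat).

(** Only upper bounds on the distance of the moduli are imposed, so the near pieces decrease with [j];
    the low and high pieces are dyadic sectors. *)
Definition near_piece j : set (mT * mT) :=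
  [set z | `|z.1| <= 2 * `|z.2|] `&` [set z | `|z.2| <= 2 * `|z.1|] `&`
  [set z | `| `|z.1| - `|z.2| | * 2 ^+ j <= Num.max `|z.1| `|z.2|].

Definition low_piece j : set (mT * mT) :=
  [set z | `|z.2| * 2 ^+ j.+1 <= `|z.1|] `&` [set z | `|z.1| <= `|z.2| * 2 ^+ j.+2].

Definition high_piece j : set (mT * mT) :=
  [set z | `|z.1| * 2 ^+ j.+1 <= `|z.2|] `&` [set z | `|z.2| <= `|z.1| * 2 ^+ j.+2].

Lemma measurable_leset (f g : mT * mT -> R) : measurable_fun setT f -> measurable_fun setT g ->
  measurable [set z | f z <= g z].
Proof. by move=> mf mg; rewrite -[X in measurable X]setTI; exact: measurable_fun_le. Qed.

Let m1 : measurable_fun setT (fun z : mT * mT => `|z.1|).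
Proof. by apply: measurableT_comp => //; exact: measurable_fst. Qed.

Let m2 : measurable_fun setT (fun z : mT * mT => `|z.2|).
Proof. by apply: measurableT_comp => //; exact: measurable_snd. Qed.

Lemma measurable_near_piece j : measurable (near_piece j).
Proof.
apply: measurableI; first apply: measurableI.
- by apply: measurable_leset => //; exact: measurable_funM.
- by apply: measurable_leset => //; exact: measurable_funM.
- apply: measurable_leset; last exact: measurable_maxr.
  apply: measurable_funM => //; apply: measurableT_comp => //.
  exact: measurable_funB.
Qed.

Lemma measurable_low_piece j : measurable (low_piece j).
Proof. by apply: measurableI; apply: measurable_leset => //; exact: measurable_funM. Qed.

Lemma measurable_high_piece j : measurable (high_piece j).
Proof. by apply: measurableI; apply: measurable_leset => //; exact: measurable_funM. Qed.

(** The set lies in two symmetric intervals, where the density is at most $1/m$. *)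
Lemma inv_measure_le (m c c' : R) (A : set mT) : measurable A -> 0 < m -> c <= c' ->
  (forall y, A y -> m <= `|y| /\ c <= `|y| <= c') ->
  (mu A <= (2 * (c' - c) / m)%:E)%E.
Proof.
move=> mA m0 cc hA; apply: (@le_trans _ _ (m^-1%:E * leb A)%E).
  apply: w_measure_le => //; first by rewrite invr_ge0 ltW.
  move=> y /hA[my _]; rewrite /w_density (_ : _ + 1 = -1); last by ring.
  rewrite powRN powRr1// lef_pV2// posrE// (lt_le_trans m0)//.
rewrite [_ / m]mulrC EFinM; apply: lee_wpmul2l; first by rewrite lee_fin invr_ge0 ltW.
pose I1 : set mT := [set` `[c, c'] ]; pose I2 : set mT := [set` `[- c', - c] ].
have mI1 : measurable I1 by exact: measurable_itv.
have mI2 : measurable I2 by exact: measurable_itv.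
apply: (@le_trans _ _ (leb (I1 `|` I2))).
  apply: (@le_measure _ _ _ lebesgue_measure A (I1 `|` I2)).
  - exact: (mem_set mA).
  - exact: (mem_set (measurableU _ _ mI1 mI2)).
  - move=> y /hA[_ /andP[h1 h2]]; have [y0|y0] := leP 0 y.
      by left; rewrite /I1/= in_itv/= -(ger0_norm y0) h1.
    by right; rewrite /I2/= in_itv/= lerNl lerNr -(ltr0_norm y0) h1 h2.
apply: (le_trans (measureU2 _ mI1 mI2)).
have L1 : leb I1 = (c' - c)%:E.
  rewrite /I1 lebesgue_measure_itv/= lte_fin; case: ltP => [_|h]; first by [].
  by rewrite (@le_anti _ _ c c') ?cc ?subrr.
have L2 : leb I2 = (c' - c)%:E.
  rewrite /I2 lebesgue_measure_itv/= lte_fin ltrN2; case: ltP => [_|h].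
    by rewrite -EFinB opprK addrC.
  by rewrite (@le_anti _ _ c c') ?cc ?subrr.
by rewrite [X in (X + _)%E]L1 [X in (_ + X)%E]L2 -EFinD lee_fin mulr_natl mulr2n.
Qed.

(** The coordinate axes may thus be ignored in the slice estimates. *)
Lemma inv_measure_set1 x : mu [set x] = 0%E.
Proof. by apply/w_measure_null => //; exact: lebesgue_measure_set1. Qed.

Lemma near_piece_sym j x y : near_piece j (x, y) -> near_piece j (y, x).
Proof. by move=> [[/= h1 h2] h3]; split=> //=; rewrite distrC maxC. Qed.

Lemma near_piece_slice j x (A : set mT) : measurable A ->
  (forall y, A y -> near_piece j (x, y)) -> (mu A <= (16 * 2^-1 ^+ j)%:E)%E.
Proof.
move=> mA hA; have h0 : 0 <= 16 * 2^-1 ^+ j :> R by rewrite mulr_ge0// exprn_ge0.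
have [x0|x0] := eqVneq x 0.
  apply: (@le_trans _ _ (mu [set 0])); last by rewrite inv_measure_set1 lee_fin.
  apply: (@le_measure _ _ _ mu A [set 0]).
  - exact: (mem_set mA).
  - exact: (mem_set (measurable_set1 0)).
  move=> y /hA[[/= _ h] _]; move: h; rewrite x0 normr0 mulr0 normr_le0 => /eqP//.
have xp : 0 < `|x| by rewrite normr_gt0.
have p0 : 0 < 2 ^+ j :> R by rewrite exprn_gt0.
pose r := 2 * `|x| * 2^-1 ^+ j.
have r0 : 0 <= r by rewrite !mulr_ge0// exprn_ge0.
have -> : 16 * 2^-1 ^+ j = 2 * ((`|x| + r) - (`|x| - r)) / (`|x| / 2).
  by rewrite /r; field; rewrite gt_eqF.
apply: inv_measure_le => //; first by rewrite divr_gt0.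
  by rewrite lerD2l ge0_cp// lerNl oppr0.
move=> y /hA[[/= h1 h2] h3]; split; first by rewrite ler_pdivrMr// mulrC.
rewrite -ler_distlC.
rewrite -(ler_pM2r p0) (le_trans h3)//.
have -> : r * 2 ^+ j = 2 * `|x| by rewrite /r exprVn divfK// gt_eqF.
by rewrite ge_max h2 andbT ler_peMl// ler1n.
Qed.

Lemma low_piece_slice1 j x (A : set mT) : measurable A ->
  (forall y, A y -> low_piece j (x, y)) -> (mu A <= 2%:E)%E.
Proof.
move=> mA hA.
have [x0|x0] := eqVneq x 0.
  apply: (@le_trans _ _ (mu [set 0])); last by rewrite inv_measure_set1 lee_fin.
  apply: (@le_measure _ _ _ mu A [set 0]).
  - exact: (mem_set mA).
  - exact: (mem_set (measurable_set1 0)).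
  move=> y /hA[/= h _]; move: h; rewrite x0 normr0 pmulr_lle0 ?exprn_gt0//.
  by rewrite normr_le0 => /eqP.
have xp : 0 < `|x| by rewrite normr_gt0.
have p0 i : 0 < 2 ^+ i :> R by rewrite exprn_gt0.
have -> : 2 = 2 * (`|x| / 2 ^+ j.+1 - `|x| / 2 ^+ j.+2) / (`|x| / 2 ^+ j.+2) :> R.
  by rewrite [2 ^+ j.+2]exprS; field; rewrite !gt_eqF.
apply: inv_measure_le => //; first by rewrite divr_gt0.
  by rewrite ler_pdivrMr// [2 ^+ j.+2]exprS mulrCA divfK ?gt_eqF// ler_peMl// ler1n.
by move=> y /hA[/= h1 h2]; rewrite !ler_pdivrMr// h2; split => //; rewrite ler_pdivlMr.
Qed.

Lemma low_piece_slice2 j y (A : set mT) : measurable A ->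
  (forall x, A x -> low_piece j (x, y)) -> (mu A <= 2%:E)%E.
Proof.
move=> mA hA.
have [y0|y0] := eqVneq y 0.
  apply: (@le_trans _ _ (mu [set 0])); last by rewrite inv_measure_set1 lee_fin.
  apply: (@le_measure _ _ _ mu A [set 0]).
  - exact: (mem_set mA).
  - exact: (mem_set (measurable_set1 0)).
  by move=> x /hA[/= _]; rewrite y0 normr0 mul0r normr_le0 => /eqP.
have yp : 0 < `|y| by rewrite normr_gt0.
have p0 i : 0 < 2 ^+ i :> R by rewrite exprn_gt0.
have -> : 2 = 2 * (`|y| * 2 ^+ j.+2 - `|y| * 2 ^+ j.+1) / (`|y| * 2 ^+ j.+1) :> R.
  by rewrite [2 ^+ j.+2]exprS; field; rewrite !gt_eqF.
apply: inv_measure_le => //; first by rewrite mulr_gt0.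
  by rewrite ler_pM2l// [2 ^+ j.+2]exprS ler_peMl// ?ler1n// ltW.
by move=> x /hA[/= h1 h2]; rewrite h1 h2.
Qed.

End kernel_pieces.

Section slices.
Context {R : realType}.
Local Notation mT := (measurableTypeR R).
Local Notation mu := (@w_measure R (-1)).

Lemma near_piece_slices j : (forall x : mT, mu (xsection (@near_piece R j) x) <= (16 * 2^-1 ^+ j)%:E)%E /\
  (forall y : mT, mu (ysection (@near_piece R j) y) <= (16 * 2^-1 ^+ j)%:E)%E.
Proof.
split=> x; apply: (@near_piece_slice R j x).
- exact: measurable_xsection (@measurable_near_piece R j).
- by move=> y; rewrite /xsection/= inE.
- exact: measurable_ysection (@measurable_near_piece R j).
- by move=> y; rewrite /ysection/= inE => /near_piece_sym.
Qed.

Lemma low_piece_slices j : (forall x : mT, mu (xsection (@low_piece R j) x) <= 2%:E)%E /\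
  (forall y : mT, mu (ysection (@low_piece R j) y) <= 2%:E)%E.
Proof.
split=> x; [apply: (@low_piece_slice1 R j x)|apply: (@low_piece_slice2 R j x)].
- exact: measurable_xsection (@measurable_low_piece R j).
- by move=> y; rewrite /xsection/= inE.
- exact: measurable_ysection (@measurable_low_piece R j).
- by move=> y; rewrite /ysection/= inE.
Qed.

(** The high pieces are the low ones with the operands exchanged. *)
Lemma high_piece_slices j : (forall x : mT, mu (xsection (@high_piece R j) x) <= 2%:E)%E /\
  (forall y : mT, mu (ysection (@high_piece R j) y) <= 2%:E)%E.
Proof.
split=> x; [apply: (@low_piece_slice2 R j x)|apply: (@low_piece_slice1 R j x)].
- exact: measurable_xsection (@measurable_high_piece R j).
- by move=> y; rewrite /xsection/= inE.
- exact: measurable_ysection (@measurable_high_piece R j).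
- by move=> y; rewrite /ysection/= inE.
Qed.

End slices.

(** * The kernel on the dyadic pieces *)
Section normalised_kernel.
Context {R : realType}.
Implicit Types (al s th A B x y : R).

Lemma powR_inv (u e : R) : 0 <= u -> u^-1 `^ e = (u `^ e)^-1.
Proof. by move=> u0; rewrite -powR_inv1// -powRrM mulN1r powRN. Qed.

(** $x^2 + y^2$ is comparable to $M^2$, and $A + B = D - 2s$ makes the powers of [M] cancel. *)
Lemma potentialK_normalised al s th A B : -1 < al -> 0 < s -> s < al + 1 -> 0 <= th -> th < 1 ->
  1 - 2 * s <= th -> (0 < th \/ 1 < 2 * s) -> A + B = 2 * al + 2 - 2 * s ->
  exists2 C : R, 0 < C & forall x y (M : R), x != 0 -> y != 0 -> `|x| != `|y| ->
   M = Num.max `|x| `|y| ->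
   ((`|x| `^ A * `|y| `^ B)%:E * `|potentialK al s x y| <=
     (C * ((`|x| / M) `^ A * (`|y| / M) `^ B * (M / `| `|x| - `|y| |) `^ th))%:E)%E.
Proof.
move=> a1 s0 sa th0 th1 sth hth AB.
have [C C0 HC] := potentialK_le a1 s0 sa th0 th1 sth hth.
exists (C * 2 `^ (th / 2)); first by rewrite mulr_gt0// powR_gt0.
move=> x y M x0 y0 xy ME.
have xp : 0 < `|x| by rewrite normr_gt0.
have yp : 0 < `|y| by rewrite normr_gt0.
have M0 : 0 < M by rewrite ME lt_max xp.
have d0 : 0 < `| `|x| - `|y| | by rewrite normr_gt0 subr_eq0.
pose S := x ^+ 2 + y ^+ 2.
have SM : M ^+ 2 <= S.
  rewrite /S -(real_normK (num_real x)) -(real_normK (num_real y)) ME.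
  by case: (leP `|x| `|y|) => _; rewrite ?lerDl ?lerDr sqr_ge0.
have S2M : S <= 2 * M ^+ 2.
  rewrite /S -(real_normK (num_real x)) -(real_normK (num_real y)) mulr_natl mulr2n.
  by apply: lerD; rewrite lerXn2r ?nnegrE// ?(ltW M0)// ME le_max lexx ?orbT.
have MM0 : 0 < M ^+ 2 by rewrite exprn_gt0.
have S0 : 0 < S by exact: lt_le_trans SM.
apply: (@le_trans _ _ ((`|x| `^ A * `|y| `^ B) * (C * S `^ (s - al - 1) *
    ((`|x| - `|y|) ^+ 2 / S) `^ (- (th / 2))))%:E).
  by rewrite [leRHS]EFinM; apply: lee_wpmul2l; [rewrite lee_fin mulr_ge0 ?powR_ge0|exact: HC].
rewrite lee_fin.
have b1 : S `^ (s - al - 1) <= M `^ (- A) * M `^ (- B).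
  have -> : M `^ (- A) * M `^ (- B) = (M ^+ 2) `^ (s - al - 1).
    rewrite -powRD ?(gt_eqF M0) ?implybT//.
    rewrite -powR_mulrn ?(ltW M0)// -powRrM; congr (_ `^ _); lra.
  have -> : s - al - 1 = - (al + 1 - s) by ring.
  rewrite !powRN lef_pV2 ?posrE ?powR_gt0//.
  by apply: ge0_ler_powR; rewrite ?nnegrE ?(ltW S0) ?(ltW MM0)//; lra.
have b2 : ((`|x| - `|y|) ^+ 2 / S) `^ (- (th / 2)) <=
    2 `^ (th / 2) * (M / `| `|x| - `|y| |) `^ th.
  have dd : 0 < (`|x| - `|y|) ^+ 2 by rewrite -real_normK ?num_real// exprn_gt0.
  have -> : (M / `| `|x| - `|y| |) `^ th = (M ^+ 2 / (`|x| - `|y|) ^+ 2) `^ (th / 2).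
    rewrite -[in RHS](real_normK (num_real (`|x| - `|y|))) -expr_div_n.
    rewrite -powR_mulrn ?divr_ge0 ?(ltW M0)// -powRrM; congr (_ `^ _); lra.
  rewrite -powRM// ?divr_ge0 ?(ltW MM0) ?(ltW dd)// powRN -powR_inv ?divr_ge0 ?(ltW dd) ?(ltW S0)//.
  have t2 : 0 <= th / 2 by rewrite divr_ge0.
  apply: ge0_ler_powR => //.
  - by rewrite nnegrE invr_ge0 divr_ge0 ?ltW.
  - by rewrite nnegrE mulr_ge0// divr_ge0 ?ltW.
  by rewrite invf_div mulrA ler_pM2r ?invr_gt0.
have -> : C * 2 `^ (th / 2) * ((`|x| / M) `^ A * (`|y| / M) `^ B * (M / `| `|x| - `|y| |) `^ th)
  = (`|x| `^ A * `|y| `^ B) * (C * (M `^ (- A) * M `^ (- B)) *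
     (2 `^ (th / 2) * (M / `| `|x| - `|y| |) `^ th)).
  rewrite !powRM ?invr_ge0 ?(ltW M0) ?(ltW xp) ?(ltW yp) ?(ltW d0)//.
  by rewrite !powRN -!powR_inv ?(ltW M0)//; ring.
apply: ler_wpM2l; first by rewrite mulr_ge0 ?powR_ge0.
apply: ler_pM => //; rewrite ?mulr_ge0 ?powR_ge0 ?(ltW C0)//.
by rewrite ler_pM2l.
Qed.

(** On the low pieces $|x|/M = 1$ and the distance of the moduli is comparable to [M], so only the power
    of $|y|/|x|$ remains; symmetrically on the high pieces. *)
Lemma kernel_decomposition al s th A B : -1 < al -> 0 < s -> s < al + 1 -> 0 <= th -> th < 1 ->
  1 - 2 * s <= th -> (0 < th \/ 1 < 2 * s) -> A + B = 2 * al + 2 - 2 * s ->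
  0 <= A -> 0 <= B ->
  exists2 C : R, 0 < C & forall x y, x != 0 -> y != 0 -> `|x| != `|y| -> exists j,
   [\/ near_piece j (x, y) /\
       ((`|x| `^ A * `|y| `^ B)%:E * `|potentialK al s x y| <= (C * (2 `^ th) ^+ j)%:E)%E,
       low_piece j (x, y) /\
       ((`|x| `^ A * `|y| `^ B)%:E * `|potentialK al s x y| <= (C * (2 `^ (- B)) ^+ j)%:E)%E |
       high_piece j (x, y) /\
       ((`|x| `^ A * `|y| `^ B)%:E * `|potentialK al s x y| <= (C * (2 `^ (- A)) ^+ j)%:E)%E].
Proof.
move=> a1 s0 sa th0 th1 sth hth AB A0 B0.
have [C C0 HC] := potentialK_normalised a1 s0 sa th0 th1 sth hth AB.
exists (C * 2); first by rewrite mulr_gt0.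
move=> x y x0 y0 xy; pose M := Num.max `|x| `|y|.
have {HC} := HC x y M x0 y0 xy erefl.
have xp : 0 < `|x| by rewrite normr_gt0.
have yp : 0 < `|y| by rewrite normr_gt0.
have M0 : 0 < M by rewrite lt_max xp.
have d0 : 0 < `| `|x| - `|y| | by rewrite normr_gt0 subr_eq0.
set K := (_ * `|potentialK _ _ _ _|)%E => HC.
have xM : `|x| / M <= 1 by rewrite ler_pdivrMr// mul1r /M le_max lexx.
have yM : `|y| / M <= 1 by rewrite ler_pdivrMr// mul1r /M le_max lexx orbT.
have pow1 (u e : R) : 0 <= u -> u <= 1 -> 0 <= e -> u `^ e <= 1.
  move=> u0 u1 e0; have h1 : 1 `^ e = 1 :> R by rewrite powR1.
  by rewrite -[leRHS]h1; apply: ge0_ler_powR; rewrite ?nnegrE.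
have p2 i : 0 < 2 ^+ i :> R by rewrite exprn_gt0.
(* the ratio is a power of two up to a factor two: far from the diagonal *)
have far (u v e w : R) : 0 < u -> 0 <= v -> 0 <= w -> 0 <= e -> 2 < u -> v <= u^-1 -> w <= 2 -> exists j,
    (2 ^+ j.+1 <= u <= 2 ^+ j.+2) /\ v `^ e * w `^ th <= 2 * (2 `^ (- e)) ^+ j .
  move=> u0 v0 w0 e0 u2 vu w2; have [j /andP[j1 j2]] : exists j, 2 ^+ j < u / 2 <= 2 ^+ j.+1.
    by apply: pow2_bracket; rewrite ltr_pdivlMr// mul1r.
  exists j; split.
    by rewrite exprS -ler_pdivlMl// mulrC (ltW j1)/= exprS -ler_pdivrMl// mulrC.
  rewrite mulrC; apply: ler_pM; rewrite ?powR_ge0//.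
    apply: (@le_trans _ _ (2 `^ th)).
      by apply: ge0_ler_powR; rewrite ?nnegrE.
    by rewrite -[leRHS]powRr1//; apply: ler_powR; rewrite ?ler1n// ltW.
  rewrite -exprn_powR// powRN -powR_inv ?exprn_ge0//.
  apply: ge0_ler_powR; rewrite ?nnegrE ?invr_ge0 ?exprn_ge0//.
  apply: (le_trans vu); rewrite lef_pV2 ?posrE//.
  by apply: (le_trans (ltW j1)); rewrite ler_pdivrMr// ler_peMr ?ler1n// ltW.
have [yx|yx] := ltP (2 * `|y|) `|x|.
  have ME : M = `|x| by rewrite /M; apply/max_idPl; lra.
  have [] := far (`|x| / `|y|) (`|y| / M) B (M / `| `|x| - `|y| |).
  - by rewrite divr_gt0.
  - by rewrite divr_ge0// ltW.
  - by rewrite divr_ge0// ltW.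
  - by [].
  - by rewrite ltr_pdivlMr.
  - by rewrite invf_div ME.
  - rewrite ler_pdivrMr// ME [`| _ - _ |]ger0_norm; lra.
  move=> j [/andP[]]; rewrite ler_pdivlMr// ler_pdivrMr// => h1 h2 h3.
  exists j; apply: Or32; split; first by split; rewrite /= mulrC.
  apply: (le_trans HC); rewrite lee_fin -[leRHS]mulrA; apply: ler_wpM2l; first exact: ltW.
  apply: le_trans h3; rewrite -mulrA.
  by apply: ler_piMl; [rewrite mulr_ge0 ?powR_ge0|apply: pow1; rewrite ?divr_ge0// ltW].
have [xy'|xy'] := ltP (2 * `|x|) `|y|.
  have ME : M = `|y| by rewrite /M; apply/max_idPr; lra.
  have [] := far (`|y| / `|x|) (`|x| / M) A (M / `| `|x| - `|y| |).
  - by rewrite divr_gt0.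
  - by rewrite divr_ge0// ltW.
  - by rewrite divr_ge0// ltW.
  - by [].
  - by rewrite ltr_pdivlMr.
  - by rewrite invf_div ME.
  - rewrite ler_pdivrMr// ME distrC [`| _ - _ |]ger0_norm; lra.
  move=> j [/andP[]]; rewrite ler_pdivlMr// ler_pdivrMr// => h1 h2 h3.
  exists j; apply: Or33; split; first by split; rewrite /= mulrC.
  apply: (le_trans HC); rewrite lee_fin -[leRHS]mulrA; apply: ler_wpM2l; first exact: ltW.
  apply: le_trans h3; rewrite [X in X * _]mulrC -mulrA.
  by apply: ler_piMl; [rewrite mulr_ge0 ?powR_ge0|apply: pow1; rewrite ?divr_ge0// ltW].
have [j /andP[j1 j2]] : exists j, 2 ^+ j < M / `| `|x| - `|y| | <= 2 ^+ j.+1.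
  apply: pow2_bracket; rewrite ltr_pdivlMr// mul1r /M.
  have xM' : `|x| <= M by rewrite /M le_max lexx.
  have yM' : `|y| <= M by rewrite /M le_max lexx orbT.
  by rewrite -/M real_ltr_norml ?num_real//; apply/andP; split; lra.
exists j; apply: Or31; split.
  split; first by split => /=.
  by rewrite /= mulrC -ler_pdivlMr// ltW.
apply: (le_trans HC); rewrite lee_fin -[leRHS]mulrA; apply: ler_wpM2l; first exact: ltW.
apply: (@le_trans _ _ ((M / `| `|x| - `|y| |) `^ th)).
  apply: ler_piMl; rewrite ?powR_ge0//.
  by apply: mulr_ile1; rewrite ?powR_ge0//; apply: pow1; rewrite ?divr_ge0// ltW.
apply: (@le_trans _ _ ((2 ^+ j.+1) `^ th)).
  by apply: ge0_ler_powR; rewrite ?nnegrE ?divr_ge0 ?exprn_ge0// ltW.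
rewrite exprn_powR// exprS; apply: ler_wpM2r; first by rewrite exprn_ge0 ?powR_ge0.
by rewrite -[leRHS]powRr1//; apply: ler_powR; rewrite ?ler1n// ltW.
Qed.

End normalised_kernel.

(** * Operators on the spaces of the invariant measure *)
Section norm_le.
Context {R : realType}.
Local Notation mT := (measurableTypeR R).
Local Notation leb := (@lebesgue_measure R).
Local Notation mu := (@w_measure R (-1)).
Implicit Types (g h : mT -> \bar R) (q : \bar R) (N r e : R).

(** For nonnegative [g] this is $\|g\|_{L^q(dx/|x|)} \le N$, without taking a root. *)
Definition norm_le q g N : Prop :=
  match q with
  | r%:E => (\int[mu]_x g x `^ r <= (N `^ r)%:E)%E
  | +oo%E => {ae mu, forall x, g x <= N%:E}%E
  | -oo%E => False
  end.

Lemma poweRD_le (u v : \bar R) r : 0 <= r -> (0 <= u)%E -> (0 <= v)%E ->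
  ((u + v) `^ r <= (2 `^ r)%:E * (u `^ r + v `^ r))%E.
Proof.
move=> r0 u0 v0.
have H (s t : \bar R) : (0 <= s)%E -> (s <= t)%E -> ((s + t) `^ r <= (2 `^ r)%:E * (s `^ r + t `^ r))%E.
  move=> s0 st; have t0 : (0 <= t)%E by exact: le_trans st.
  apply: (@le_trans _ _ ((2%:E * t) `^ r)%E).
    apply: poweR_le => //; last exact: adde_ge0.
    rewrite -[2%R]/(1 + 1 : R) EFinD ge0_muleDl// mul1e.
    exact: leeD.
  rewrite poweRM// poweR_EFin; apply: lee_wpmul2l; first by rewrite lee_fin powR_ge0.
  by rewrite leeDr// poweR_ge0.
have [uv|/ltW vu] := leP u v; first exact: H.
by rewrite addeC [(u `^ r + _)%E]addeC; exact: H.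
Qed.

(** The constant 4 replaces Minkowski's inequality. *)
Lemma norm_leD q g h N N' : (1 <= q)%E -> 0 < N -> 0 < N' -> (forall x, 0 <= g x)%E -> (forall x, 0 <= h x)%E ->
  measurable_fun setT g -> measurable_fun setT h ->
  norm_le q g N -> norm_le q h N' -> norm_le q (fun x => g x + h x)%E (4 * (N + N')).
Proof.
case: q => [r||] //=; last first.
  move=> _ N0 N0' _ _ _ _; apply: filterS2 => x gN hN.
  apply: (le_trans (leeD gN hN)); rewrite -EFinD lee_fin; lra.
rewrite lee_fin => r1 N0 N0' g0 h0 mg mh gN hN; have r0 : 0 < r by exact: lt_le_trans r1.
have mp (k : mT -> \bar R) : measurable_fun setT k -> measurable_fun setT (fun x => k x `^ r)%E.
  by move=> mk; apply: (measurableT_comp (measurable_poweR r)).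
apply: (@le_trans _ _ (\int[mu]_x ((2 `^ r)%:E * (g x `^ r + h x `^ r)))%E).
  by apply: ge0_le_integralT => x; [exact: poweR_ge0|apply: poweRD_le => //; exact: ltW].
rewrite ge0_integralZl_EFin//; last 2 first.
- by move=> x _; rewrite adde_ge0// poweR_ge0.
- by apply: emeasurable_funD; exact: mp.
rewrite ge0_integralD//; try exact: mp; try by move=> x _; exact: poweR_ge0.
apply: (@le_trans _ _ ((2 `^ r)%:E * ((N `^ r)%:E + (N' `^ r)%:E))%E).
  by apply: lee_wpmul2l; [rewrite lee_fin powR_ge0|exact: leeD].
rewrite -EFinD -EFinM lee_fin.
have N2 : 0 < N + N' by exact: addr_gt0.
have -> : 4 * (N + N') = 2 * (2 * (N + N')) by ring.
rewrite powRM ?mulr_ge0// ?(ltW N2)//; apply: ler_wpM2l; first exact: powR_ge0.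
rewrite powRM ?(ltW N2)//.
apply: (@le_trans _ _ (2 * (N + N') `^ r)).
  rewrite mulr_natl mulr2n; apply: lerD; apply: ge0_ler_powR; rewrite ?nnegrE ?(ltW r0) ?(ltW N0) ?(ltW N0') ?(ltW N2)//; lra.
apply: ler_wpM2r; first exact: powR_ge0.
by rewrite -[leLHS]powRr1//; apply: ler_powR; rewrite ?ler1n.
Qed.

Lemma norm_leZ q g N e : (1 <= q)%E -> 0 < e -> 0 < N -> (forall x, 0 <= g x)%E -> measurable_fun setT g ->
  norm_le q g N -> norm_le q (fun x => e%:E * g x)%E (e * N).
Proof.
case: q => [r||] //=; last first.
  by move=> _ e0 N0 _ _; apply: filterS => x gN; rewrite EFinM lee_wpmul2l// lee_fin ltW.
rewrite lee_fin => r1 e0 N0 g0 mg gN; have r0 : 0 < r by exact: lt_le_trans r1.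
under eq_integral => x _.
  rewrite poweRM//; last by rewrite lee_fin ltW.
  rewrite poweR_EFin; over.
rewrite ge0_integralZl_EFin//; last 3 first.
- by move=> x _; exact: poweR_ge0.
- by apply: (measurableT_comp (measurable_poweR r)).
- exact: powR_ge0.
rewrite powRM ?(ltW e0) ?(ltW N0)// EFinM; apply: lee_wpmul2l => //.
by rewrite lee_fin powR_ge0.
Qed.

Lemma norm_le_fin q g N : (1 <= q)%E -> 0 < N -> (forall x, 0 <= g x)%E -> measurable_fun setT g ->
  norm_le q g N -> {ae mu, forall x, g x < +oo}%E.
Proof.
case: q => [r||] //=; last first.
  by move=> _ N0 _ _; apply: filterS => x gN; exact: le_lt_trans gN (ltry _).
rewrite lee_fin => r1 N0 g0 mg gN; have r0 : 0 < r by exact: lt_le_trans r1.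
have ig : mu.-integrable setT (fun x => g x `^ r)%E.
  apply/integrableP; split; first by apply: (measurableT_comp (measurable_poweR r)).
  under eq_integral do rewrite gee0_abs ?poweR_ge0//.
  exact: le_lt_trans gN (ltry _).
have := integrable_ae measurableT ig.
apply: filterS => x /(_ Logic.I) fg; rewrite ltNge; apply/negP; rewrite leye_eq => /eqP gx.
by move: fg; rewrite gx poweRyr// gt_eqF.
Qed.

End norm_le.

Section operator_bounds.
Context {R : realType}.
Local Notation mT := (measurableTypeR R).
Local Notation leb := (@lebesgue_measure R).
Local Notation mu := (@w_measure R (-1)).
Implicit Types (F : mT -> R) (p q : \bar R) (N r e : R) (w A : nat -> R) (E : nat -> set (mT * mT)).
Implicit Types (T : (mT -> R) -> mT -> \bar R).

Definition op_bounded p q T : Prop :=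
  exists2 C : R, 0 < C & forall F N, measurable_fun setT F -> (forall y, 0 <= F y) -> 0 < N ->
    norm_le p (EFin \o F) N -> norm_le q (T F) (C * N).

Lemma measurable_indic_pair (E : set (mT * mT)) x : measurable E ->
  measurable_fun setT (fun y : mT => \1_E (x, y) : R).
Proof.
move=> mE; have m1 : measurable_fun setT (\1_E : mT * mT -> R) by exact: measurable_indic.
exact: (measurableT_comp m1 (measurable_pair1 x)).
Qed.

Lemma set_opZ (E : set (mT * mT)) F e x : measurable E -> measurable_fun setT F -> (forall y, 0 <= F y) ->
  0 <= e -> (set_op mu E (fun y => e * F y)%R x = e%:E * set_op mu E F x)%E.
Proof.
move=> mE mF F0 e0; rewrite /set_op -ge0_integralZl_EFin//.
- by apply: eq_integral => y _; rewrite -EFinM mulrCA.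
- by move=> y _; rewrite lee_fin mulr_ge0.
- apply/measurable_EFinP; apply: measurable_funM => //.
  exact: measurable_indic_pair.
Qed.

Lemma series_opZ w E F e x : (forall j, measurable (E j)) -> (forall j, 0 <= w j) ->
  measurable_fun setT F -> (forall y, 0 <= F y) -> 0 <= e ->
  (series_op mu w E (fun y => e * F y)%R x = e%:E * series_op mu w E F x)%E.
Proof.
move=> mE w0 mF F0 e0; rewrite /series_op -nneseriesZl; last first.
  by move=> j _; rewrite mule_ge0 ?lee_fin// set_op_ge0.
by apply: eq_eseriesr => j _; rewrite set_opZ// muleCA.
Qed.

Lemma norm_le_normalise (p : R) F N : measurable_fun setT F -> (forall y, 0 <= F y) -> 0 < N ->
  norm_le p%:E (EFin \o F) N -> (\int[mu]_y ((N^-1 * F y) `^ p)%:E <= 1)%E.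
Proof.
move=> mF F0 N0 /= FN.
have -> : (\int[mu]_y ((N^-1 * F y) `^ p)%:E = ((N^-1) `^ p)%:E * \int[mu]_y ((EFin \o F) y `^ p))%E.
  rewrite -ge0_integralZl_EFin//; last 3 first.
  - by move=> x _; exact: poweR_ge0.
  - by apply: (measurableT_comp (measurable_poweR p)); exact/measurable_EFinP.
  - exact: powR_ge0.
  by apply: eq_integral => y _; rewrite /= -EFinM powRM// invr_ge0 ltW.
apply: (le_trans (lee_wpmul2l _ FN)); first by rewrite lee_fin powR_ge0.
rewrite -EFinM -powRM ?invr_ge0 ?(ltW N0)// mulVf ?gt_eqF//.
by rewrite powR1.
Qed.
(** Homogeneity reduces boundedness to the unit ball. *)
Lemma op_bounded_series (p q : R) w E : (forall j, measurable (E j)) -> (forall j, 0 <= w j) ->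
  1 <= p -> 1 <= q ->
  (exists2 C : R, 0 < C & forall F, measurable_fun setT F -> (forall y, 0 <= F y) ->
    (\int[mu]_y (F y `^ p)%:E <= 1)%E ->
    (\int[mu]_x (series_op mu w E F x) `^ q <= C%:E)%E) ->
  op_bounded p%:E q%:E (series_op mu w E).
Proof.
move=> mE w0 p1 q1 [C C0 HC]; have q0 : 0 < q by exact: lt_le_trans q1.
have p0 : 0 < p by exact: lt_le_trans p1.
exists (C `^ q^-1); first by rewrite powR_gt0.
move=> F N mF F0 N0 /= FN; pose G y := N^-1 * F y.
have G0 y : 0 <= G y by rewrite mulr_ge0// invr_ge0 ltW.
have mG : measurable_fun setT G by exact: measurable_funM.
have -> : F = (fun y => N * G y) by apply/funext => y; rewrite /G mulVKf// gt_eqF.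
under eq_integral => x _.
  rewrite series_opZ// ?(ltW N0)// poweRM ?lee_fin ?(ltW N0)//; last exact: series_op_ge0.
  rewrite poweR_EFin; over.
rewrite ge0_integralZl_EFin//; last 3 first.
- by move=> x _; exact: poweR_ge0.
- by apply: (measurableT_comp (measurable_poweR q)); exact: measurable_series_op.
- exact: powR_ge0.
rewrite powRM ?powR_ge0 ?(ltW N0)// -powRrM mulVf ?gt_eqF// powRr1 ?(ltW C0)// mulrC EFinM.
apply: lee_wpmul2l; first by rewrite lee_fin powR_ge0.
by apply: HC => //; exact: norm_le_normalise.
Qed.

Lemma op_bounded_sup (p : R) w A E (M c : R) : (forall j, measurable (E j)) -> (forall j, 0 <= w j) ->
  (forall j, 0 < A j) -> (forall j x, mu (xsection (E j) x) <= (A j)%:E)%E ->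
  1 <= p -> 0 < M -> 0 < c < 1 -> (forall j, w j * A j `^ (1 - p^-1) <= M * c ^+ j) ->
  op_bounded p%:E +oo%E (series_op mu w E).
Proof.
move=> mE w0 A0 EA p1 M0 /andP[c0 c1] wA; have p0 : 0 < p by exact: lt_le_trans p1.
exists (M / (1 - c)); first by rewrite divr_gt0// subr_gt0.
move=> F N mF F0 N0 /= FN; pose G y := N^-1 * F y.
have G0 y : 0 <= G y by rewrite mulr_ge0// invr_ge0 ltW.
have mG : measurable_fun setT G by exact: measurable_funM.
have -> : F = (fun y => N * G y) by apply/funext => y; rewrite /G mulVKf// gt_eqF.
apply/nearW => x; rewrite series_opZ// ?(ltW N0)// mulrC EFinM.
apply: lee_wpmul2l; first by rewrite lee_fin ltW.
have c01 : 0 < c < 1 by rewrite c0.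
apply: (@series_op_sup _ _ _ mu w A E p M c G x mE w0 A0 (fun j => EA j x) p1 (ltW M0) c01 wA mG G0).
exact: norm_le_normalise.
Qed.

(** The function may exceed its essential bound on a null set, where it is truncated. *)
Lemma op_bounded_infty w A E (M c : R) : (forall j, measurable (E j)) -> (forall j, 0 <= w j) ->
  (forall j, 0 < A j) -> (forall j x, mu (xsection (E j) x) <= (A j)%:E)%E ->
  0 < M -> 0 < c < 1 -> (forall j, w j * A j <= M * c ^+ j) ->
  op_bounded +oo%E +oo%E (series_op mu w E).
Proof.
move=> mE w0 A0 EA M0 /andP[c0 c1] wA.
exists (M / (1 - c)); first by rewrite divr_gt0// subr_gt0.
move=> F N mF F0 N0 /= FN; pose G y := Num.min (F y) N.
have G0 y : 0 <= G y by rewrite le_min F0 ltW.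
have mG : measurable_fun setT G by exact: measurable_minr.
apply/nearW => x.
have FG j : set_op mu (E j) F x = set_op mu (E j) G x.
  have mI : measurable_fun setT (fun y : mT => \1_(E j) (x, y) : R).
    exact: measurable_indic_pair.
  apply: ge0_ae_eq_integral => //.
  - by apply/measurable_EFinP; exact: measurable_funM.
  - by apply/measurable_EFinP; exact: measurable_funM.
  - by move=> y _; rewrite lee_fin mulr_ge0.
  - by move=> y _; rewrite lee_fin mulr_ge0.
  apply: filterS FN => y; rewrite /= lee_fin => FyN _.
  by rewrite /G (min_idPl FyN).
rewrite /series_op; apply: (@le_trans _ _ (\sum_(0 <= j <oo) (N * M * c ^+ j)%:E)%E).
  apply: lee_nneseries => j _; first by move=> _; rewrite mule_ge0 ?lee_fin// set_op_ge0.
  rewrite FG; apply: (le_trans (lee_wpmul2l _ (@set_op_le _ _ _ mu (E j) G N (A j) x (mE j) mG _ _ _))) => //.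
  - by rewrite lee_fin.
  - by move=> y; rewrite G0/= /G ge_min lexx orbT.
  - exact: ltW.
  - exact: EA.
  rewrite -EFinM lee_fin -mulrA mulrCA; apply: ler_wpM2l => //; exact: ltW.
rewrite eseries_geometric ?(ltW c0) ?mulr_ge0 ?(ltW N0) ?(ltW M0)//.
by rewrite lee_fin [leRHS]mulrC mulrA.
Qed.

Lemma op_boundedD p q T T' : (1 <= q)%E ->
  (forall F, measurable_fun setT F -> (forall y, 0 <= F y) ->
     measurable_fun setT (T F) /\ forall x, (0 <= T F x)%E) ->
  (forall F, measurable_fun setT F -> (forall y, 0 <= F y) ->
     measurable_fun setT (T' F) /\ forall x, (0 <= T' F x)%E) ->
  op_bounded p q T -> op_bounded p q T' -> op_bounded p q (fun F x => T F x + T' F x)%E.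
Proof.
move=> q1 hT hT' [C C0 HC] [C' C0' HC']; exists (4 * (C + C')).
  by rewrite mulr_gt0// addr_gt0.
move=> F N mF F0 N0 FN; have [mT0 T0] := hT _ mF F0; have [mT0' T0'] := hT' _ mF F0.
have -> : 4 * (C + C') * N = 4 * (C * N + C' * N) by ring.
by apply: norm_leD => //; rewrite ?mulr_gt0//; [exact: HC|exact: HC'].
Qed.

End operator_bounds.

Section reciprocal_exponent.
Context {R : realType}.

Lemma rcp_EFin (r : R) : r != 0 -> rcp r%:E = r^-1.
Proof. by move=> r0; rewrite /rcp inver (negbTE r0). Qed.

Lemma rcp_pinfty : rcp (+oo%E : \bar R) = 0.
Proof. by rewrite /rcp invey. Qed.

Lemma rcp_ge0 (p : \bar R) : (1 <= p)%E -> 0 <= rcp p.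
Proof.
case: p => [r||//]; last by rewrite rcp_pinfty.
rewrite lee_fin => r1; have r0 : 0 < r by exact: lt_le_trans r1.
by rewrite rcp_EFin ?gt_eqF// invr_ge0 ltW.
Qed.

Lemma rcp_le1 (p : \bar R) : (1 <= p)%E -> rcp p <= 1.
Proof.
case: p => [r||//]; last by rewrite rcp_pinfty.
rewrite lee_fin => r1; have r0 : 0 < r by exact: lt_le_trans r1.
by rewrite rcp_EFin ?gt_eqF// invf_le1.
Qed.

Lemma rcp1 : rcp (1%E : \bar R) = 1.
Proof. by rewrite rcp_EFin ?invr1. Qed.

Lemma rcp_conjugate (p : \bar R) : (1 <= p)%E -> rcp (hoelder_conjugate p) = 1 - rcp p.
Proof.
case: p => [r||//]; last by rewrite hoelder_conjugatey rcp_pinfty subr0 rcp1.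
rewrite lee_fin le_eqVlt => /predU1P[<-|r1].
  by rewrite hoelder_conjugate1 rcp_pinfty rcp1 subrr.
have r0 : 0 < r by exact: lt_trans r1.
have r10 : r - 1 != 0 by rewrite gt_eqF// subr_gt0.
have -> : hoelder_conjugate r%:E = (r / (r - 1))%:E.
  by rewrite /hoelder_conjugate/= eqe gt_eqF// -EFinD inver (negbTE r10).
rewrite !rcp_EFin ?gt_eqF ?divr_gt0 ?subr_gt0//.
by field; rewrite gt_eqF.
Qed.

Lemma rcp_lt1 (p : \bar R) : (1 <= p)%E -> p != 1%E -> rcp p < 1.
Proof.
case: p => [r||//]; last by rewrite rcp_pinfty.
rewrite lee_fin eqe => r1 rn1; have r1' : 1 < r by rewrite lt_neqAle eq_sym rn1.
by rewrite rcp_EFin ?invf_lt1//; lra.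
Qed.

Lemma rcp_gt0 (p : \bar R) : (1 <= p)%E -> p != +oo%E -> 0 < rcp p.
Proof.
case: p => [r||//]; last by rewrite eqxx.
by rewrite lee_fin => r1 _; rewrite rcp_EFin ?invr_gt0; lra.
Qed.

Lemma hoelder_conjugate_eq1 (q : \bar R) : (1 <= q)%E -> (hoelder_conjugate q == 1%E) = (q == +oo%E).
Proof.
move=> q1; have [->|qy] := eqVneq q +oo%E; first by rewrite hoelder_conjugatey eqxx.
apply/negbTE/eqP => q'1; have := rcp_conjugate q1; rewrite q'1 rcp1.
by have := rcp_gt0 q1 qy; lra.
Qed.

Lemma rcp_lt (p q : \bar R) : (1 <= q)%E -> (q < p)%E -> rcp p < rcp q.
Proof.
case: q p => [u||//] [v||//]; rewrite ?ltxx// ?lte_fin lee_fin => u1.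
  move=> uv; have u0 : 0 < u by lra.
  have v0 : 0 < v by lra.
  by rewrite !rcp_EFin ?gt_eqF// ltf_pV2.
by move=> _; rewrite rcp_pinfty; apply: rcp_gt0; rewrite ?lee_fin.
Qed.

Lemma rcp_le (p q : \bar R) : (1 <= p)%E -> (p <= q)%E -> rcp q <= rcp p.
Proof. by move=> p1; rewrite le_eqVlt => /predU1P[->//|/(rcp_lt p1)/ltW]. Qed.

End reciprocal_exponent.

Section pieces_bounded.
Context {R : realType}.
Local Notation mT := (measurableTypeR R).
Local Notation mu := (@w_measure R (-1)).
Implicit Types (p q : \bar R) (r s A th e : R).

(** The hypothesis on [r] and [s] is strict subcriticality for Young's inequality on the [j]-th piece. *)
Lemma op_bounded_geometric p q r s A (E : nat -> set (mT * mT)) : (1 <= p)%E -> (p <= q)%E ->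
  (forall j, measurable (E j)) -> 0 < r -> 0 < s -> 0 < A ->
  (forall j x, mu (xsection (E j) x) <= (A * s ^+ j)%:E)%E ->
  (forall j y, mu (ysection (E j) y) <= (A * s ^+ j)%:E)%E ->
  r * s `^ (1 - rcp p + rcp q) < 1 ->
  op_bounded p q (series_op mu (fun j => r ^+ j) E).
Proof.
move=> p1 pq mE r0 s0 A0 EX EY rs.
pose kap := 1 - rcp p + rcp q; rewrite -/kap in rs.
pose c := r * s `^ kap; rewrite -/c in rs.
have c0 : 0 < c by rewrite mulr_gt0// powR_gt0.
have As0 j : 0 < A * s ^+ j by rewrite mulr_gt0// exprn_gt0.
have w0 j : 0 <= r ^+ j by rewrite exprn_ge0// ltW.
have key j : r ^+ j * (A * s ^+ j) `^ kap = A `^ kap * c ^+ j.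
  rewrite powRM ?exprn_ge0 ?(ltW A0) ?(ltW s0)// exprn_powR ?(ltW s0)//.
  by rewrite /c exprMn; ring.
have Ak0 : 0 < A `^ kap by rewrite powR_gt0.
have pqE : kap = 1 - rcp p + rcp q by [].
clearbody c; clearbody kap.
case: p p1 pq pqE => [p||//] p1; last first.
  rewrite leye_eq => /eqP ->; rewrite rcp_pinfty subr0 addr0 => pqE.
  apply: (@op_bounded_infty _ _ (fun j => A * s ^+ j) E (A `^ kap) c) => //.
    by rewrite c0.
  by move=> j; rewrite -key pqE powRr1// ltW.
rewrite lee_fin in p1; have p0 : 0 < p by exact: lt_le_trans p1.
case: q => [q||//]; last first.
  move=> _; rewrite rcp_pinfty addr0 rcp_EFin ?gt_eqF// => pqE.
  apply: (@op_bounded_sup _ p _ (fun j => A * s ^+ j) E (A `^ kap) c) => //.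
    by rewrite c0.
  by move=> j; rewrite -pqE key.
rewrite lee_fin => pq; have q0 : 0 < q by exact: lt_le_trans pq.
rewrite !rcp_EFin ?gt_eqF// => pqE.
apply: op_bounded_series => //; first exact: le_trans pq.
apply: (@series_op_strong _ _ _ mu _ (fun j => A * s ^+ j) E p q (A `^ kap) (c `^ 2^-1)) => //.
- exact: ltW.
- rewrite powR_gt0//=; have h1 : 1 `^ 2^-1 = 1 :> R by rewrite powR1.
  by rewrite -[ltRHS]h1; apply: gt0_ltr_powR; rewrite ?nnegrE ?ltW ?invr_gt0.
- move=> j; rewrite -pqE key -exprMn -powRD ?(gt_eqF c0) ?implybT//.
  by rewrite (_ : 2^-1 + 2^-1 = 1 :> R) ?powRr1 ?(ltW c0)//; field.
Qed.

Definition near_op th := series_op mu (fun j => (2 `^ th) ^+ j) (@near_piece R).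
Definition low_op e := series_op mu (fun j => (2 `^ (- e)) ^+ j) (@low_piece R).
Definition high_op e := series_op mu (fun j => (2 `^ (- e)) ^+ j) (@high_piece R).

Lemma near_op_bounded p q th : (1 <= p)%E -> (p <= q)%E ->
  th < 1 - rcp p + rcp q -> op_bounded p q (near_op th).
Proof.
move=> p1 pq h; apply: (@op_bounded_geometric p q (2 `^ th) 2^-1 16) => //.
- exact: measurable_near_piece.
- by move=> j; exact: (near_piece_slices j).1.
- by move=> j; exact: (near_piece_slices j).2.
- rewrite powR_inv// -powRB; last by rewrite pnatr_eq0 implybT.
  by rewrite -opprB powR2N_lt1// subr_gt0.
Qed.

Lemma near_op_bounded_endpoint (p q : R) th : 1 < p -> p < q ->
  th = 1 - p^-1 + q^-1 -> op_bounded p%:E q%:E (near_op th).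
Proof.
move=> p1 pq h; apply: op_bounded_series => //.
- exact: measurable_near_piece.
- exact: ltW.
- by rewrite ltW// (lt_trans p1).
apply: (@series_op_endpoint _ _ _ mu _ _ p q 16) => //.
- exact: measurable_near_piece.
- by move=> j; exact: (near_piece_slices j).1.
- by move=> j; exact: (near_piece_slices j).2.
- by move=> j; rewrite h.
Qed.

Lemma low_op_bounded p q e : (1 <= p)%E -> (p <= q)%E -> 0 < e -> op_bounded p q (low_op e).
Proof.
move=> p1 pq e0; apply: (@op_bounded_geometric p q _ 1 2) => //.
- exact: measurable_low_piece.
- by move=> j; rewrite expr1n mulr1; exact: (low_piece_slices j).1.
- by move=> j; rewrite expr1n mulr1; exact: (low_piece_slices j).2.
- by rewrite powR1 mulr1 powR2N_lt1.
Qed.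

Lemma high_op_bounded p q e : (1 <= p)%E -> (p <= q)%E -> 0 < e -> op_bounded p q (high_op e).
Proof.
move=> p1 pq e0; apply: (@op_bounded_geometric p q _ 1 2) => //.
- exact: measurable_high_piece.
- by move=> j; rewrite expr1n mulr1; exact: (high_piece_slices j).1.
- by move=> j; rewrite expr1n mulr1; exact: (high_piece_slices j).2.
- by rewrite powR1 mulr1 powR2N_lt1.
Qed.

End pieces_bounded.

(** * Domination of the potential *)
Section domination.
Context {R : realType}.
Local Notation mT := (measurableTypeR R).
Local Notation leb := (@lebesgue_measure R).
Local Notation mu := (@w_measure R (-1)).
Implicit Types (al s A B x y : R) (f : mT -> R) (T : (mT -> R) -> mT -> \bar R).

Lemma ae_neq (a : R) : {ae leb, forall x : mT, x != a}.
Proof.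
exists [set a]; split => //; first exact: lebesgue_measure_set1.
by move=> x /= /negP; rewrite negbK => /eqP.
Qed.

Lemma ae_abs_neq (a : R) : {ae leb, forall x : mT, `|x| != `|a|}.
Proof.
apply: filterS2 (ae_neq a) (ae_neq (- a)) => x xa xna; apply/negP => /eqP e.
have : x ^+ 2 == a ^+ 2.
  by rewrite -(real_normK (num_real x)) -(real_normK (num_real a)) e.
by rewrite eqf_sqr (negbTE xa) (negbTE xna).
Qed.

(** The density of $|f| \, dw_\alpha$ with respect to $|y|^B \, d\mu$. *)
Definition normalised al B f (y : mT) : R := `|y| `^ (2 * al + 2 - B) * `|f y|.

Lemma measurable_normalised al B f : measurable_fun setT f ->
  measurable_fun setT (normalised al B f).
Proof.
move=> mf; apply: measurable_funM; last exact: measurableT_comp.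
exact: (measurableT_comp (measurable_powR _) (@normr_measurable R setT)).
Qed.

Lemma normalised_ge0 al B f (y : mT) : 0 <= normalised al B f y.
Proof. by rewrite mulr_ge0// powR_ge0. Qed.

(** The bound on the kernel is asked for off the null set of [y] where [potentialK_le] says nothing. *)
Lemma potential_le_kernel al s A B (g : mT -> \bar R) f x : -1 < al -> 0 < s -> s < al + 1 ->
  x != 0 -> measurable_fun setT f -> measurable_fun setT g -> (forall y, 0 <= g y)%E ->
  (forall y, (y != 0)%R -> (`|x| != `|y|)%R -> (`|x| `^ A * `|y| `^ B)%:E * `|potentialK al s x y| <= g y)%E ->
  ((`|x| `^ A)%:E * \int[w_measure al]_y `|potentialK al s x y * (f y)%:E| <=
   \int[mu]_y (g y * (normalised al B f y)%:E))%E.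
Proof.
move=> a1 s0 sa x0 mf mg g0 hg.
have mK := measurable_potentialK a1 s0 sa x0.
have mKf : measurable_fun setT (fun y : mT => `|potentialK al s x y * (f y)%:E|)%E.
  by apply: measurableT_comp => //; apply: emeasurable_funM => //; exact/measurable_EFinP.
have mF := measurable_normalised al B mf.
have mgF : measurable_fun setT (fun y : mT => g y * (normalised al B f y)%:E)%E.
  by apply: emeasurable_funM => //; exact/measurable_EFinP.
rewrite integral_w_measure// [leRHS]integral_w_measure//; last first.
  by move=> y; rewrite mule_ge0// lee_fin normalised_ge0.
rewrite -ge0_integralZl_EFin//; last 2 first.
- by move=> y _; rewrite mule_ge0// lee_fin w_density_ge0.
- exact: measurable_mul_density.
apply: ae_ge0_le_integral => //.
- by move=> y _; rewrite !mule_ge0// lee_fin ?powR_ge0 ?w_density_ge0.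
- by apply: measurable_funeM; exact: measurable_mul_density.
- by move=> y _; rewrite !mule_ge0// lee_fin ?normalised_ge0 ?w_density_ge0.
- exact: measurable_mul_density.
apply: filterS2 (ae_neq 0) (ae_abs_neq x) => y y0 yx _.
rewrite eq_sym in yx; have := hg y y0 yx.
move: (potentialK al s x y) => k0; rewrite abseM abse_EFin; move: `|k0|%E => k hk.
have -> : ((`|x| `^ A)%:E * (k * `|f y|%:E * (w_density al y)%:E) =
    (`|x| `^ A * `|y| `^ B)%:E * k * (normalised al B f y)%:E * (w_density (-1) y)%:E)%E.
  have yp : 0 < `|y| by rewrite normr_gt0.
  have -> : w_density al y = `|y| `^ B * `|y| `^ (2 * al + 2 - B) * w_density (-1) y.
    rewrite /w_density -!powRD ?(gt_eqF yp) ?implybT//; congr (_ `^ _); ring.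
  rewrite /normalised.
  rewrite -[(k * _ * _)%E]muleA -EFinM muleCA -EFinM.
  rewrite [(_%:E * k)%E]muleC -[RHS]muleA -EFinM -[RHS]muleA -EFinM; congr (k * _%:E)%E; ring.
rewrite -muleA -[leRHS]muleA; apply: lee_wpmul2r => //.
by rewrite mule_ge0// lee_fin ?mulr_ge0 ?powR_ge0 ?w_density_ge0.
Qed.

(** The absolute values are inside the integral, so that finiteness of the dominating function also
    gives membership in the natural domain. *)
Definition dominates al s A B T : Prop :=
  (forall F : mT -> R, measurable_fun setT F -> (forall y, 0 <= F y) ->
     measurable_fun setT (T F) /\ forall x, (0 <= T F x)%E) /\
  (forall f x, measurable_fun setT f -> (x != 0)%R ->
    (`|x| `^ A)%:E * \int[w_measure al]_y `|potentialK al s x y * (f y)%:E| <=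
    T (normalised al B f) x)%E.

Lemma series_op_kernel (w : nat -> R) (E : nat -> set (mT * mT)) (F : mT -> R) x :
  (forall j, measurable (E j)) -> (forall j, 0 <= w j) -> measurable_fun setT F ->
  (forall y, 0 <= F y) ->
  (\int[mu]_y ((\sum_(0 <= j <oo) (w j * \1_(E j) (x, y))%:E) * (F y)%:E) =
   series_op mu w E F x)%E.
Proof.
move=> mE w0 mF F0.
have h0 j y : 0 <= w j * \1_(E j) (x, y) * F y by rewrite !mulr_ge0.
have mI j : measurable_fun setT (fun y : mT => \1_(E j) (x, y) : R).
  exact: measurable_indic_pair.
under eq_integral => y _.
  rewrite muleC -nneseriesZl; last by move=> j _; rewrite lee_fin mulr_ge0.
  under eq_eseriesr do rewrite -EFinM mulrC.
  over.
rewrite integral_nneseries//; last 2 first.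
- move=> j; apply/measurable_EFinP; apply: measurable_funM => //; exact: measurable_funM.
- by move=> j y _; rewrite lee_fin.
apply: eq_eseriesr => j _; rewrite /set_op -ge0_integralZl_EFin//.
- by apply: eq_integral => y _; rewrite -EFinM mulrA.
- by move=> y _; rewrite lee_fin mulr_ge0.
- by apply/measurable_EFinP; exact: measurable_funM.
Qed.

(** A pair may lie in several pieces; one of them suffices. *)
Lemma kernel_series_ge (w : nat -> R) (E : nat -> set (mT * mT)) x y j :
  (forall j, 0 <= w j) -> E j (x, y) -> ((w j)%:E <= \sum_(0 <= j <oo) (w j * \1_(E j) (x, y))%:E)%E.
Proof.
move=> w0 Exy; have h0 i : (0 <= (w i * \1_(E i) (x, y))%:E)%E by rewrite lee_fin mulr_ge0.
apply: (@le_trans _ _ (\sum_(0 <= i < j.+1) (w i * \1_(E i) (x, y))%:E)%E); last first.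
  exact: nneseries_lim_ge.
by rewrite big_nat_recr//= indicE mem_set// mulr1 leeDr// sume_ge0.
Qed.

Lemma measurable_kernel_series (w : nat -> R) (E : nat -> set (mT * mT)) x :
  (forall j, measurable (E j)) -> (forall j, 0 <= w j) ->
  measurable_fun setT (fun y : mT => \sum_(0 <= j <oo) (w j * \1_(E j) (x, y))%:E)%E.
Proof.
move=> mE w0; apply: ge0_emeasurable_sum => [j y _ _|j _]; first by rewrite lee_fin mulr_ge0.
by apply/measurable_EFinP; apply: measurable_funM => //; exact: measurable_indic_pair.
Qed.

Lemma kernel_series_ge0 (w : nat -> R) (E : nat -> set (mT * mT)) x y :
  (forall j, 0 <= w j) -> (0 <= \sum_(0 <= j <oo) (w j * \1_(E j) (x, y))%:E)%E.
Proof. by move=> w0; apply: nneseries_ge0 => j _ _; rewrite lee_fin mulr_ge0. Qed.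

End domination.

Section dominating_operators.
Context {R : realType}.
Local Notation mT := (measurableTypeR R).
Local Notation mu := (@w_measure R (-1)).
Implicit Types (al s A B th : R) (f F : mT -> R).

Lemma near_op_good th F : measurable_fun setT F -> (forall y, 0 <= F y) ->
  measurable_fun setT (near_op th F) /\ forall x, (0 <= near_op th F x)%E.
Proof.
move=> mF F0; split => [|x].
  by apply: measurable_series_op => // j; exact: measurable_near_piece.
by apply: series_op_ge0 => // j; exact/exprn_ge0/powR_ge0.
Qed.

Lemma low_op_good e F : measurable_fun setT F -> (forall y, 0 <= F y) ->
  measurable_fun setT (low_op e F) /\ forall x, (0 <= low_op e F x)%E.
Proof.
move=> mF F0; split => [|x].
  by apply: measurable_series_op => // j; exact: measurable_low_piece.
by apply: series_op_ge0 => // j; exact/exprn_ge0/powR_ge0.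
Qed.

Lemma high_op_good e F : measurable_fun setT F -> (forall y, 0 <= F y) ->
  measurable_fun setT (high_op e F) /\ forall x, (0 <= high_op e F x)%E.
Proof.
move=> mF F0; split => [|x].
  by apply: measurable_series_op => // j; exact: measurable_high_piece.
by apply: series_op_ge0 => // j; exact/exprn_ge0/powR_ge0.
Qed.

Definition pieces_op C th A B F x : \bar R :=
  (C%:E * (near_op th F x + (low_op B F x + high_op A F x)))%E.

Lemma pieces_op_good C th A B F : 0 < C -> measurable_fun setT F -> (forall y, 0 <= F y) ->
  measurable_fun setT (pieces_op C th A B F) /\ forall x, (0 <= pieces_op C th A B F x)%E.
Proof.
move=> C0 mF F0; have [m1 p1] := near_op_good th mF F0.
have [m2 p2] := low_op_good B mF F0; have [m3 p3] := high_op_good A mF F0.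
split; last first.
  move=> x; apply: mule_ge0; first by rewrite lee_fin ltW.
  exact: (adde_ge0 (p1 x) (adde_ge0 (p2 x) (p3 x))).
by apply: measurable_funeM; apply: emeasurable_funD => //; exact: emeasurable_funD.
Qed.

Lemma dominates_pieces al s A B th : -1 < al -> 0 < s -> s < al + 1 -> 0 <= th -> th < 1 ->
  1 - 2 * s <= th -> (0 < th \/ 1 < 2 * s) -> A + B = 2 * al + 2 - 2 * s -> 0 <= A -> 0 <= B ->
  exists2 C : R, 0 < C & dominates al s A B (pieces_op C th A B).
Proof.
move=> a1 s0 sa th0 th1 sth hth AB A0 B0.
have [C C0 HC] := kernel_decomposition a1 s0 sa th0 th1 sth hth AB A0 B0.
exists C; first exact: C0.
split; first by move=> F mF F0; exact: pieces_op_good.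
move=> f x mf x0; set F := normalised al B f.
have mF : measurable_fun setT F by exact: measurable_normalised.
have F0 y : 0 <= F y by exact: normalised_ge0.
pose g1 y : \bar R := (\sum_(0 <= j <oo) ((2 `^ th) ^+ j * \1_(@near_piece R j) (x, y))%:E)%E.
pose g2 y : \bar R := (\sum_(0 <= j <oo) ((2 `^ (- B)) ^+ j * \1_(@low_piece R j) (x, y))%:E)%E.
pose g3 y : \bar R := (\sum_(0 <= j <oo) ((2 `^ (- A)) ^+ j * \1_(@high_piece R j) (x, y))%:E)%E.
have w0 (e : R) j : 0 <= (2 `^ e) ^+ j by rewrite exprn_ge0 ?powR_ge0.
have p1 y : (0 <= g1 y)%E by exact: kernel_series_ge0.
have p2 y : (0 <= g2 y)%E by exact: kernel_series_ge0.
have p3 y : (0 <= g3 y)%E by exact: kernel_series_ge0.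
have m1 : measurable_fun setT (g1 : mT -> \bar R).
  by apply: measurable_kernel_series => //; exact: measurable_near_piece.
have m2 : measurable_fun setT (g2 : mT -> \bar R).
  by apply: measurable_kernel_series => //; exact: measurable_low_piece.
have m3 : measurable_fun setT (g3 : mT -> \bar R).
  by apply: measurable_kernel_series => //; exact: measurable_high_piece.
have mEF : measurable_fun setT (EFin \o F) by exact/measurable_EFinP.
apply: (le_trans (@potential_le_kernel R al s A B (fun y => C%:E * (g1 y + (g2 y + g3 y)))%E
   f x a1 s0 sa x0 mf _ _ _)).
- by apply: measurable_funeM; apply: emeasurable_funD => //; exact: emeasurable_funD.
- by move=> y; rewrite mule_ge0 ?lee_fin ?(ltW C0)// !adde_ge0.
- move=> y y0 xy; have [j [[Ej Kj]|[Ej Kj]|[Ej Kj]]] := HC x y x0 y0 xy; apply: (le_trans Kj); clear Kj HC;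
    rewrite EFinM; apply: lee_wpmul2l; try by rewrite lee_fin ltW.
  + apply: (@le_trans _ _ (g1 y)); first exact: (kernel_series_ge (E := @near_piece R)).
    by rewrite leeDl// adde_ge0.
  + apply: (@le_trans _ _ (g2 y)); first exact: (kernel_series_ge (E := @low_piece R)).
    by rewrite (@le_trans _ _ (g2 y + g3 y)%E)// ?leeDl// leeDr.
  + apply: (@le_trans _ _ (g3 y)); first exact: (kernel_series_ge (E := @high_piece R)).
    by rewrite (@le_trans _ _ (g2 y + g3 y)%E)// ?leeDr.
rewrite -/F.
under eq_integral => y _.
  rewrite -muleA ge0_muleDl ?adde_ge0// ge0_muleDl//; over.
have F0E y : (0 <= (F y)%:E)%E by rewrite lee_fin.
rewrite ge0_integralZl_EFin ?(ltW C0)//; last 2 first.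
- by move=> y _; rewrite !adde_ge0// mule_ge0.
- apply: emeasurable_funD; first exact: emeasurable_funM.
  by apply: emeasurable_funD; exact: emeasurable_funM.
rewrite ge0_integralD//; last 4 first.
- by move=> y _; rewrite mule_ge0.
- exact: emeasurable_funM.
- by move=> y _; rewrite adde_ge0// mule_ge0.
- by apply: emeasurable_funD; exact: emeasurable_funM.
rewrite [X in (_ * (_ + X) <= _)%E]ge0_integralD//; last 4 first.
- by move=> y _; rewrite mule_ge0.
- exact: emeasurable_funM.
- by move=> y _; rewrite mule_ge0.
- exact: emeasurable_funM.
rewrite /pieces_op /near_op /low_op /high_op -!series_op_kernel//.
- exact: measurable_high_piece.
- exact: measurable_low_piece.
- exact: measurable_near_piece.
Qed.

(** When [A] or [B] vanishes the far kernel does not decay but is still bounded. *)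
Lemma dominates_near_bounded al s A B th : -1 < al -> 0 < s -> s < al + 1 -> 0 <= th -> th < 1 ->
  1 - 2 * s <= th -> (0 < th \/ 1 < 2 * s) -> A + B = 2 * al + 2 - 2 * s -> 0 <= A -> 0 <= B ->
  exists2 C : R, 0 < C & dominates al s A B
    (fun F x => C%:E * (near_op th F x + \int[mu]_y (F y)%:E))%E.
Proof.
move=> a1 s0 sa th0 th1 sth hth AB A0 B0.
have [C C0 HC] := kernel_decomposition a1 s0 sa th0 th1 sth hth AB A0 B0.
exists C; first exact: C0.
split.
  move=> F mF F0; have [m1 p1] := near_op_good th mF F0.
  have i0 : (0 <= \int[mu]_y (F y)%:E)%E by apply: integral_ge0 => y _; rewrite lee_fin.
  split; first by apply: measurable_funeM; apply: emeasurable_funD.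
  by move=> x; rewrite mule_ge0 ?lee_fin ?(ltW C0)// adde_ge0.
move=> f x mf x0; set F := normalised al B f.
have mF : measurable_fun setT F by exact: measurable_normalised.
have F0 y : 0 <= F y by exact: normalised_ge0.
pose g1 y : \bar R := (\sum_(0 <= j <oo) ((2 `^ th) ^+ j * \1_(@near_piece R j) (x, y))%:E)%E.
have w0 (e : R) j : 0 <= (2 `^ e) ^+ j by rewrite exprn_ge0 ?powR_ge0.
have p1 y : (0 <= g1 y)%E by exact: kernel_series_ge0.
have m1 : measurable_fun setT (g1 : mT -> \bar R).
  by apply: measurable_kernel_series => //; exact: measurable_near_piece.
have mEF : measurable_fun setT (EFin \o F) by exact/measurable_EFinP.
have w1 (e : R) j : 0 <= e -> (2 `^ (- e)) ^+ j <= 1.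
  move=> e0; apply: exprn_ile1; first exact: powR_ge0.
  by rewrite -[leRHS](powRr0 2); apply: ler_powR; rewrite ?ler1n// oppr_le0.
apply: (le_trans (@potential_le_kernel R al s A B (fun y => C%:E * (g1 y + 1))%E
   f x a1 s0 sa x0 mf _ _ _)).
- by apply: measurable_funeM; apply: emeasurable_funD.
- by move=> y; rewrite mule_ge0 ?lee_fin ?(ltW C0)// adde_ge0.
- move=> y y0 xy; have [j [[Ej Kj]|[Ej Kj]|[Ej Kj]]] := HC x y x0 y0 xy; apply: (le_trans Kj); clear Kj HC;
    rewrite EFinM; apply: lee_wpmul2l; try by rewrite lee_fin ltW.
  + apply: (@le_trans _ _ (g1 y)); first exact: (kernel_series_ge (E := @near_piece R)).
    by rewrite leeDl.
  + by apply: (@le_trans _ _ 1%E); [rewrite lee_fin w1|rewrite leeDr].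
  + by apply: (@le_trans _ _ 1%E); [rewrite lee_fin w1|rewrite leeDr].
rewrite -/F.
under eq_integral => y _.
  rewrite -muleA ge0_muleDl// mul1e; over.
have F0E y : (0 <= (F y)%:E)%E by rewrite lee_fin.
rewrite ge0_integralZl_EFin ?(ltW C0)//; last 2 first.
- by move=> y _; rewrite adde_ge0// mule_ge0.
- by apply: emeasurable_funD => //; exact: emeasurable_funM.
rewrite ge0_integralD//; last 2 first.
- by move=> y _; rewrite mule_ge0.
- exact: emeasurable_funM.
rewrite /near_op -!series_op_kernel//.
exact: measurable_near_piece.
Qed.

(** With $\theta = 0$ the near part is bounded as well. *)
Lemma dominates_bounded al s A B : -1 < al -> 0 < s -> s < al + 1 ->
  1 < 2 * s -> A + B = 2 * al + 2 - 2 * s -> 0 <= A -> 0 <= B ->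
  exists2 C : R, 0 < C & dominates al s A B (fun F x => C%:E * \int[mu]_y (F y)%:E)%E.
Proof.
move=> a1 s0 sa s2 AB A0 B0.
have sth : 1 - 2 * s <= 0 by lra.
have [C C0 HC] := kernel_decomposition a1 s0 sa (lexx 0) (ltr01) sth (or_intror s2) AB A0 B0.
exists C; first exact: C0.
split.
  move=> F mF F0.
  have i0 : (0 <= \int[mu]_y (F y)%:E)%E by apply: integral_ge0 => y _; rewrite lee_fin.
  split; first by [].
  by move=> x; rewrite mule_ge0 ?lee_fin ?(ltW C0).
move=> f x mf x0; set F := normalised al B f.
have mF : measurable_fun setT F by exact: measurable_normalised.
have F0 y : 0 <= F y by exact: normalised_ge0.
have mEF : measurable_fun setT (EFin \o F) by exact/measurable_EFinP.
have w1 (e : R) j : 0 <= e -> (2 `^ (- e)) ^+ j <= 1.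
  move=> e0; apply: exprn_ile1; first exact: powR_ge0.
  by rewrite -[leRHS](powRr0 2); apply: ler_powR; rewrite ?ler1n// oppr_le0.
apply: (le_trans (@potential_le_kernel R al s A B (fun y => C%:E)
   f x a1 s0 sa x0 mf _ _ _)) => //.
- by move=> y; rewrite lee_fin ltW.
- move=> y y0 xy; have [j [[Ej Kj]|[Ej Kj]|[Ej Kj]]] := HC x y x0 y0 xy; apply: (le_trans Kj); clear Kj HC;
    rewrite lee_fin -[leRHS]mulr1; apply: ler_wpM2l; try exact: ltW.
  + by rewrite powRr0 expr1n.
  + exact: w1.
  + exact: w1.
by rewrite ge0_integralZl_EFin ?(ltW C0)// => y _; rewrite lee_fin.
Qed.

End dominating_operators.

(** * Sufficiency of the conditions *)
Section norm_transfer.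
Context {R : realType}.
Local Notation mT := (measurableTypeR R).
Local Notation leb := (@lebesgue_measure R).
Local Notation mu := (@w_measure R (-1)).
Implicit Types (al a b N : R) (p q : \bar R) (f : mT -> R).

Lemma w_measure_setT_gt0 al : (0 < w_measure al [set: mT])%E.
Proof.
rewrite lt0e measure_ge0 andbT; apply/negP => /eqP /(w_measure_null al measurableT) h.
have : (leb `[0%R, 1%R]%classic <= leb [set: R])%E.
  by apply: (@le_measure _ _ _ lebesgue_measure); rewrite ?inE.
have -> : leb [set: R] = 0%E by exact: h.
by rewrite lebesgue_measure_itv/= lte_fin ltr01 oppr0 adde0 lee_fin ler10.
Qed.

(** $dw_\alpha = |x|^D \, d\mu$. *)
Lemma integral_w_inv al (g h : mT -> \bar R) : (forall x, 0 <= g x)%E -> (forall x, 0 <= h x)%E ->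
  measurable_fun setT g -> measurable_fun setT h ->
  (forall x, x != 0%R -> h x = (`|x| `^ (2 * al + 2))%:E * g x)%E ->
  (\int[w_measure al]_x g x = \int[mu]_x h x)%E.
Proof.
move=> g0 h0 mg mh hg; rewrite !integral_w_measure//.
apply: ge0_ae_eq_integral => //.
- exact: measurable_mul_density.
- exact: measurable_mul_density.
- by move=> x _; rewrite mule_ge0// lee_fin w_density_ge0.
- by move=> x _; rewrite mule_ge0// lee_fin w_density_ge0.
apply: filterS (ae_neq (0 : R)) => x x0 _; rewrite hg// [(_%:E * g x)%E]muleC -muleA -EFinM.
have xp : 0 < `|x| by rewrite normr_gt0.
congr (_ * _%:E)%E; rewrite /w_density -powRD ?(gt_eqF xp) ?implybT//.
by congr (_ `^ _); ring.
Qed.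

(** The factor $|x|^{D/p}$ of the normalisation is the $p$-th root of the density of $dw_\alpha$. *)
Lemma norm_le_input al a p f N : (1 <= p)%E -> measurable_fun setT f -> 0 < N ->
  (weighted_norm al a p (EFin \o f) <= N%:E)%E ->
  norm_le p (EFin \o normalised al (2 * al + 2 - (a + (2 * al + 2) * rcp p)) f) N.
Proof.
move=> p1 mf N0; rewrite /weighted_norm unlock /normalised.
rewrite (_ : 2 * al + 2 - _ = a + (2 * al + 2) * rcp p); last by ring.
case: p p1 => [r||//]; last first.
  move=> _; rewrite w_measure_setT_gt0 rcp_pinfty mulr0 addr0 => /ess_supP h.
  apply/(ae_w_measure (-1)); move/(ae_w_measure al): h; apply: filterS => x /=.
  by rewrite !lee_fin normrM [`|_ `^ _|]ger0_norm ?powR_ge0.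
rewrite lee_fin => r1; have r0 : 0 < r by exact: lt_le_trans r1.
rewrite rcp_EFin ?gt_eqF// => h /=.
rewrite -(@integral_w_inv al (fun x => `|(`|x| `^ a)%:E * (f x)%:E| `^ r)%E).
- move: h; set I := integral _ _ _ => h.
  have I0 : (0 <= I)%E by apply: integral_ge0 => x _; exact: poweR_ge0.
  rewrite -(poweRe1 I0) -(@mulVf _ r) ?gt_eqF// poweRrM -poweR_EFin.
  by apply: poweR_le => //; [exact: ltW|exact: poweR_ge0].
- by move=> x; exact: poweR_ge0.
- by move=> x; rewrite lee_fin powR_ge0.
- apply: (measurableT_comp (measurable_poweR r)); apply: measurableT_comp => //.
  apply/measurable_EFinP; apply: measurable_funM => //.
  exact: (measurableT_comp (measurable_powR _) (@normr_measurable R setT)).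
- apply/measurable_EFinP; apply: (measurableT_comp (measurable_powR r)).
  apply: measurable_funM; last exact: measurableT_comp.
  exact: (measurableT_comp (measurable_powR _) (@normr_measurable R setT)).
move=> x x0; have xp : 0 < `|x| by rewrite normr_gt0.
have -> : (`|(`|x| `^ a)%:E * (f x)%:E| = (`|x| `^ a * `|f x|)%:E)%E.
  by rewrite abseM !abse_EFin ger0_norm ?powR_ge0.
rewrite poweR_EFin -EFinM.
rewrite !powRM ?powR_ge0// mulrA -!powRrM -powRD ?(gt_eqF xp) ?implybT//.
by congr ((_ `^ _ * _)%:E); field; rewrite gt_eqF.
Qed.

(** [g] is the potential, which is compared with a measurable majorant. *)
Lemma norm_le_output al b q (g H : mT -> \bar R) N : (1 <= q)%E -> 0 < N ->
  (forall x, 0 <= H x)%E -> measurable_fun setT H -> norm_le q H N ->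
  {ae leb, forall x, (`|x| `^ ((2 * al + 2) * rcp q - b))%:E * `|g x| <= H x}%E ->
  (weighted_norm al (- b) q g <= N%:E)%E.
Proof.
move=> q1 N0 H0 mH HN hg; rewrite /weighted_norm unlock.
case: q q1 HN hg => [r||//]; last first.
  move=> _ /= HN hg; rewrite w_measure_setT_gt0; apply/ess_supP.
  apply/(ae_w_measure al); move/(ae_w_measure (-1)): HN => HN.
  apply: filterS2 HN hg => x HN; rewrite rcp_pinfty mulr0 sub0r => hg.
  by rewrite /= abseM gee0_abs ?lee_fin ?powR_ge0// (le_trans hg).
rewrite lee_fin => r1; have r0 : 0 < r by exact: lt_le_trans r1.
rewrite rcp_EFin ?gt_eqF// => /= HN hg.
have mp (e : R) : measurable_fun setT (fun x : mT => (`|x| `^ e)%:E).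
  apply/measurable_EFinP.
  exact: (measurableT_comp (measurable_powR _) (@normr_measurable R setT)).
have mHr : measurable_fun setT (fun x : mT => H x `^ r)%E.
  by apply: (measurableT_comp (measurable_poweR r)).
have le1 : (\int[w_measure al]_x `|(`|x| `^ (- b))%:E * g x| `^ r <=
    \int[w_measure al]_x ((`|x| `^ (- (2 * al + 2)))%:E * H x `^ r))%E.
  apply: integral_le_ae.
  - by move=> x; exact: poweR_ge0.
  - by move=> x; rewrite mule_ge0 ?poweR_ge0// lee_fin powR_ge0.
  - exact: emeasurable_funM.
  apply/(ae_w_measure al); apply: filterS2 (ae_neq (0 : R)) hg => x x0 hg.
  have xp : 0 < `|x| by rewrite normr_gt0.
  rewrite abseM gee0_abs ?lee_fin ?powR_ge0//.
  have -> : ((`|x| `^ (- b))%:E * `|g x| = (`|x| `^ (- ((2 * al + 2) / r)))%:E *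
      ((`|x| `^ ((2 * al + 2) / r - b))%:E * `|g x|))%E.
    rewrite muleA -EFinM -powRD ?(gt_eqF xp) ?implybT//.
    by congr ((_ `^ _)%:E * _)%E; ring.
  rewrite poweRM ?mule_ge0 ?lee_fin ?powR_ge0// poweR_EFin -powRrM mulNr divfK ?gt_eqF//.
  apply: lee_wpmul2l; first by rewrite lee_fin powR_ge0.
  by apply: poweR_le; [exact: ltW|exact: hg|rewrite mule_ge0// lee_fin powR_ge0].
rewrite -[leRHS]poweRe1 ?lee_fin ?(ltW N0)// -(@mulfV _ r) ?gt_eqF// poweRrM.
apply: poweR_le; first by rewrite invr_ge0 ltW.
- rewrite poweR_EFin; apply: (le_trans le1).
  rewrite (@integral_w_inv al _ (fun x => H x `^ r)%E)//.
  + by move=> x; rewrite mule_ge0 ?poweR_ge0// lee_fin powR_ge0.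
  + by move=> x; exact: poweR_ge0.
  + exact: emeasurable_funM.
  move=> x x0; have xp : 0 < `|x| by rewrite normr_gt0.
  by rewrite muleA -EFinM -powRD ?(gt_eqF xp) ?implybT// subrr powRr0 mul1e.
- by apply: integral_ge0 => x _; exact: poweR_ge0.
Qed.

End norm_transfer.

Local Opaque near_op low_op high_op potentialK.

Section sufficiency.
Context {R : realType}.
Local Notation mT := (measurableTypeR R).
Local Notation leb := (@lebesgue_measure R).
Local Notation mu := (@w_measure R (-1)).
Implicit Types (al s a b A B : R) (p q : \bar R) (f : mT -> R) (T : (mT -> R) -> mT -> \bar R).

Lemma integrable_of_dominated al s A B T f (x : R) : -1 < al -> 0 < s -> s < al + 1 ->
  dominates al s A B T -> measurable_fun setT f -> x != 0 ->
  (T (normalised al B f) x < +oo)%E ->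
  (w_measure al).-integrable setT (fun y : mT => (potentialK al s x y * (f y)%:E)%E).
Proof.
move=> a1 s0 sa [_ hT] mf x0 Tx; have xp : 0 < `|x| by rewrite normr_gt0.
apply/integrableP; split.
  apply: emeasurable_funM; last exact/measurable_EFinP.
  exact: measurable_potentialK.
have := le_lt_trans (hT f x mf x0) Tx.
set I := integral _ _ _; case: (I) => [r _| |//]; first exact: ltry.
by rewrite gt0_muley ?ltxx// lte_fin powR_gt0.
Qed.

Lemma weighted_Lp_norm al a p f : weighted_Lp al a p f ->
  measurable_fun setT f /\ exists2 n : R, 0 <= n & weighted_norm al a p (EFin \o f) = n%:E.
Proof.
move=> [mf]; rewrite inE => /andP[_]; rewrite inE /= /finite_norm => fin; split => //.
have : (0 <= weighted_norm al a p (EFin \o f))%E by exact: Lnorm_ge0.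
have : (weighted_norm al a p (EFin \o f) < +oo)%E by exact: fin.
by case: (weighted_norm _ _ _ _) => [r| |]//= _; rewrite lee_fin => r0; exists r.
Qed.

Lemma potential_dom_suff al s a A B p T : -1 < al -> 0 < s -> s < al + 1 -> (1 <= p)%E ->
  B = 2 * al + 2 - (a + (2 * al + 2) * rcp p) -> dominates al s A B T ->
  (forall (F : mT -> R) N, measurable_fun setT F -> (forall y, 0 <= F y) -> 0 < N ->
     norm_le p (EFin \o F) N -> {ae mu, forall x, T F x < +oo}%E) ->
  weighted_Lp al a p `<=` potential_dom al s.
Proof.
move=> a1 s0 sa p1 BE hT fin f /weighted_Lp_norm[mf [n n0 hn]].
have N0 : 0 < n + 1 by rewrite ltr_wpDl.
have FN : norm_le p (EFin \o normalised al B f) (n + 1).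
  rewrite BE; apply: norm_le_input => //; rewrite hn lee_fin.
  by rewrite lerDl.
have := fin _ _ (measurable_normalised al B mf) (normalised_ge0 al B f) N0 FN.
move=> /(ae_w_measure (-1)) h; apply: filterS2 (ae_neq (0 : R)) h => x x0 Tx.
exact: integrable_of_dominated hT mf x0 Tx.
Qed.

(** [norm_le_input] asks for a positive bound while the norm may vanish, hence the additional $e$. *)
Lemma two_weight_suff al s a b A B p q T : -1 < al -> 0 < s -> s < al + 1 ->
  (1 <= p)%E -> (1 <= q)%E ->
  A = (2 * al + 2) * rcp q - b -> B = 2 * al + 2 - (a + (2 * al + 2) * rcp p) ->
  dominates al s A B T -> op_bounded p q T -> two_weight_estimate al s a b p q.
Proof.
move=> a1 s0 sa p1 q1 AE BE hT [C C0 HC]; have [gT dT] := hT.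
exists C => // f fp; split.
  apply: (potential_dom_suff a1 s0 sa p1 BE hT) fp => F N mF F0 N0 FN.
  have [mTF TF0] := gT F mF F0.
  by apply: (norm_le_fin q1 _ TF0 mTF (HC F N mF F0 N0 FN)); exact: mulr_gt0.
have [mf [n n0 hn]] := weighted_Lp_norm fp; rewrite hn.
apply/lee_addgt0Pr => e e0; pose N := n + e / C.
have N0 : 0 < N by rewrite ltr_wpDl// divr_gt0.
have -> : (C%:E * n%:E + e%:E = (C * N)%:E)%E.
  by rewrite -EFinM -EFinD /N; congr EFin; field; rewrite gt_eqF.
set F := normalised al B f.
have mF : measurable_fun setT F by exact: measurable_normalised.
have F0 y : 0 <= F y by exact: normalised_ge0.
have FN : norm_le p (EFin \o F) N.
  rewrite /F BE; apply: norm_le_input => //; rewrite hn lee_fin /N.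
  by rewrite lerDl divr_ge0 ?ltW.
have [mTF TF0] := gT F mF F0.
apply: (norm_le_output q1 _ TF0 mTF (HC F N mF F0 N0 FN)); first exact: mulr_gt0.
apply: filterS (ae_neq (0 : R)) => x x0; rewrite -AE.
apply: le_trans (dT f x mf x0); apply: lee_wpmul2l; first by rewrite lee_fin powR_ge0.
apply: le_abse_integral => //; apply: emeasurable_funM; last exact/measurable_EFinP.
exact: measurable_potentialK.
Qed.

Lemma pieces_op_bounded al s A B th p q : -1 < al -> 0 < s -> s < al + 1 -> 0 <= th -> th < 1 ->
  1 - 2 * s <= th -> (0 < th \/ 1 < 2 * s) -> A + B = 2 * al + 2 - 2 * s -> 0 < A -> 0 < B ->
  (1 <= p)%E -> (p <= q)%E -> op_bounded p q (near_op th) ->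
  exists2 T, dominates al s A B T & op_bounded p q T.
Proof.
move=> a1 s0 sa th0 th1 sth hth AB A0 B0 p1 pq bn.
have q1 : (1 <= q)%E by exact: le_trans pq.
have [D D0 HD] : op_bounded p q (fun F x => near_op th F x + (low_op B F x + high_op A F x))%E.
  apply: (op_boundedD q1 _ _ bn).
  - by move=> F mF F0; exact: near_op_good.
  - move=> F mF F0; have [m2 p2] := low_op_good B mF F0; have [m3 p3] := high_op_good A mF F0.
    split; first by apply: emeasurable_funD; [exact: m2|exact: m3].
    by move=> x; exact: adde_ge0.
  clear bn; apply: (op_boundedD q1).
  - by move=> F mF F0; exact: low_op_good.
  - by move=> F mF F0; exact: high_op_good.
  - exact: low_op_bounded.
  - exact: high_op_bounded.
have [C C0 hC] := dominates_pieces a1 s0 sa th0 th1 sth hth AB (ltW A0) (ltW B0).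
exists (pieces_op C th A B); first exact: hC.
clear hC; exists (C * D); first exact: mulr_gt0.
move=> F N mF F0 N0 FN; rewrite -mulrA; apply: norm_leZ => //.
- exact: mulr_gt0.
- move=> x; have [_ p1'] := near_op_good th mF F0.
  exact: (adde_ge0 (p1' x) (adde_ge0 ((low_op_good B mF F0).2 x) ((high_op_good A mF F0).2 x))).
- apply: emeasurable_funD; first exact: (near_op_good th mF F0).1.
  exact: (emeasurable_funD (low_op_good B mF F0).1 (high_op_good A mF F0).1).
- exact: HD.
Qed.

(** The hypothesis $0 < 1 - 1/p + 1/q$ excludes only $p = 1$, $q = \infty$. The exponent [th] has to lie
    between $1 - 2s$ and $1 - 1/p + 1/q$, and be positive. *)
Lemma two_weight_suff_strict al s a b p q : -1 < al -> 0 < s -> s < al + 1 ->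
  (1 <= p)%E -> (p <= q)%E -> rcp q = rcp p + (a + b - 2 * s) / (2 * al + 2) ->
  a < (2 * al + 2) * (1 - rcp p) -> b < (2 * al + 2) * rcp q -> 0 < 1 - rcp p + rcp q ->
  rcp p - 2 * s < rcp q -> two_weight_estimate al s a b p q.
Proof.
move=> a1 s0 sa p1 pq hb hc hd hk he; have q1 : (1 <= q)%E by exact: le_trans pq.
have D0 : 0 < 2 * al + 2 by lra.
pose A := (2 * al + 2) * rcp q - b; pose B := 2 * al + 2 - (a + (2 * al + 2) * rcp p).
pose th := Num.max (1 - 2 * s) ((1 - rcp p + rcp q) / 2).
have rp := rcp_ge0 p1; have rq := rcp_ge0 q1; have rq1 := rcp_le1 q1.
have rpq : 1 - rcp p + rcp q <= 1.
  by have := rcp_le p1 pq; lra.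
have th0 : 0 < th by rewrite lt_max divr_gt0 ?orbT.
have thk : th < 1 - rcp p + rcp q by rewrite gt_max; apply/andP; split; lra.
have [T dT bT] : exists2 T, dominates al s A B T & op_bounded p q T.
  apply: (@pieces_op_bounded al s A B th p q) => //.
  - exact: ltW.
  - exact: lt_le_trans thk rpq.
  - by rewrite le_max lexx.
  - by left.
  - rewrite /A /B hb; field; apply: lt0r_neq0; lra.
  - by rewrite subr_gt0.
  - by rewrite /B subr_gt0 -ltrBrDr; apply: (lt_le_trans hc); rewrite mulrBr mulr1.
  - exact: near_op_bounded.
exact: two_weight_suff dT bT.
Qed.

(** Here [th] has to be the critical exponent $1 - 2s = 1 - 1/p + 1/q$. *)
Lemma two_weight_suff_endpoint al s a b (p q : R) : -1 < al -> 0 < s -> s < al + 1 ->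
  1 < p -> p <= q -> q^-1 = p^-1 + (a + b - 2 * s) / (2 * al + 2) ->
  a < (2 * al + 2) * (1 - p^-1) -> b < (2 * al + 2) * q^-1 ->
  q^-1 = p^-1 - 2 * s -> two_weight_estimate al s a b p%:E q%:E.
Proof.
move=> a1 s0 sa p1 pq hb hc hd he; have p0 : 0 < p by exact: lt_trans p1.
have q0 : 0 < q by exact: lt_le_trans pq.
have p1' : (1 <= p%:E)%E by rewrite lee_fin ltW.
have pq' : (p%:E <= q%:E)%E by rewrite lee_fin.
have q1' : (1 <= q%:E)%E by exact: le_trans pq'.
have D0 : 0 < 2 * al + 2 by lra.
pose A := (2 * al + 2) * rcp q%:E - b; pose B := 2 * al + 2 - (a + (2 * al + 2) * rcp p%:E).
have qi : 0 < q^-1 by rewrite invr_gt0.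
have pi1 : p^-1 < 1 by rewrite invf_lt1.
have [T dT bT] : exists2 T, dominates al s A B T & op_bounded p%:E q%:E T.
  apply: (@pieces_op_bounded al s A B (1 - 2 * s)) => //.
  - lra.
  - lra.
  - left; lra.
  - by rewrite /A /B !rcp_EFin ?gt_eqF// hb; move: (p^-1) => u; field; apply: lt0r_neq0; lra.
  - by rewrite /A rcp_EFin ?gt_eqF// subr_gt0.
  - by rewrite /B rcp_EFin ?gt_eqF// subr_gt0 -ltrBrDr; apply: (lt_le_trans hc); rewrite mulrBr mulr1.
  - apply: near_op_bounded_endpoint => //; last lra.
    rewrite lt_neqAle pq andbT; apply/negP => /eqP pqE; move: he; rewrite pqE; lra.
exact: two_weight_suff dT bT.
Qed.

(** The normalised kernel is bounded, which is all that is needed from $L^1$ to $L^\infty$. *)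
Lemma two_weight_suff_bounded al s a b : -1 < al -> 0 < s -> s < al + 1 ->
  a + b = 2 * s - (2 * al + 2) -> a <= 0 -> b <= 0 -> 1 < 2 * s ->
  two_weight_estimate al s a b 1%E +oo%E.
Proof.
move=> a1 s0 sa hb hc hd he.
pose A := (2 * al + 2) * rcp (+oo%E : \bar R) - b.
pose B := 2 * al + 2 - (a + (2 * al + 2) * rcp (1%E : \bar R)).
have AB : A + B = 2 * al + 2 - 2 * s by rewrite /A /B rcp_pinfty rcp1; lra.
have A0 : 0 <= A by rewrite /A rcp_pinfty; lra.
have B0 : 0 <= B by rewrite /B rcp1; lra.
have [C C0 dT] := dominates_bounded a1 s0 sa he AB A0 B0.
apply: (@two_weight_suff al s a b A B _ _ _ a1 s0 sa _ _ _ _ dT) => //; first exact: leey.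
exists C => // F N mF F0 N0 /= FN; apply/nearW => x; rewrite EFinM.
apply: lee_wpmul2l; first by rewrite lee_fin ltW.
move: FN; rewrite powRr1 ?(ltW N0)// => FN; apply: le_trans FN.
by apply: ge0_le_integralT => y; rewrite ?lee_fin ?powRr1.
Qed.

(** The near part is bounded on $L^1$, because [th] is less than 1; the far part is finite at every
    point although it is not bounded on $L^1$ when [A] or [B] vanishes. *)
Lemma potential_dom_L1 al s a : -1 < al -> 0 < s -> s < al + 1 ->
  2 * s - (2 * al + 2) <= a -> a <= 0 -> weighted_Lp al a 1%E `<=` potential_dom al s.
Proof.
move=> a1 s0 sa ha ha'.
pose A := (2 * al + 2) - 2 * s + a; pose B := 2 * al + 2 - (a + (2 * al + 2) * rcp (1%E : \bar R)).
pose th := Num.max (1 - 2 * s) (2^-1 : R).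
have th0 : 0 < th by rewrite lt_max invr_gt0 ltr0n orbT.
have th1 : th < 1 by rewrite gt_max invf_lt1 ?ltr1n// andbT; lra.
have sth : 1 - 2 * s <= th by rewrite le_max lexx.
have AB : A + B = 2 * al + 2 - 2 * s by rewrite /A /B rcp1; ring.
have A0 : 0 <= A by rewrite /A; lra.
have B0 : 0 <= B by rewrite /B rcp1; lra.
have [C C0 dT] := dominates_near_bounded a1 s0 sa (ltW th0) th1 sth (or_introl th0) AB A0 B0.
have bn : op_bounded (1%E : \bar R) 1%E (near_op th).
  by apply: near_op_bounded => //; rewrite rcp1 subrr add0r.
apply: (potential_dom_suff a1 s0 sa _ _ dT) => // F N mF F0 N0 FN.
have [D D0 HD] := bn; have := HD F N mF F0 N0 FN.
have [mTF TF0] := near_op_good th mF F0.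
move=> /norm_le_fin h; have {}h : {ae mu, forall x, near_op th F x < +oo}%E.
  by apply: h => //; exact: mulr_gt0.
apply: filterS h => x hx; rewrite lte_mul_pinfty ?lee_fin ?(ltW C0)//.
apply: lte_add_pinfty => //; move: FN => /= FN; apply: le_lt_trans (ltry (N `^ 1)).
by apply: le_trans FN; apply: ge0_le_integralT => y; rewrite ?lee_fin ?powRr1.
Qed.

End sufficiency.

(** * Lower bounds for the kernel *)
Section lower_bounds.
Context {R : realType}.
Implicit Types (al s x y e d : R).

Lemma powR_itv_ge (t e : R) : 1 <= t -> t <= 2 -> 2 `^ (- `|e|) <= t `^ e.
Proof.
move=> t1 t2; have t0 : 0 < t by exact: lt_le_trans t1.
have [e0|e0] := leP 0 e.
  apply: (@le_trans _ _ 1).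
    by rewrite -[leRHS](powRr0 2); apply: ler_powR; rewrite ?ler1n// oppr_le0.
  by rewrite -[leLHS](powRr0 t); apply: ler_powR.
rewrite ltr0_norm// opprK; have [u u0 ->] : exists2 u, 0 <= u & e = - u.
  by exists (- e); rewrite ?opprK// oppr_ge0 ltW.
rewrite !powRN lef_pV2 ?posrE ?powR_gt0//.
by apply: ge0_ler_powR; rewrite ?nnegrE ?(ltW t0).
Qed.

(** The term of index 0 of the series. *)
Lemma potentialK_ge_power al s : -1 < al -> 0 < s -> s < al + 1 ->
  exists2 c : R, 0 < c & forall x y S, 0 < x -> 0 < y -> x ^+ 2 + y ^+ 2 <= S ->
    ((c * S `^ (s - al - 1))%:E <= potentialK al s x y)%E.
Proof.
move=> a1 s0 sa; have [c c0 Hc] := potentialK_ge a1 s0 sa.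
exists c => // x y S x0 y0 xyS; have Q0 : 0 < x ^+ 2 + y ^+ 2 by rewrite addr_gt0 ?exprn_gt0.
have h0 : 4 * 0%:R * ((x - y) ^+ 2 / (x ^+ 2 + y ^+ 2)) <= 1 by rewrite mulr0 mul0r.
apply: le_trans (Hc x y 0%N x0 y0 h0).
rewrite big_ord1 powR1 mulr1 lee_fin ler_pM2l//.
have -> : s - al - 1 = - (al + 1 - s) by ring.
rewrite !powRN lef_pV2 ?posrE ?powR_gt0 ?(lt_le_trans Q0 xyS)//.
by apply: ge0_ler_powR; rewrite ?nnegrE ?(ltW Q0) ?(ltW (lt_le_trans Q0 xyS))//; lra.
Qed.

Lemma potentialK_ge0 al s x y : -1 < al -> 0 < s -> s < al + 1 -> 0 < x -> 0 < y ->
  (0 <= potentialK al s x y)%E.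
Proof.
move=> a1 s0 sa x0 y0; have [c c0 Hc] := potentialK_ge_power a1 s0 sa.
by apply: le_trans (Hc x y _ x0 y0 (lexx _)); rewrite lee_fin mulr_ge0 ?powR_ge0// ltW.
Qed.

Lemma sum_powR_ge (m : nat) e : 0 <= e -> e <= 1 ->
  m.+1%:R `^ (1 - e) <= \sum_(k < m.+1) k.+1%:R `^ (- e) :> R.
Proof.
move=> e0 e1; apply: (@le_trans _ _ (\sum_(k < m.+1) m.+1%:R `^ (- e))).
  rewrite sumr_const card_ord -[leRHS]mulr_natl powRD ?pnatr_eq0 ?implybT//.
  by rewrite powRr1.
apply: ler_sum => k _; rewrite !powRN lef_pV2 ?posrE ?powR_gt0//.
by apply: ge0_ler_powR; rewrite ?nnegrE// ler_nat ltn_ord.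
Qed.

(** With $m \approx 1/d^2$ terms of the series. *)
Lemma potentialK_ge_diagonal al s : -1 < al -> 0 < s -> s < al + 1 -> 2 * s < 1 ->
  exists2 c : R, 0 < c & forall x y d, 1 <= x -> x <= 2 -> 1 <= y -> y <= 2 -> 0 < d -> `|x - y| <= d ->
    ((c * d `^ (2 * s - 1))%:E <= potentialK al s x y)%E.
Proof.
move=> a1 s0 sa s2; have [c c0 Hc] := potentialK_ge a1 s0 sa.
exists (c * 8 `^ (s - al - 1) * 2 `^ (s - 2^-1)).
  by rewrite !mulr_gt0 ?powR_gt0.
move=> x y d x1 x2 y1 y2 d0 xy; have x0 : 0 < x by lra. have y0 : 0 < y by lra.
pose S := x ^+ 2 + y ^+ 2; have S2 : 2 <= S by rewrite /S; nra.
have S8 : S <= 8 by rewrite /S; nra.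
have S0 : 0 < S by lra.
have dd : (x - y) ^+ 2 <= d ^+ 2.
  by rewrite -(real_normK (num_real (x - y))) lerXn2r ?nnegrE ?(ltW d0).
have dd0 : 0 < d ^+ 2 by rewrite exprn_gt0.
pose m := Num.truncn (S / (4 * d ^+ 2)).
have m0 : 0 <= S / (4 * d ^+ 2) by rewrite divr_ge0 ?mulr_ge0 ?ltW.
have hm : 4 * m%:R * ((x - y) ^+ 2 / (x ^+ 2 + y ^+ 2)) <= 1.
  rewrite -/S mulrA ler_pdivrMr// mul1r.
  apply: (@le_trans _ _ (4 * m%:R * d ^+ 2)); first by apply: ler_wpM2l; rewrite ?mulr_ge0.
  rewrite -[leLHS]mulrA [m%:R * _]mulrC mulrA -ler_pdivlMl ?mulr_gt0// mulrC.
  by rewrite truncn_le.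
apply: le_trans (Hc x y m x0 y0 hm); rewrite lee_fin -/S -!mulrA ler_pM2l//.
apply: ler_pM; rewrite ?mulr_ge0 ?powR_ge0//.
  have -> : s - al - 1 = - (al + 1 - s) by ring.
  rewrite !powRN lef_pV2 ?posrE ?powR_gt0//.
  by apply: ge0_ler_powR; rewrite ?nnegrE ?(ltW S0)//; lra.
have -> : - s - 2^-1 = - (s + 2^-1) by ring.
apply: (le_trans _ (@sum_powR_ge m (s + 2^-1) _ _)); [|lra|lra].
apply: (@le_trans _ _ ((2^-1 / d ^+ 2) `^ (2^-1 - s))).
  rewrite powRM ?invr_ge0 ?(ltW dd0)// !powR_inv ?(ltW dd0)// -!powRN.
  rewrite -(powR_mulrn 2 (ltW d0)) -powRrM le_eqVlt; apply/orP; left; apply/eqP.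
  by congr (_ `^ _ * _ `^ _); lra.
have -> : 1 - (s + 2^-1) = 2^-1 - s by lra.
apply: ge0_ler_powR; rewrite ?nnegrE ?divr_ge0 ?invr_ge0 ?(ltW dd0)//; first lra.
apply: (@le_trans _ _ (S / (4 * d ^+ 2))); last by rewrite ltW// truncnS_gt.
rewrite ler_pdivlMr ?mulr_gt0// mulrA [2^-1 / _ * _]mulrAC divfK ?gt_eqF//.
by rewrite (le_trans _ S2)//; lra.
Qed.

(** For $2s \le 1$ the coefficients are at least those of the harmonic series. *)
Lemma potentialK_unbounded al s (M : R) : -1 < al -> 0 < s -> s < al + 1 -> 2 * s <= 1 ->
  exists2 d : R, 0 < d <= 1 & forall x y, 1 <= x -> x <= 1 + d -> 1 <= y -> y <= 1 + d ->
    (M%:E <= potentialK al s x y)%E.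
Proof.
move=> a1 s0 sa s2; have [c c0 Hc] := potentialK_ge a1 s0 sa.
have [C C0 HC] := @harmonic_shift_bound R 1 ltr01.
pose c' := c * 8 `^ (s - al - 1); have c'0 : 0 < c' by rewrite mulr_gt0 ?powR_gt0.
pose m := (Num.truncn (expR (M / c' + C))).+1.
have m1 : 1 <= m%:R :> R by rewrite ler1n.
have m0 : 0 < m%:R :> R by rewrite ltr0n.
have mi : m%:R * m%:R^-1 = 1 :> R by rewrite mulfV ?gt_eqF.
have mi0 : 0 < m%:R^-1 :> R by rewrite invr_gt0.
have mi1 : m%:R^-1 <= 1 :> R by rewrite invf_le1.
exists (m%:R^-1 / 2); first by apply/andP; split; lra.
move=> x y x1 x2 y1 y2; have x0 : 0 < x by lra. have y0 : 0 < y by lra.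
pose S := x ^+ 2 + y ^+ 2; have S2 : 2 <= S by rewrite /S; nra.
have S8 : S <= 8 by rewrite /S; nra.
have S0 : 0 < S by lra.
have dd : (x - y) ^+ 2 <= (m%:R^-1 / 2) ^+ 2.
  rewrite -(real_normK (num_real (x - y))) lerXn2r ?nnegrE ?divr_ge0 ?invr_ge0 ?(ltW m0)//.
  by rewrite real_ler_norml ?num_real//; apply/andP; split; lra.
have hm : 4 * m%:R * ((x - y) ^+ 2 / (x ^+ 2 + y ^+ 2)) <= 1.
  rewrite mulrA ler_pdivrMr// mul1r -/S.
  apply: (@le_trans _ _ (4 * m%:R * (m%:R^-1 / 2) ^+ 2)).
    by apply: ler_wpM2l => //; rewrite mulr_ge0// ltW.
  have -> : 4 * m%:R * (m%:R^-1 / 2) ^+ 2 = (m%:R * m%:R^-1) * m%:R^-1 :> R.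
    by move: (m%:R) (m%:R^-1) => u v; field.
  by rewrite mi; lra.
apply: le_trans (Hc x y m x0 y0 hm); rewrite lee_fin -/S.
apply: (@le_trans _ _ (c' * \sum_(k < m.+1) k.+1%:R `^ (- s - 2^-1))); last first.
  apply: ler_wpM2r; first by apply: sumr_ge0 => k _; exact: powR_ge0.
  rewrite ler_pM2l//; have -> : s - al - 1 = - (al + 1 - s) by ring.
  rewrite !powRN lef_pV2 ?posrE ?powR_gt0//.
  by apply: ge0_ler_powR; rewrite ?nnegrE ?(ltW S0)//; lra.
rewrite -ler_pdivrMl// mulrC.
apply: (@le_trans _ _ (\sum_(k < m.+1) (k%:R + 1)^-1)); last first.
  apply: ler_sum => k _; rewrite natr1 -[leLHS]powR_inv1//.
  by apply: ler_powR; rewrite ?ler1n//; lra.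
have := HC m.+1; rewrite ler_norml => /andP[hl _].
have : M / c' + C <= ln m.+2%:R.
  rewrite -ler_expR lnK ?posrE ?ltr0n//.
  apply: (@le_trans _ _ m%:R); first by rewrite /m ltW// truncnS_gt.
  by rewrite ler_nat; exact: leq_trans (leqnSn _) (leqnSn _).
lra.
Qed.

End lower_bounds.

(** * Testing on the half-line *)
Section log_measure.
Context {R : realType}.
Local Notation mT := (measurableTypeR R).
Local Notation leb := (@lebesgue_measure R).
Local Notation mu := (@w_measure R (-1)).
Implicit Types (u v x y : R).

Lemma inv_measure_itv u v : 0 < u -> u <= v -> mu `[u, v]%classic = (ln v - ln u)%:E.
Proof.
move=> u0 uv; rewrite /w_measure.
transitivity (\int[leb]_(x in `[u, v]) (x^-1)%:E)%E; last apply: (@FTC_itv R (@ln R) (fun x : R => x^-1)) => //.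
- apply: eq_integral => x; rewrite inE /= in_itv/= => /andP[ux _].
  have x0 : 0 < x by exact: lt_le_trans ux.
  by rewrite /w_density (_ : _ + 1 = -1) ?powR_inv1// ?(gtr0_norm x0) ?powR_inv1 ?(ltW x0)//; ring.
- move=> x /andP[ux _]; apply: is_derive1_ln; exact: lt_le_trans ux.
- move=> x /andP[ux _]; have x0 : 0 < x by exact: lt_le_trans ux.
  apply: (rder_continuous (rderV (f := fun y : R => y) _ (rder_id x))); exact: lt0r_neq0.
Qed.

Lemma integral_mu_itv (g : R -> R) u v : 0 < u -> (forall x, 0 <= g x) ->
  measurable_fun setT g ->
  (\int[mu]_(x in `[u, v]) (g x)%:E = \int[leb]_(x in `[u, v]) (g x / x)%:E)%E.
Proof.
move=> u0 g0 mg; rewrite integral_mkcond [RHS]integral_mkcond integral_w_measure.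
- apply: eq_integral => x _; rewrite !patchE; case: ifPn; rewrite ?mul0e// inE/= in_itv/=.
  move=> /andP[ux _]; have x0 : 0 < x by exact: lt_le_trans ux.
  by rewrite -EFinM /w_density (_ : _ + 1 = -1) ?(gtr0_norm x0) ?powR_inv1 ?(ltW x0)//; ring.
- by move=> x; rewrite patchE; case: ifP => // _; rewrite lee_fin.
- apply/(measurable_restrictT _ _).1 => //; apply/measurable_EFinP.
  exact: measurable_funS mg.
Qed.

End log_measure.

Section necessity_transfer.
Context {R : realType}.
Local Notation mT := (measurableTypeR R).
Local Notation leb := (@lebesgue_measure R).
Local Notation mu := (@w_measure R (-1)).
Implicit Types (al s a b x y N : R) (p q : \bar R) (F h : mT -> R).

(** The inverse of the normalisation of the input, for nonnegative functions. *)
Definition denormalised al a p F (y : R) : R := `|y| `^ (- (a + (2 * al + 2) * rcp p)) * F y.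

Lemma measurable_denormalised al a p F : measurable_fun setT F ->
  measurable_fun setT (denormalised al a p F).
Proof.
move=> mF; apply: measurable_funM => //.
exact: (measurableT_comp (measurable_powR _) (@normr_measurable R setT)).
Qed.

Lemma denormalised_Lp al a p F N : (1 <= p)%E -> 0 < N -> measurable_fun setT F ->
  (forall y, 0 <= F y) -> norm_le p (EFin \o F) N ->
  weighted_Lp al a p (denormalised al a p F) /\
  (weighted_norm al a p (EFin \o denormalised al a p F) <= N%:E)%E.
Proof.
move=> p1 N0 mF F0 FN; have mf := measurable_denormalised al a p mF.
have le : (weighted_norm al a p (EFin \o denormalised al a p F) <= N%:E)%E.
  rewrite -[a in weighted_norm _ a]opprK.
  apply: (@norm_le_output R al (- a) p _ (EFin \o F) N) => //.
    exact/measurable_EFinP.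
  apply: filterS (ae_neq (0 : R)) => x x0; have xp : 0 < `|x| by rewrite normr_gt0.
  rewrite /= /denormalised lee_fin normrM (ger0_norm (powR_ge0 _ _)) (ger0_norm (F0 x)).
  rewrite mulrA -powRD ?(gt_eqF xp) ?implybT// opprK.
  by rewrite (_ : _ + _ = 0) ?powRr0 ?mul1r//; ring.
split => //; split; first exact: mf.
rewrite inE; apply/andP; split.
  rewrite inE; apply: measurable_funM => //.
  exact: (measurableT_comp (measurable_powR _) (@normr_measurable R setT)).
by rewrite inE /= /finite_norm; exact: le_lt_trans le (ltry _).
Qed.

Definition half_line F := forall y, y <= 0 -> F y = 0.

Lemma potential_denormalised al s a p F x : -1 < al -> 0 < s -> s < al + 1 -> 0 < x ->
  measurable_fun setT F -> (forall y, 0 <= F y) -> half_line F ->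
  (forall y, 0 <= potentialK al s x y * (denormalised al a p F y)%:E)%E /\
  (\int[w_measure al]_y (potentialK al s x y * (denormalised al a p F y)%:E) =
   \int[mu]_y ((`|y| `^ (2 * al + 2 - (a + (2 * al + 2) * rcp p)))%:E *
      potentialK al s x y * (F y)%:E))%E.
Proof.
move=> a1 s0 sa x0 mF F0 hF; have mf := measurable_denormalised al a p mF.
have mK := measurable_potentialK a1 s0 sa (lt0r_neq0 x0).
have K0 y : 0 < y -> (0 <= potentialK al s x y)%E by move=> y0; exact: potentialK_ge0.
have f0 y : 0 <= denormalised al a p F y by rewrite mulr_ge0// powR_ge0.
have p0 y : (0 <= potentialK al s x y * (denormalised al a p F y)%:E)%E.
  have [y0|y0] := leP y 0; first by rewrite /denormalised hF// mulr0 mule0.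
  by rewrite mule_ge0 ?K0// lee_fin.
split; first exact: p0.
apply: integral_w_inv; first exact: p0.
- move=> y; have [y0|y0] := leP y 0; first by rewrite hF// mule0.
  apply: mule_ge0; last by rewrite lee_fin.
  by apply: mule_ge0; [rewrite lee_fin powR_ge0|exact: K0].
- by apply: emeasurable_funM => //; exact/measurable_EFinP.
- apply: emeasurable_funM; last exact/measurable_EFinP.
  apply: emeasurable_funM => //; apply/measurable_EFinP.
  exact: (measurableT_comp (measurable_powR _) (@normr_measurable R setT)).
move=> y y0; have yp : 0 < `|y| by rewrite normr_gt0.
move: (potentialK al s x y) => k; rewrite /denormalised [RHS]muleCA -EFinM mulrA.
rewrite -powRD ?(gt_eqF yp) ?implybT// [(_%:E * k)%E]muleC -muleA -EFinM.
by congr (k * (_ `^ _ * _)%:E)%E; ring.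
Qed.

(** The measurable minorant [h] stands for the potential, whose measurability is not known. *)
Lemma norm_ge_output al b q (g : mT -> \bar R) h N : (1 <= q)%E -> 0 < N ->
  measurable_fun setT h -> (forall x, 0 <= h x) ->
  {ae leb, forall x, (h x)%:E <= (`|x| `^ ((2 * al + 2) * rcp q - b))%:E * `|g x|}%E ->
  (weighted_norm al (- b) q g <= N%:E)%E -> norm_le q (EFin \o h) N.
Proof.
move=> q1 N0 mh h0 hg; rewrite /weighted_norm unlock.
case: q q1 hg => [r||//]; last first.
  move=> _ hg; rewrite w_measure_setT_gt0 => /ess_supP.
  move=> /(ae_w_measure al) g1; apply/(ae_w_measure (-1)).
  apply: filterS2 g1 hg => x /=; rewrite abseM gee0_abs ?lee_fin ?powR_ge0//.
  by rewrite rcp_pinfty mulr0 sub0r => g1 g2; exact: le_trans g2 g1.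
rewrite lee_fin => r1; have r0 : 0 < r by exact: lt_le_trans r1.
rewrite rcp_EFin ?gt_eqF// => hg /=.
have mhr : measurable_fun setT (fun x : mT => (h x `^ r)%:E).
  by apply/measurable_EFinP; apply: (measurableT_comp (measurable_powR r)).
have mp (e : R) : measurable_fun setT (fun x : mT => (`|x| `^ e)%:E).
  apply/measurable_EFinP.
  exact: (measurableT_comp (measurable_powR _) (@normr_measurable R setT)).
move=> I1; rewrite -(@integral_w_inv R al (fun x => (`|x| `^ (- (2 * al + 2)))%:E * (h x `^ r)%:E)%E).
- apply: (@le_trans _ _ (\int[w_measure al]_x `|(`|x| `^ (- b))%:E * g x| `^ r)%E); last first.
    move: I1; set I := integral _ _ _ => I1.
    have I0 : (0 <= I)%E by apply: integral_ge0 => x _; exact: poweR_ge0.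
    rewrite -(poweRe1 I0) -(@mulVf _ r) ?gt_eqF// poweRrM -poweR_EFin.
    by apply: poweR_le => //; [exact: ltW|exact: poweR_ge0].
  apply: integral_ge_ae.
  - by move=> x; exact: poweR_ge0.
  - by move=> x; rewrite mule_ge0// lee_fin powR_ge0.
  - exact: emeasurable_funM.
  apply/(ae_w_measure al); apply: filterS2 (ae_neq (0 : R)) hg => x x0 hg.
  have xp : 0 < `|x| by rewrite normr_gt0.
  rewrite abseM gee0_abs ?lee_fin ?powR_ge0//.
  have -> : ((`|x| `^ (- b))%:E * `|g x| = (`|x| `^ (- ((2 * al + 2) / r)))%:E *
      ((`|x| `^ ((2 * al + 2) / r - b))%:E * `|g x|))%E.
    rewrite muleA -EFinM -powRD ?(gt_eqF xp) ?implybT//.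
    by congr ((_ `^ _)%:E * _)%E; ring.
  rewrite poweRM ?mule_ge0 ?lee_fin ?powR_ge0// poweR_EFin -powRrM mulNr divfK ?gt_eqF//.
  apply: lee_wpmul2l; first by rewrite lee_fin powR_ge0.
  by rewrite -poweR_EFin; apply: poweR_le; [exact: ltW|exact: hg|rewrite lee_fin].
- by move=> x; rewrite mule_ge0// lee_fin powR_ge0.
- by move=> x; rewrite lee_fin powR_ge0.
- exact: emeasurable_funM.
- exact: mhr.
move=> x x0; have xp : 0 < `|x| by rewrite normr_gt0.
move: ((h x `^ r)%:E) => k.
by rewrite muleA -EFinM -powRD ?(gt_eqF xp) ?implybT// subrr powRr0 mul1e.
Qed.

(** On the half-line all values of the kernel that enter are nonnegative, and the potential can be
    bounded below by integrating over any subset. *)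
Lemma two_weight_test al s a b p q : -1 < al -> 0 < s -> s < al + 1 -> (1 <= p)%E -> (1 <= q)%E ->
  two_weight_estimate al s a b p q ->
  exists2 C : R, 0 < C & forall F N h, 0 < N -> measurable_fun setT F -> (forall y, 0 <= F y) ->
    half_line F -> norm_le p (EFin \o F) N -> measurable_fun setT h -> (forall x, 0 <= h x) ->
    half_line h ->
    (forall x, (0 < x)%R -> (h x)%:E <= (x `^ ((2 * al + 2) * rcp q - b))%:E *
       \int[mu]_y ((`|y| `^ (2 * al + 2 - (a + (2 * al + 2) * rcp p)))%:E *
         potentialK al s x y * (F y)%:E))%E ->
    norm_le q (EFin \o h) (C * N).
Proof.
move=> a1 s0 sa p1 q1 [C C0 HC]; exists C => // F N h N0 mF F0 hF FN mh h0 hh le.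
have [fL fN] := denormalised_Lp al a p1 N0 mF F0 FN.
have [_ est] := HC _ fL.
apply: (@norm_ge_output al b q (potentialI al s (denormalised al a p F))) => //.
- exact: mulr_gt0.
- apply/nearW => x; have [x0|x0] := leP x 0.
    by rewrite hh// mule_ge0// lee_fin powR_ge0.
  rewrite (gtr0_norm x0); apply: (le_trans (le x x0)).
  apply: lee_wpmul2l; first by rewrite lee_fin powR_ge0.
  have [_ <-] := potential_denormalised a p a1 s0 sa x0 mF F0 hF.
  exact: lee_abs.
apply: (le_trans est); rewrite EFinM; apply: lee_wpmul2l => //.
by rewrite lee_fin ltW.
Qed.

(** The potential converges at almost every point, hence at one point of $[1, 2]$. *)
Lemma dom_test al s a p : -1 < al -> 0 < s -> s < al + 1 -> (1 <= p)%E ->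
  weighted_Lp al a p `<=` potential_dom al s ->
  forall F N, 0 < N -> measurable_fun setT F -> (forall y, 0 <= F y) -> half_line F ->
    norm_le p (EFin \o F) N -> exists2 x : R, 1 <= x <= 2 &
     (\int[mu]_y ((`|y| `^ (2 * al + 2 - (a + (2 * al + 2) * rcp p)))%:E *
         potentialK al s x y * (F y)%:E) < +oo)%E.
Proof.
move=> a1 s0 sa p1 dom F N N0 mF F0 hF FN.
have [/dom [Z [mZ Z0 hZ]] _] := denormalised_Lp al a p1 N0 mF F0 FN.
have [x /andP[x1 x2] nZx] : exists2 x : R, 1 <= x <= 2 & ~ Z x.
  pose I : set mT := [set` `[1, 2] ].
  apply: contrapT => h; have sub : I `<=` Z.
    move=> x; rewrite /I /= in_itv/= => x12; apply: contrapT => Zx; apply: h; by exists x.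
  have : (leb I <= leb Z)%E.
    by apply: (@le_measure _ _ _ lebesgue_measure); rewrite ?inE//; exact: measurable_itv.
  rewrite [leb Z]Z0 /I lebesgue_measure_itv/= lte_fin ltr1n -EFinB lee_fin; lra.
exists x; first by rewrite x1.
have x0 : 0 < x by lra.
have [nn <-] := potential_denormalised a p a1 s0 sa x0 mF F0 hF.
have /integrableP[_] := contrapT (fun notint => nZx (hZ x notint)).
by apply: le_lt_trans; apply: ge0_le_integralT => // y; rewrite gee0_abs.
Qed.

Lemma integral_indic_itv (u v : R) : 0 < u -> u <= v ->
  (\int[mu]_x (\1_(`[u, v]%classic : set mT) x)%:E = (ln v - ln u)%:E)%E.
Proof.
move=> u0 uv; rewrite integral_indic// setIT; exact: inv_measure_itv.
Qed.

Lemma norm_le_indic p (j1 j2 : R) : (1 <= p)%E -> 0 < j1 -> j1 < j2 ->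
  norm_le p (EFin \o (\1_(`[j1, j2]%classic : set mT) : mT -> R)) ((ln j2 - ln j1) `^ rcp p).
Proof.
move=> p1 j0 j12; have L0 : 0 < ln j2 - ln j1.
  by rewrite subr_gt0 ltr_ln// posrE (lt_trans j0).
have mJ : measurable (`[j1, j2]%classic : set mT) by exact: measurable_itv.
case: p p1 => [r||//]; last first.
  move=> _; rewrite rcp_pinfty powRr0; apply/nearW => x /=; rewrite lee_fin indicE.
  by case: (_ \in _).
rewrite lee_fin => r1; have r0 : 0 < r by exact: lt_le_trans r1.
rewrite rcp_EFin ?gt_eqF//= -powRrM mulVf ?gt_eqF// powRr1 ?(ltW L0)//.
rewrite -(integral_indic_itv j0 (ltW j12)).
apply: ge0_le_integralT => x; rewrite /= lee_fin ?powR_ge0//.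
by rewrite indicE; case: (_ \in _); rewrite /= ?powR1 ?powR0 ?gt_eqF.
Qed.

Lemma norm_ge_indic q (e1 e2 m N : R) : (1 <= q)%E -> 0 < e1 -> e1 < e2 -> 0 <= m -> 0 < N ->
  norm_le q (EFin \o (fun x : mT => m * \1_(`[e1, e2]%classic : set mT) x)) N ->
  m * (ln e2 - ln e1) `^ rcp q <= N.
Proof.
move=> q1 e0 e12 m0 N0; have L0 : 0 < ln e2 - ln e1.
  by rewrite subr_gt0 ltr_ln// posrE (lt_trans e0).
have mJ : measurable (`[e1, e2]%classic : set mT) by exact: measurable_itv.
case: q q1 => [r||//]; last first.
  move=> _ [Z [mZ Z0 hZ]]; rewrite rcp_pinfty powRr0 mulr1.
  rewrite leNgt; apply/negP => Nm.
  have sub : `[e1, e2]%classic `<=` Z.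
    move=> x xe; apply: hZ => /=; rewrite lee_fin indicE mem_set// mulr1.
    by apply/negP; rewrite -ltNge.
  have : (mu `[e1, e2]%classic <= mu Z)%E.
    by apply: (@le_measure _ _ _ mu); rewrite ?inE.
  rewrite [mu Z]Z0 inv_measure_itv ?(ltW e12)// lee_fin; lra.
rewrite lee_fin => r1; have r0 : 0 < r by exact: lt_le_trans r1.
rewrite rcp_EFin ?gt_eqF//= => h.
have : ((m `^ r * (ln e2 - ln e1))%:E <= (N `^ r)%:E)%E.
  apply: le_trans h; rewrite EFinM -(integral_indic_itv e0 (ltW e12)).
  rewrite -ge0_integralZl_EFin//; last 2 first.
  - exact/measurable_EFinP.
  - exact: powR_ge0.
  apply: ge0_le_integralT => x; first by rewrite -EFinM lee_fin mulr_ge0 ?powR_ge0.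
  rewrite /= -EFinM lee_fin indicE; case: (_ \in _); rewrite /= ?mulr1// ?mulr0.
  exact: powR_ge0.
rewrite lee_fin => h2; have := ge0_ler_powR (r := r^-1) _ _ _ h2.
rewrite !nnegrE !mulr_ge0 ?powR_ge0 ?(ltW L0) ?invr_ge0 ?(ltW r0)// => /(_ isT isT isT).
rewrite powRM ?powR_ge0 ?(ltW L0)// -!powRrM mulfV ?gt_eqF// !powRr1 ?(ltW N0)//.
Qed.

(** The form used most: an indicator is tested, and the operator is bounded below by a constant on an
    interval, with an inner interval $[l(x), r(x)]$ that may depend on the point. *)
Lemma two_weight_test_itv al s a b p q : -1 < al -> 0 < s -> s < al + 1 -> (1 <= p)%E -> (1 <= q)%E ->
  two_weight_estimate al s a b p q ->
  exists2 C : R, 0 < C & forall (j1 j2 e1 e2 m v : R) (l r : R -> R),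
    0 < j1 -> j1 < j2 -> 0 < e1 -> e1 < e2 -> 0 <= m -> 0 <= v ->
    (forall x, e1 <= x <= e2 -> [/\ j1 <= l x, l x <= r x, r x <= j2 & v <= ln (r x) - ln (l x)]) ->
    (forall x y, (e1 <= x <= e2)%R -> (l x <= y <= r x)%R ->
      m%:E <= (x `^ ((2 * al + 2) * rcp q - b) *
              y `^ (2 * al + 2 - (a + (2 * al + 2) * rcp p)))%:E * potentialK al s x y)%E ->
    m * v * (ln e2 - ln e1) `^ rcp q <= C * (ln j2 - ln j1) `^ rcp p.
Proof.
move=> a1 s0 sa p1 q1 /(two_weight_test a1 s0 sa p1 q1)[C C0 HC].
exists C => // j1 j2 e1 e2 m v l r j0 j12 e0 e12 m0 v0 hlr hm.
have L0 : 0 < ln j2 - ln j1.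
  by rewrite subr_gt0 ltr_ln// posrE (lt_trans j0).
have mJ u w : measurable (`[u, w]%classic : set mT) by exact: measurable_itv.
apply: norm_ge_indic => //; rewrite ?mulr_ge0 ?mulr_gt0 ?powR_gt0//.
apply: (HC (\1_(`[j1, j2]%classic : set mT))) => //.
- by rewrite powR_gt0.
- move=> y y0; rewrite indicE memNset//= in_itv/= => /andP[h _].
  by have := lt_le_trans j0 h; rewrite ltNge y0.
- exact: norm_le_indic.
- exact: measurable_funM.
- by move=> x; rewrite mulr_ge0// mulr_ge0.
- move=> x x0; rewrite indicE memNset ?mulr0//= in_itv/= => /andP[h _].
  by have := lt_le_trans e0 h; rewrite ltNge x0.
move=> x x0; set A := _ - b; set B := _ - (a + _).
have K0 y : 0 < y -> (0 <= potentialK al s x y)%E by move=> y0; exact: potentialK_ge0.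
have nn y : (0 <= (`|y| `^ B)%:E * potentialK al s x y * (\1_(`[j1, j2]%classic : set mT) y)%:E)%E.
  have [y0|y0] := leP y 0.
    rewrite indicE memNset ?mule0//= in_itv/= => /andP[h _].
    by have := lt_le_trans j0 h; rewrite ltNge y0.
  apply: mule_ge0; last by rewrite lee_fin.
  by apply: mule_ge0; [rewrite lee_fin powR_ge0|exact: K0].
have [xe|xe] := boolP (e1 <= x <= e2); last first.
  rewrite indicE memNset ?mulr0; last by rewrite /= in_itv/=; exact/negP.
  by rewrite mule_ge0 ?lee_fin ?powR_ge0// integral_ge0.
have [h1 h2 h3 h4] := hlr x xe; have lx0 : 0 < l x by exact: lt_le_trans h1.
rewrite indicE mem_set ?mulr1 /=; last by rewrite in_itv.
have mK := measurable_potentialK a1 s0 sa (lt0r_neq0 x0).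
rewrite -ge0_integralZl_EFin ?powR_ge0//; last first.
  apply: emeasurable_funM; last exact/measurable_EFinP.
  apply: emeasurable_funM => //; apply/measurable_EFinP.
  exact: (measurableT_comp (measurable_powR _) (@normr_measurable R setT)).
apply: (@le_trans _ _ (\int[mu]_y (m%:E * (\1_(`[l x, r x]%classic : set mT) y)%:E))%E).
  rewrite ge0_integralZl_EFin//; last exact/measurable_EFinP.
  rewrite integral_indic_itv// EFinM.
  by apply: lee_wpmul2l; rewrite lee_fin.
apply: ge0_le_integralT => y; first by rewrite -EFinM lee_fin mulr_ge0.
have [yl|yl] := boolP (l x <= y <= r x); last first.
  rewrite indicE memNset ?mule0; last by rewrite /= in_itv/=; exact/negP.
  by rewrite mule_ge0 ?lee_fin ?powR_ge0.
have y0 : 0 < y by case/andP: yl => + _; exact: lt_le_trans.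
rewrite !indicE !mem_set /= ?in_itv//=; last first.
  by case/andP: yl => u1 u2; rewrite (le_trans h1 u1) (le_trans u2 h3).
by rewrite !mule1 (gtr0_norm y0) muleA -EFinM; exact: hm.
Qed.

End necessity_transfer.

Section real_growth.
Context {R : realType}.
Implicit Types (d C x y : R).

Lemma powR_unbounded d C : 0 < d -> exists2 r : R, 1 <= r & forall t, r <= t -> C < t `^ d.
Proof.
move=> d0; pose K := `|C| + 1; have K1 : 1 <= K by rewrite /K lerDr.
have K0 : 0 < K by lra.
have e1 : K `^ d^-1 >= 1.
  have h1 : 1 `^ d^-1 = 1 :> R by rewrite powR1.
  by rewrite -[leLHS]h1; apply: ge0_ler_powR; rewrite ?nnegrE ?invr_ge0 ?(ltW d0) ?(ltW K0).
exists (K `^ d^-1) => // t ht.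
apply: (@lt_le_trans _ _ K); first by rewrite /K (le_lt_trans (ler_norm C))// ltrDl.
rewrite -[leLHS](powRr1 (ltW K0)) -(@mulVf _ d) ?gt_eqF// powRrM.
by apply: ge0_ler_powR; rewrite ?nnegrE ?(ltW d0) ?powR_ge0//; lra.
Qed.

(** A homogeneous bound at all scales forces degree 0. *)
Lemma powR_bounded0 d C : (forall r, 0 < r -> r `^ d <= C) -> d = 0.
Proof.
move=> h; apply/eqP; rewrite eq_le; apply/andP; split; rewrite leNgt; apply/negP => d0.
  have [r r1 /(_ r (lexx r))] := powR_unbounded C d0.
  by rewrite ltNge h//; lra.
have nd0 : 0 < - d by rewrite oppr_gt0.
have [r r1 /(_ r (lexx r))] := powR_unbounded C nd0; have r0 : 0 < r by lra.
by rewrite powRN -powR_inv ?(ltW r0)// ltNge h// invr_gt0.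
Qed.

Lemma ln_bounds d : 0 < d -> d <= 1 -> d / 2 <= ln (1 + d) <= d.
Proof.
move=> d0 d1; have p : 0 < 1 + d by lra.
apply/andP; split; last by have := ln_le_subr1 p; lra.
have q : 0 < (1 + d)^-1 by rewrite invr_gt0.
have := ln_le_subr1 q; rewrite lnV ?posrE//.
have : (1 + d)^-1 <= 1 - d / 2.
  rewrite -[leLHS]mul1r ler_pdivrMr//; nra.
lra.
Qed.

End real_growth.

Section kernel_tests.
Context {R : realType}.
Implicit Types (al s A B x y r d : R).

(** Each variable is within a factor two of [r]. *)
Lemma two_powers_ge A B x y r : 0 < r -> r <= x -> x <= 2 * r -> r <= y -> y <= 2 * r ->
  2 `^ (- `|A|) * 2 `^ (- `|B|) * r `^ (A + B) <= x `^ A * y `^ B.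
Proof.
move=> r0 x1 x2 y1 y2.
have H e z : r <= z -> z <= 2 * r -> 2 `^ (- `|e|) * r `^ e <= z `^ e.
  move=> z1 z2; have -> : z = (z / r) * r by rewrite divfK// gt_eqF.
  rewrite powRM ?divr_ge0 ?(ltW r0) ?(le_trans (ltW r0) z1)//.
  apply: ler_wpM2r; first exact: powR_ge0.
  by apply: powR_itv_ge; [rewrite ler_pdivlMr// mul1r|rewrite ler_pdivrMr].
rewrite powRD ?(gt_eqF r0) ?implybT//.
have -> : 2 `^ (- `|A|) * 2 `^ (- `|B|) * (r `^ A * r `^ B) =
  (2 `^ (- `|A|) * r `^ A) * (2 `^ (- `|B|) * r `^ B) by ring.
by apply: ler_pM; rewrite ?mulr_ge0 ?powR_ge0//; exact: H.
Qed.

Lemma kernel_ge_dyadic al s A B : -1 < al -> 0 < s -> s < al + 1 ->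
  exists2 c : R, 0 < c & forall r x y, 0 < r -> r <= x -> x <= 2 * r -> r <= y -> y <= 2 * r ->
    ((c * r `^ (A + B + 2 * s - (2 * al + 2)))%:E <=
     (x `^ A * y `^ B)%:E * potentialK al s x y)%E.
Proof.
move=> a1 s0 sa; have [c c0 Hc] := potentialK_ge_power a1 s0 sa.
exists (2 `^ (- `|A|) * 2 `^ (- `|B|) * (c * 8 `^ (s - al - 1))).
  by rewrite !mulr_gt0 ?powR_gt0.
move=> r x y r0 x1 x2 y1 y2; have x0 : 0 < x by lra. have y0 : 0 < y by lra.
have S8 : x ^+ 2 + y ^+ 2 <= 8 * r ^+ 2 by nra.
have h1 := two_powers_ge A B r0 x1 x2 y1 y2.
apply: (@le_trans _ _ ((2 `^ (- `|A|) * 2 `^ (- `|B|) * r `^ (A + B))%:E *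
   (c * (8 * r ^+ 2) `^ (s - al - 1))%:E)%E).
  rewrite -EFinM lee_fin powRM ?sqr_ge0// -(powR_mulrn 2 (ltW r0)) -powRrM.
  have -> : A + B + 2 * s - (2 * al + 2) = (A + B) + 2 * (s - al - 1) by ring.
  rewrite [r `^ (A + B + _)]powRD ?(gt_eqF r0) ?implybT// le_eqVlt; apply/orP; left; apply/eqP; ring.
apply: lee_pmul; rewrite ?lee_fin ?mulr_ge0 ?powR_ge0 ?(ltW c0)//.
exact: Hc.
Qed.

(** For [y] near 1 the normalised kernel behaves like $x^{-B}$ at infinity and like $x^A$ at 0. *)
Lemma kernel_ge_far al s A B : -1 < al -> 0 < s -> s < al + 1 -> A + B = 2 * al + 2 - 2 * s ->
  exists2 c : R, 0 < c & forall x y, 1 <= y -> y <= 2 -> 0 < x ->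
    (2 <= x /\ B <= 0) \/ (x <= 1 /\ A <= 0) ->
    (c%:E <= (x `^ A * y `^ B)%:E * potentialK al s x y)%E.
Proof.
move=> a1 s0 sa AB; have [c c0 Hc] := potentialK_ge_power a1 s0 sa.
have P u : 0 < 8 `^ u :> R by rewrite powR_gt0.
exists (2 `^ (- `|B|) * (c * 8 `^ (s - al - 1))).
  by rewrite !mulr_gt0 ?powR_gt0.
move=> x y y1 y2 x0 H; have y0 : 0 < y by lra.
have yB : 2 `^ (- `|B|) <= y `^ B by exact: powR_itv_ge.
case: H => -[x1 AB0].
  apply: (@le_trans _ _ ((x `^ A * y `^ B)%:E * (c * (8 * x ^+ 2) `^ (s - al - 1))%:E)%E).
    rewrite -EFinM lee_fin powRM ?sqr_ge0// -(powR_mulrn 2 (ltW x0)) -powRrM.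
    have -> : x `^ A * y `^ B * (c * (8 `^ (s - al - 1) * x `^ (2 * (s - al - 1)))) =
      (y `^ B * (c * 8 `^ (s - al - 1))) * (x `^ A * x `^ (2 * (s - al - 1))) by ring.
    rewrite -powRD ?(gt_eqF x0) ?implybT// (_ : A + _ = - B); last by lra.
    rewrite -[leLHS]mulr1; apply: ler_pM; rewrite ?mulr_ge0 ?powR_ge0 ?(ltW c0)//.
      by apply: ler_wpM2r; rewrite ?mulr_ge0 ?powR_ge0 ?(ltW c0).
    rewrite -[leLHS](powRr0 x); apply: ler_powR; lra.
  apply: lee_wpmul2l; first by rewrite lee_fin mulr_ge0 ?powR_ge0.
  by apply: Hc => //; nra.
apply: (@le_trans _ _ ((x `^ A * y `^ B)%:E * (c * 8 `^ (s - al - 1))%:E)%E).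
  rewrite -EFinM lee_fin; apply: ler_wpM2r; first by rewrite mulr_ge0 ?powR_ge0 ?(ltW c0).
  rewrite -[leLHS]mul1r; apply: ler_pM; rewrite ?powR_ge0//.
  have [u u0 ->] : exists2 u, 0 <= u & A = - u by exists (- A); rewrite ?opprK// oppr_ge0.
  have h1 : 1 `^ u = 1 :> R by rewrite powR1.
  rewrite powRN invf_ge1 ?powR_gt0// -[leRHS]h1.
  by apply: ge0_ler_powR; rewrite ?nnegrE ?(ltW x0).
apply: lee_wpmul2l; first by rewrite lee_fin mulr_ge0 ?powR_ge0.
by apply: Hc => //; nra.
Qed.

End kernel_tests.

Section singular_test_integrals.
Context {R : realType}.
Local Notation mT := (measurableTypeR R).
Local Notation leb := (@lebesgue_measure R).
Local Notation mu := (@w_measure R (-1)).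
Implicit Types (d k u v : R).

Lemma ge0_le_integral_set (I : set mT) (g h : mT -> \bar R) (nu : {measure set mT -> \bar R}) :
  (forall x, I x -> 0 <= g x)%E -> (forall x, I x -> g x <= h x)%E ->
  (\int[nu]_(x in I) g x <= \int[nu]_(x in I) h x)%E.
Proof.
move=> g0 gh; rewrite integral_mkcond [leRHS]integral_mkcond.
apply: ge0_le_integralT => x; rewrite !patchE; case: ifPn => //; rewrite inE => Ix.
  exact: g0.
exact: gh.
Qed.

Lemma integral_shift_inv d k : 0 < d -> d < 1 ->
  (\int[leb]_(y in `[(1 + d)%R, 2%R]) (k * (y - 1)^-1)%:E = (k * (- ln d))%:E)%E.
Proof.
move=> d0 d1; have -> : k * (- ln d) = k * ln (2 - 1) - k * ln (1 + d - 1) :> R.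
  by rewrite (_ : 2 - 1 = 1) ?ln1 ?mulr0 ?sub0r ?mulrN ?[1 + d]addrC ?addrK//; ring.
apply: (@FTC_itv R (fun y => k * ln (y - 1)) (fun y => k * (y - 1)^-1)); first lra.
- move=> y /andP[y1 _]; have y0 : 0 < y - 1 by lra.
  refine (rderE (rderM (rder_cst k y) (rder_comp (rderD (rder_id y) (rder_cst (-1) y)) (is_derive1_ln y0))) _).
  by rewrite mulr0 !addr0 mulr1.
- move=> y /andP[y1 _]; have y0 : y - 1 != 0 by apply: lt0r_neq0; lra.
  exact: (rder_continuous (rderM (rder_cst k y) (rderV (f := fun y => y - 1) y0 (rderD (rder_id y) (rder_cst (-1) y))))).
Qed.

Lemma measurable_shift_powR (e : R) : measurable_fun setT (fun y : mT => `|y - 1| `^ e).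
Proof.
apply: (measurableT_comp (measurable_powR e)); apply: measurableT_comp => //.
exact: measurable_funB.
Qed.

(** On $[1, 2]$ the density $1/y$ lies between $1/2$ and 1. *)
Lemma integral_shift_bounds d k : 0 < d -> d < 1 -> 0 <= k ->
  ((k * (- ln d) / 2)%:E <= \int[mu]_(y in `[(1 + d)%R, 2%R]) (k * `|y - 1| `^ (- 1))%:E)%E /\
  (\int[mu]_(y in `[(1 + d)%R, 2%R]) (k * `|y - 1| `^ (- 1))%:E <= (k * (- ln d))%:E)%E.
Proof.
move=> d0 d1 k0; have u0 : 0 < 1 + d by lra.
rewrite integral_mu_itv//; last 2 first.
- by move=> y; rewrite mulr_ge0 ?powR_ge0.
- by apply: measurable_funM => //; exact: measurable_shift_powR.
split.
  rewrite (_ : k * - ln d / 2 = (k / 2) * - ln d); last by ring.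
  rewrite -(integral_shift_inv _ d0 d1).
  apply: ge0_le_integral_set => y /=; rewrite in_itv/= => /andP[y1 y2].
    by rewrite lee_fin !mulr_ge0 ?invr_ge0//; lra.
  rewrite lee_fin ger0_norm; last lra.
  rewrite powR_inv1; last lra.
  rewrite [leRHS]mulrAC; apply: ler_wpM2r; first by rewrite invr_ge0; lra.
  by apply: ler_wpM2l => //; rewrite lef_pV2 ?posrE; lra.
rewrite -(integral_shift_inv _ d0 d1).
apply: ge0_le_integral_set => y /=; rewrite in_itv/= => /andP[y1 y2].
  by rewrite lee_fin !mulr_ge0 ?powR_ge0 ?invr_ge0//; lra.
rewrite lee_fin ger0_norm; last lra.
rewrite powR_inv1; last lra.
apply: ler_piMr; last by rewrite invf_le1; lra.
by rewrite mulr_ge0// invr_ge0; lra.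
Qed.

End singular_test_integrals.

(** * Necessity for the two-weight estimate *)
Section necessity_two_weight.
Context {R : realType}.
Local Notation mT := (measurableTypeR R).
Local Notation leb := (@lebesgue_measure R).
Local Notation mu := (@w_measure R (-1)).
Context (al s a b : R) (p q : \bar R).
Context (a1 : -1 < al) (s0 : 0 < s) (sa : s < al + 1) (p1 : (1 <= p)%E) (q1 : (1 <= q)%E).
Context (est : two_weight_estimate al s a b p q).
Let A := (2 * al + 2) * rcp q - b.
Let B := 2 * al + 2 - (a + (2 * al + 2) * rcp p).
Let ln2_gt0 : 0 < ln 2 :> R. Proof. by rewrite ln_gt0// ltr1n. Qed.

(** The indicator of $[r, 2r]$, for all scales [r]: all norms are independent of [r], and the kernel is
    homogeneous of degree $A + B + 2s - D$. *)
Lemma necessity_scaling : A + B = 2 * al + 2 - 2 * s.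
Proof.
have [C C0 HC] := two_weight_test_itv a1 s0 sa p1 q1 est.
have [c c0 Hc] := kernel_ge_dyadic A B a1 s0 sa.
suff : A + B + 2 * s - (2 * al + 2) = 0 by lra.
pose L := ln 2 `^ rcp q; have L0 : 0 < L by rewrite powR_gt0.
apply: (@powR_bounded0 _ _ (C * ln 2 `^ rcp p / (c * ln 2 * L))) => r r0.
rewrite ler_pdivlMr ?mulr_gt0//.
have r2 : r < 2 * r by lra.
have lnr : ln (2 * r) - ln r = ln 2 by rewrite lnM ?posrE// addrK.
have := HC r (2 * r) r (2 * r) (c * r `^ (A + B + 2 * s - (2 * al + 2))) (ln 2) (fun=> r) (fun=> 2 * r) r0 r2 r0 r2.
rewrite !lnr => H; have {H} := H _ _ _ _; rewrite -/L => H.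
apply: le_trans (H _ _ _ _); first by rewrite le_eqVlt; apply/orP; left; apply/eqP; ring.
- by rewrite mulr_ge0 ?powR_ge0 ?ltW.
- exact: ltW.
- by move=> x _; split => //; rewrite ltW.
- by move=> x y /andP[? ?] /andP[? ?]; exact: Hc.
Qed.

(** An indicator of logarithmic length [r], with the operator bounded below on an interval of the same
    length: $r^{1/q} \le C r^{1/p}$ for large [r]. *)
Lemma necessity_pq : (p <= q)%E.
Proof.
rewrite leNgt; apply/negP => qp.
have rpq : rcp p < rcp q by exact: rcp_lt qp.
have [C C0 HC] := two_weight_test_itv a1 s0 sa p1 q1 est.
have [c c0 Hc] := kernel_ge_dyadic A B a1 s0 sa.
have AB := necessity_scaling.
have d0 : 0 < rcp q - rcp p by lra.
have rp0 := rcp_ge0 p1.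
have [r r1 Hr] := powR_unbounded (C * 2 `^ rcp p / (c * ln 2)) d0.
have := Hr r (lexx r); apply/negP; rewrite -leNgt ler_pdivlMr ?mulr_gt0//.
have r0 : 0 < r by lra.
have e0 : 1 < expR r by rewrite expR_gt1.
have e2 : 1 < 2 * expR r by lra.
have := HC 1 (2 * expR r) 1 (expR r) c (ln 2) id (fun x => 2 * x) ltr01 e2 ltr01 e0 (ltW c0) (ltW ln2_gt0).
rewrite ln1 !subr0 lnM ?posrE ?expR_gt0// expRK => H.
have {H} : c * ln 2 * r `^ rcp q <= C * (ln 2 + r) `^ rcp p.
  apply: H.
  - move=> x /andP[x1 x2]; have x0 : 0 < x by lra.
    by split => //; [lra|lra|rewrite lnM ?posrE// addrK].
  - move=> x y /andP[x1 x2] /andP[h1 h2]; have x0 : 0 < x by lra.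
    have := Hc x x y x0 (lexx x) _ h1 h2; rewrite AB.
    by rewrite (_ : _ - _ = 0) ?powRr0 ?mulr1; [apply; lra|ring].
move=> H; have h2 : (ln 2 + r) `^ rcp p <= 2 `^ rcp p * r `^ rcp p.
  rewrite -powRM ?(ltW r0)//; apply: ge0_ler_powR; rewrite ?nnegrE ?mulr_ge0 ?addr_ge0 ?(ltW r0) ?(ltW ln2_gt0)//.
  have := @ln_le_subr1 R 2 _; rewrite ltr0n => /(_ isT); lra.
have rp : 0 < r `^ rcp p by rewrite powR_gt0.
rewrite -(ler_pM2r rp).
apply: (@le_trans _ _ (c * ln 2 * r `^ rcp q)).
  have -> : r `^ rcp q = r `^ (rcp q - rcp p) * r `^ rcp p.
    by rewrite -powRD ?(gt_eqF r0) ?implybT// subrK.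
  by rewrite le_eqVlt; apply/orP; left; apply/eqP; ring.
by apply: (le_trans H); rewrite -[leRHS]mulrA ler_pM2l.
Qed.

(** The indicator of $[1, 2]$: if [B] (or [A]) is not positive, its image does not decay at infinity (or
    at 0), and is not in $L^q(dx/|x|)$. *)
Lemma necessity_strict : q != +oo%E -> 0 < B /\ 0 < A.
Proof.
move=> /(rcp_gt0 q1) rq0.
have [C C0 HC] := two_weight_test_itv a1 s0 sa p1 q1 est.
have AB := necessity_scaling.
have [c c0 Hc] := kernel_ge_far a1 s0 sa AB.
have [r r1 Hr] := powR_unbounded (C * ln 2 `^ rcp p / (c * ln 2)) rq0.
have r0 : 0 < r by lra.
have e0 : 1 < expR r by rewrite expR_gt1.
have l2 : 1 < 2 :> R by rewrite ltr1n.
have := Hr r (lexx r); rewrite ltNge => /negP contra.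
split; rewrite ltNge; apply/negP => AB0; apply: contra; rewrite ler_pdivlMr ?mulr_gt0//.
  have e2 : 2 < 2 * expR r by lra.
  have := HC 1 2 2 (2 * expR r) c (ln 2) (fun=> 1) (fun=> 2) ltr01 l2 (ltr0Sn R 1) e2 (ltW c0) (ltW ln2_gt0).
  rewrite ln1 !subr0 lnM ?posrE ?expR_gt0// expRK [ln 2 + r]addrC addrK => H.
  rewrite mulrC; apply: H; first by move=> x _; split => //; rewrite ltW.
  move=> x y /andP[x1 x2] /andP[h1 h2]; apply: Hc => //; first lra.
  by left.
have e2 : expR (- r) < 1 by rewrite expR_lt1 oppr_lt0.
have := HC 1 2 (expR (- r)) 1 c (ln 2) (fun=> 1) (fun=> 2) ltr01 l2 (expR_gt0 _) e2 (ltW c0) (ltW ln2_gt0).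
rewrite ln1 !subr0 expRK sub0r opprK => H.
rewrite mulrC; apply: H; first by move=> x _; split => //; rewrite ltW.
move=> x y /andP[x1 x2] /andP[h1 h2]; apply: Hc => //; first exact: lt_le_trans (expR_gt0 _) x1.
by right.
Qed.

Let A2 := 2 `^ (- `|A|) * 2 `^ (- `|B|) : R.
Let A2_gt0 : 0 < A2. Proof. by rewrite mulr_gt0 ?powR_gt0. Qed.
Let A2_le x y : 1 <= x -> x <= 2 -> 1 <= y -> y <= 2 -> A2 <= x `^ A * y `^ B.
Proof.
move=> x1 x2 y1 y2; have := @two_powers_ge R A B x y 1 ltr01; rewrite mulr1 powR1 mulr1.
exact.
Qed.

(** The indicator of $[1, 1 + d]$, whose image is at least $d^{2s}$ there: $d^{2s + 1/q} \le C d^{1/p}$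
    for small [d]. *)
Lemma necessity_local : rcp p - 2 * s <= rcp q.
Proof.
rewrite leNgt; apply/negP => h.
have rp1 := rcp_le1 p1; have rq0 := rcp_ge0 q1; have s2 : 2 * s < 1 by lra.
have [C C0 HC] := two_weight_test_itv a1 s0 sa p1 q1 est.
have [c c0 Hc] := potentialK_ge_diagonal a1 s0 sa s2.
have d0 : 0 < rcp p - 2 * s - rcp q by lra.
pose k := c * A2 * 2 `^ (2 * s - 1); have k0 : 0 < k by rewrite !mulr_gt0 ?powR_gt0.
have [r r1 Hr] := powR_unbounded (C / k) d0.
have [d [dp d1 dr]] : exists d : R, [/\ 0 < d, d <= 1 & r <= (ln (1 + d))^-1].
  exists r^-1; have r0 : 0 < r by lra. have i0 : 0 < r^-1 by rewrite invr_gt0.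
  have i1 : r^-1 <= 1 by rewrite invf_le1.
  split => //; have /andP[h1 h2] := ln_bounds i0 i1.
  rewrite -[leLHS]invrK lef_pV2 ?posrE//; lra.
have /andP[h1 h2] := ln_bounds dp d1; pose L := ln (1 + d); rewrite -/L in h1 h2 dr.
have L0 : 0 < L by lra.
have := Hr _ dr; apply/negP; rewrite -leNgt ler_pdivlMr//.
have e1 : 1 < 1 + d by lra.
have := HC 1 (1 + d) 1 (1 + d) (A2 * (c * d `^ (2 * s - 1))) L (fun=> 1) (fun=> 1 + d) ltr01 e1 ltr01 e1.
rewrite ln1 !subr0 -/L => H.
have {H} : A2 * (c * d `^ (2 * s - 1)) * L * L `^ rcp q <= C * L `^ rcp p.
  apply: H.
  - by rewrite !mulr_ge0 ?powR_ge0 ?ltW.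
  - exact: ltW.
  - by move=> x _; split => //; rewrite ltW.
  move=> x y /andP[x1 x2] /andP[y1 y2]; rewrite EFinM.
  have [x2' y2'] : x <= 2 /\ y <= 2 by split; lra.
  apply: lee_pmul; rewrite ?lee_fin ?mulr_ge0 ?powR_ge0 ?(ltW A2_gt0) ?(ltW c0)//.
    exact: A2_le.
  apply: Hc => //; rewrite real_ler_norml ?num_real//; apply/andP; split; lra.
move=> H; have dL : (2 * L) `^ (2 * s - 1) <= d `^ (2 * s - 1).
  have -> : 2 * s - 1 = - (1 - 2 * s) by ring.
  rewrite !powRN lef_pV2 ?posrE ?powR_gt0 ?mulr_gt0//.
  by apply: ge0_ler_powR; rewrite ?nnegrE ?mulr_ge0 ?(ltW L0) ?(ltW dp)//; lra.
have Lp : 0 < L `^ rcp p by rewrite powR_gt0.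
rewrite -(ler_pM2r Lp); apply: le_trans H.
have -> : A2 * (c * d `^ (2 * s - 1)) * L * L `^ rcp q =
  (A2 * c * (L * L `^ rcp q)) * d `^ (2 * s - 1) by ring.
apply: le_trans (ler_wpM2l _ dL); last by rewrite !mulr_ge0 ?powR_ge0 ?ltW.
rewrite powRM ?(ltW L0)// powR_inv ?(ltW L0)// -powRN.
have -> : L `^ (- (rcp p - 2 * s - rcp q)) = L `^ (2 * s - 1) * L * L `^ rcp q * (L `^ rcp p)^-1.
  rewrite -powRN -[X in _ * X * _ * _](powRr1 (ltW L0)) -!powRD ?(gt_eqF L0) ?implybT//.
  by congr (_ `^ _); ring.
rewrite le_eqVlt; apply/orP; left; apply/eqP; rewrite /k; field.
exact: lt0r_neq0.
Qed.

(** From $L^1$ to $L^\infty$ the kernel itself has to be bounded. *)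
Lemma necessity_bounded : p = 1%E -> q = +oo%E -> 1 < 2 * s.
Proof.
move=> pE qE; rewrite ltNge; apply/negP => s2.
have [C C0 HC] := two_weight_test_itv a1 s0 sa p1 q1 est.
have [d /andP[dp d1] Hd] := potentialK_unbounded ((C + 1) / A2) a1 s0 sa s2.
have e1 : 1 < 1 + d by lra.
have /andP[h1 h2] := ln_bounds dp d1; pose L := ln (1 + d); rewrite -/L in h1 h2.
have L0 : 0 < L by lra.
have := HC 1 (1 + d) 1 (1 + d) (C + 1) L (fun=> 1) (fun=> 1 + d) ltr01 e1 ltr01 e1.
rewrite ln1 !subr0 -/L => H.
have : (C + 1) * L * L `^ rcp q <= C * L `^ rcp p.
  apply: H.
  - lra.
  - exact: ltW.
  - by move=> x _; split => //; rewrite ltW.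
  move=> x y /andP[x1 x2] /andP[y1 y2]; have [x2' y2'] : x <= 2 /\ y <= 2 by split; lra.
  have -> : (C + 1)%:E = (A2%:E * ((C + 1) / A2)%:E)%E.
    by rewrite -EFinM; congr EFin; field; exact: lt0r_neq0.
  apply: lee_pmul; rewrite ?lee_fin ?(ltW A2_gt0) ?divr_ge0 ?(ltW A2_gt0)//; first lra.
    exact: A2_le.
  exact: Hd.
rewrite qE pE rcp_pinfty rcp1 powRr0 mulr1 powRr1 ?(ltW L0)//; nra.
Qed.

(** With $F$ the indicator of $[1, 1 + d]$, of norm $L = \ln(1+d)$, the image is at least a multiple of
    $L (x-1)^{2s-1}$ on $[1+d, 2]$; at equality the $q$-th power of this is $L^q/(x-1)$, whose integral exceeds
    $L^q$ by a factor $-\ln d$. *)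
Lemma necessity_local_strict1 : p = 1%E -> q != +oo%E -> rcp q != rcp p - 2 * s.
Proof.
move=> pE qy; apply/eqP => h; rewrite pE rcp1 in h.
have [u u1 qE] : exists2 u : R, 1 <= u & q = u%:E.
  by case: q q1 qy => [u||//]; rewrite ?eqxx// lee_fin => u1 _; exists u.
have u0 : 0 < u by lra.
rewrite qE rcp_EFin ?gt_eqF// in h; have ui : 0 < u^-1 by rewrite invr_gt0.
have s2 : 2 * s < 1 by lra.
have [C C0 HC] := two_weight_test a1 s0 sa p1 q1 est.
have [c c0 Hc] := potentialK_ge_diagonal a1 s0 sa s2.
pose k := A2 * c; have k0 : 0 < k by rewrite mulr_gt0.
(* [T] is the value of $-\ln d$ *)
pose T := 2 * ((C / k) `^ u + 1); have T0 : 0 < T by rewrite mulr_gt0// ltr_wpDl// powR_ge0.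
pose d := expR (- T); have d0 : 0 < d by exact: expR_gt0.
have d1 : d < 1 by rewrite expR_lt1 oppr_lt0.
have lnd : - ln d = T by rewrite expRK opprK.
have e1 : 1 < 1 + d by lra.
have /andP[h1 h2] := ln_bounds d0 (ltW d1); pose L := ln (1 + d); rewrite -/L in h1 h2.
have L0 : 0 < L by lra.
have mI u' v' : measurable (`[u', v']%classic : set mT) by exact: measurable_itv.
pose F : mT -> R := \1_(`[1%R, (1 + d)%R]%classic : set mT).
pose h' (x : mT) : R := k * L * `|x - 1| `^ (2 * s - 1) * \1_(`[(1 + d)%R, 2%R]%classic : set mT) x.
have FN : norm_le p (EFin \o F) L.
  by have := norm_le_indic p1 ltr01 e1; rewrite pE rcp1 powRr1 ln1 subr0 ?(ltW L0).
have F0 y : 0 <= F y by rewrite /F indicE.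
have hF : half_line F.
  move=> y y0; rewrite /F indicE memNset//= in_itv/= => /andP[y1 _].
  have : 1 <= 0 :> R by lra.
  by rewrite ler10.
have mF : measurable_fun setT F by exact: measurable_indic.
have hh : half_line h'.
  move=> y y0; rewrite /h' indicE memNset ?mulr0//= in_itv/= => /andP[y1 _].
  have : 1 <= 0 :> R by lra.
  by rewrite ler10.
have kL : 0 <= k * L by exact: ltW (mulr_gt0 k0 L0).
have h0 x : 0 <= h' x.
  by apply: mulr_ge0; [apply: mulr_ge0; [exact: kL|exact: powR_ge0]|].
have mh : measurable_fun setT h'.
  apply: measurable_funM; last exact: measurable_indic.
  by apply: measurable_funM => //; exact: measurable_shift_powR.
have := HC F L h' L0 mF F0 hF FN mh h0 hh; rewrite -/A -/B => {}HC.
have : norm_le q (EFin \o h') (C * L).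
  apply: HC => x x0.
  have [/andP[x1 x2]|xI] := boolP (1 + d <= x <= 2); last first.
    rewrite /h' indicE memNset ?mulr0; last by rewrite /= in_itv/=; exact/negP.
    rewrite mule_ge0 ?lee_fin ?powR_ge0// integral_ge0// => y _.
    have [y0|y0] := leP y 0; first by rewrite hF// mule0.
    apply: mule_ge0; last by rewrite lee_fin.
    by apply: mule_ge0; [rewrite lee_fin powR_ge0|exact: potentialK_ge0].
  rewrite /h' indicE mem_set ?mulr1 /=; last by rewrite in_itv/= x1.
  have x10 : 0 < x - 1 by lra.
  rewrite ger0_norm ?(ltW x10)//.
  pose m := A2 * c * (x - 1) `^ (2 * s - 1).
  have m0 : 0 <= m by rewrite !mulr_ge0 ?powR_ge0 ?ltW.
  rewrite -ge0_integralZl_EFin ?powR_ge0//; last 2 first.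
  - move=> y _; have [y0|y0] := leP y 0; first by rewrite hF// mule0.
    apply: mule_ge0; last by rewrite lee_fin.
    by apply: mule_ge0; [rewrite lee_fin powR_ge0|exact: potentialK_ge0].
  - have mK := measurable_potentialK a1 s0 sa (lt0r_neq0 x0).
    apply: emeasurable_funM; last exact/measurable_EFinP.
    apply: emeasurable_funM => //; apply/measurable_EFinP.
    exact: (measurableT_comp (measurable_powR _) (@normr_measurable R setT)).
  apply: (@le_trans _ _ (\int[mu]_y (m%:E * (F y)%:E))%E).
    rewrite ge0_integralZl_EFin//; last 2 first.
    - by move=> z _; rewrite lee_fin.
    - exact/measurable_EFinP.
    rewrite integral_indic_itv// ?(ltW e1)// ln1 subr0 -/L -EFinM lee_fin /m /k.
    by rewrite le_eqVlt; apply/orP; left; apply/eqP; ring.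
  apply: ge0_le_integralT => y; first by rewrite mule_ge0 ?lee_fin.
  have [yl|yl] := boolP (1 <= y <= 1 + d); last first.
    by rewrite /F indicE memNset ?mule0//= in_itv/=; exact/negP.
  rewrite /F indicE mem_set /= ?in_itv//= !mule1.
  have /andP[y1 y2] := yl; have y0 : 0 < y by lra.
  rewrite (gtr0_norm y0) muleA -[((x `^ A)%:E * _)%E]EFinM /m -mulrA [leLHS]EFinM.
  apply: lee_pmul; rewrite ?lee_fin ?mulr_ge0 ?powR_ge0 ?(ltW A2_gt0) ?(ltW c0)//.
    by apply: A2_le; lra.
  apply: Hc; try lra.
  by rewrite real_ler_norml ?num_real//; apply/andP; split; lra.
rewrite qE /= => H.
have [lo _] := integral_shift_bounds d0 d1 (powR_ge0 (k * L) u).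
have : (((k * L) `^ u * (- ln d) / 2)%:E <= ((C * L) `^ u)%:E)%E.
  apply: (le_trans lo); apply: le_trans H; rewrite [leLHS]integral_mkcond.
  apply: ge0_le_integralT => y; rewrite patchE; case: ifPn => //; rewrite ?lee_fin ?mulr_ge0 ?powR_ge0//.
  rewrite inE /= in_itv/= => yI; rewrite /h' indicE mem_set ?mulr1 /=; last by rewrite in_itv.
  rewrite [leRHS]powRM ?kL ?powR_ge0// -powRrM.
  rewrite (_ : (2 * s - 1) * u = -1)//.
  have -> : 2 * s = 1 - u^-1 by lra.
  by field; rewrite gt_eqF.
rewrite lee_fin lnd (powRM _ (ltW k0) (ltW L0)) (powRM _ (ltW C0) (ltW L0)).
have ku : 0 < k `^ u by rewrite powR_gt0.
have Lu : 0 < L `^ u by rewrite powR_gt0.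
have -> : C `^ u = k `^ u * (C / k) `^ u.
  by rewrite -powRM ?divr_ge0 ?(ltW k0) ?(ltW C0)// mulrC divfK// gt_eqF.
rewrite (_ : _ / 2 = k `^ u * L `^ u * ((C / k) `^ u + 1)); last by rewrite /T; set z := (C / k) `^ u; field.
rewrite -[leRHS]mulrA [X in _ <= _ * X]mulrC mulrA ler_pM2l ?mulr_gt0//.
by rewrite gerDl ler10.
Qed.

(** Dual to the preceding lemma: $F(y) = (y-1)^{-1/p}$ on $[1+d, 2]$, of norm at most
    $(-\ln d)^{1/p}$; at equality $F(y)(y-1)^{2s-1} = 1/(y-1)$, so the image is at least a multiple of
    $-\ln d$ near 1. *)
Lemma necessity_local_strict_infty : p != 1%E -> q = +oo%E -> rcp q != rcp p - 2 * s.
Proof.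
move=> pn1 qE; apply/eqP => h; rewrite qE rcp_pinfty in h.
have [u u1 pE] : exists2 u : R, 1 < u & p = u%:E.
  move: h pn1; case: p p1 => [u||//]; last first.
    rewrite rcp_pinfty => _ h2; have : ~~ (0 < s) by rewrite -leNgt; lra.
    by rewrite s0.
  rewrite lee_fin eqe => u1 _ un1; exists u => //.
  by rewrite lt_neqAle eq_sym un1.
have u0 : 0 < u by lra.
rewrite pE rcp_EFin ?gt_eqF// in h; have ui : 0 < u^-1 by rewrite invr_gt0.
have ui1 : u^-1 < 1 by rewrite invf_lt1.
have s2 : 2 * s < 1 by lra.
have [C C0 HC] := two_weight_test a1 s0 sa p1 q1 est.
have [c c0 Hc] := potentialK_ge_diagonal a1 s0 sa s2.
pose k := A2 * c; have k0 : 0 < k by rewrite mulr_gt0.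
have e0 : 0 < 1 - u^-1 by lra.
have [T T1 HT] := powR_unbounded (2 * C / k) e0.
have T0 : 0 < T by lra.
pose d := expR (- T); have d0 : 0 < d by exact: expR_gt0.
have d1 : d < 1 by rewrite expR_lt1 oppr_lt0.
have lnd : - ln d = T by rewrite expRK opprK.
have e1 : 1 < 1 + d by lra.
pose J : set mT := `[(1 + d)%R, 2%R]%classic.
have mJ : measurable J by exact: measurable_itv.
pose F (y : mT) : R := `|y - 1| `^ (- u^-1) * \1_J y.
have F0 y : 0 <= F y by rewrite /F mulr_ge0 ?powR_ge0.
have hF : half_line F.
  move=> y y0; rewrite /F indicE memNset ?mulr0// /J/= in_itv/= => /andP[y1 _].
  have : 1 <= 0 :> R by lra.
  by rewrite ler10.
have mF : measurable_fun setT F.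
  by apply: measurable_funM; [exact: measurable_shift_powR|exact: measurable_indic].
have N0 : 0 < T `^ u^-1 by rewrite powR_gt0.
have FN : norm_le p (EFin \o F) (T `^ u^-1).
  rewrite pE /= -powRrM mulVf ?gt_eqF// powRr1 ?(ltW T0)//.
  have [_ up] := integral_shift_bounds d0 d1 ler01.
  rewrite lnd mul1r in up; apply: le_trans up; rewrite [leRHS]integral_mkcond.
  apply: ge0_le_integralT => y; first by rewrite lee_fin powR_ge0.
  rewrite patchE /F indicE -/J; case: (y \in J); rewrite /= ?mulr1 ?mulr0 ?powR0 ?gt_eqF//.
  by rewrite mul1r lee_fin -powRrM mulNr mulVf ?gt_eqF.
pose h' (x : mT) : R := (k * T / 2) * \1_(`[1%R, (1 + d)%R]%classic : set mT) x.
have kT : 0 <= k * T / 2 by rewrite divr_ge0// ltW// mulr_gt0.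
have hh : half_line h'.
  move=> y y0; rewrite /h' indicE memNset ?mulr0//= in_itv/= => /andP[y1 _].
  have : 1 <= 0 :> R by lra.
  by rewrite ler10.
have h0 x : 0 <= h' x by rewrite /h' mulr_ge0.
have mh : measurable_fun setT h' by exact: measurable_funM.
have := HC F _ h' N0 mF F0 hF FN mh h0 hh; rewrite -/A -/B => {}HC.
have : norm_le q (EFin \o h') (C * T `^ u^-1).
  apply: HC => x x0.
  have nn y : (0 <= (`|y| `^ B)%:E * potentialK al s x y * (F y)%:E)%E.
    have [y0|y0] := leP y 0; first by rewrite hF// mule0.
    apply: mule_ge0; last by rewrite lee_fin.
    by apply: mule_ge0; [rewrite lee_fin powR_ge0|exact: potentialK_ge0].
  have [/andP[x1 x2]|xI] := boolP (1 <= x <= 1 + d); last first.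
    rewrite /h' indicE memNset ?mulr0; last by rewrite /= in_itv/=; exact/negP.
    by rewrite mule_ge0 ?lee_fin ?powR_ge0// integral_ge0.
  rewrite /h' indicE mem_set ?mulr1 /=; last by rewrite in_itv/= x1.
  rewrite -ge0_integralZl_EFin ?powR_ge0//; last first.
    have mK := measurable_potentialK a1 s0 sa (lt0r_neq0 x0).
    apply: emeasurable_funM; last exact/measurable_EFinP.
    apply: emeasurable_funM => //; apply/measurable_EFinP.
    exact: (measurableT_comp (measurable_powR _) (@normr_measurable R setT)).
  have [lo _] := integral_shift_bounds d0 d1 (ltW k0).
  rewrite lnd in lo; apply: (le_trans lo); rewrite [leLHS]integral_mkcond.
  apply: ge0_le_integralT => y.
    by rewrite patchE; case: ifP => // _; rewrite lee_fin mulr_ge0 ?powR_ge0 ?(ltW k0).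
  rewrite patchE -/J; case: ifPn => [|_]; last by rewrite mule_ge0 ?lee_fin ?powR_ge0.
  rewrite inE /J /= in_itv/= => yl.
  rewrite /F indicE /J mem_set /= ?in_itv//= !mulr1.
  have /andP[y1 y2] := yl; have y0 : 0 < y by lra.
  have y10 : 0 < y - 1 by lra.
  rewrite (gtr0_norm y0) (gtr0_norm y10) [leRHS]muleA [X in (X * _)%E]muleA -[((x `^ A)%:E * _)%E]EFinM.
  have -> : k * (y - 1) `^ (-1) = A2 * (c * (y - 1) `^ (2 * s - 1)) * (y - 1) `^ (- u^-1).
    rewrite /k !mulrA -!mulrA; congr (_ * (_ * _)); rewrite -powRD ?(gt_eqF y10) ?implybT//.
    by congr (_ * _ `^ _); lra.
  rewrite [leLHS]EFinM; apply: lee_wpmul2r; first by rewrite lee_fin powR_ge0.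
  rewrite [leLHS]EFinM; apply: lee_pmul; rewrite ?lee_fin ?mulr_ge0 ?powR_ge0 ?(ltW A2_gt0) ?(ltW c0)//.
    by apply: A2_le; lra.
  apply: Hc; try lra.
  by rewrite real_ler_norml ?num_real//; apply/andP; split; lra.
move=> /(norm_ge_indic q1 ltr01 e1 kT (mulr_gt0 C0 N0)); rewrite qE rcp_pinfty powRr0 mulr1 => H.
have := HT T (lexx T); apply/negP; rewrite -leNgt ler_pdivlMr//.
rewrite powRB ?(gt_eqF T0) ?implybT// powRr1 ?(ltW T0)// mulrAC ler_pdivrMr//.
move: H; rewrite -mulrA; lra.
Qed.

End necessity_two_weight.

(** * Necessity for the natural domain *)
Section necessity_domain.
Context {R : realType}.
Local Notation mT := (measurableTypeR R).
Local Notation leb := (@lebesgue_measure R).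
Local Notation mu := (@w_measure R (-1)).
Implicit Types (t e r u v x y al s a : R) (p : \bar R).

(** The sign [t] is $1$ for the half $[1, \infty)$ and $-1$ for the half $(0, 1]$, so that
    $|\ln y| = t \ln y$ on it. *)
Definition log_half t : set mT := `](0 : R), +oo[%classic `&` [set y | 0 <= t * ln y].

Lemma measurable_log_half t : measurable (log_half t).
Proof.
apply: measurableI; first exact: measurable_itv.
have := @measurable_fun_le _ mT R setT (fun=> 0) (fun y => t * ln y) measurableT.
rewrite setTI; apply=> //; apply: measurable_funM => //; exact: measurable_ln.
Qed.

Lemma log_half_gt0 t y : log_half t y -> 0 < y.
Proof. by move=> [/=]; rewrite in_itv/= andbT. Qed.

Lemma log_half_interval t u v : t = 1 \/ t = -1 -> 0 < u -> u <= v ->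
  exists u' v', [/\ 0 < u', u' <= v', log_half t u', log_half t v' &
    forall y, u <= y <= v -> log_half t y -> u' <= y <= v'].
Proof.
have I1 : log_half t 1 by split; rewrite /= ?in_itv/= ?andbT ?ln1 ?mulr0.
move=> [tE|tE] u0 uv; rewrite {}tE in I1 *.
  exists 1, (Num.max v 1); split => //.
  - by rewrite le_max lexx orbT.
  - split; first by rewrite /= in_itv/= andbT lt_max ltr01 orbT.
    by rewrite /= mul1r ln_ge0// le_max lexx orbT.
  move=> y /andP[y1 y2] [_ /=]; rewrite mul1r le_max y2 andbT => h.
  have y0 : 0 < y by exact: lt_le_trans y1.
  by rewrite -(lnK y0) -expR0 ler_expR.
exists (Num.min u 1), 1; split => //.
- by rewrite lt_min u0 ltr01.
- by rewrite ge_min lexx orbT.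
- split; first by rewrite /= in_itv/= andbT lt_min u0 ltr01.
  by rewrite /= mulN1r oppr_ge0 ln_le0// ge_min lexx orbT.
move=> y /andP[y1 y2] [_ /=]; rewrite mulN1r oppr_ge0 ge_min y1/= => h.
have y0 : 0 < y by exact: lt_le_trans y1.
by rewrite -(lnK y0) -expR0 ler_expR.
Qed.

Lemma log_half_between t u v y : t = 1 \/ t = -1 -> log_half t u -> log_half t v ->
  u <= y <= v -> log_half t y.
Proof.
move=> tE hu hv /andP[uy yv]; have u0 := log_half_gt0 hu.
have y0 : 0 < y by exact: lt_le_trans uy.
split; first by rewrite /= in_itv/= y0.
case: hu => _ /=; case: hv => _ /=; case: tE => ->; rewrite ?mul1r ?mulN1r ?oppr_ge0 => hv hu.
  by rewrite (le_trans hu)// ler_ln ?posrE.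
by rewrite (le_trans _ hv)// ler_ln ?posrE// (lt_le_trans y0).
Qed.

(** By exhaustion, so that primitives can be used. *)
Lemma integral_log_half_le t (g : mT -> R) (M : R) : t = 1 \/ t = -1 -> (forall y, 0 <= g y) ->
  measurable_fun setT g ->
  (forall u v, 0 < u -> u <= v -> log_half t u -> log_half t v ->
     (\int[leb]_(y in `[u, v]) (g y / y)%:E <= M%:E)%E) ->
  (\int[mu]_y (g y * \1_(log_half t) y)%:E <= M%:E)%E.
Proof.
move=> tE g0 mg H; have mH := measurable_log_half t.
have mgH : measurable_fun setT (fun y => g y * \1_(log_half t) y) by exact: measurable_funM.
rewrite integral_w_measure//; last 2 first.
- by move=> y; rewrite lee_fin mulr_ge0.
- exact/measurable_EFinP.
pose k (y : mT) : \bar R := ((g y * \1_(log_half t) y)%:E * (w_density (-1) y)%:E)%E.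
have k0 y : (0 <= k y)%E by rewrite mule_ge0 ?lee_fin ?mulr_ge0 ?powR_ge0.
apply: (@le_trans _ _ (\int[leb]_(y in `]0%R, +oo[) k y)%E).
  rewrite [leRHS]integral_mkcond; apply: ge0_le_integralT => // y; rewrite patchE.
  case: ifPn => // /negP yI; rewrite /k indicE memNset ?mulr0 ?mul0e// => -[/= hy _].
  by apply: yI; rewrite inE.
apply: integral_itv0y_le => //.
  apply: measurable_funTS; apply: measurable_mul_density; exact/measurable_EFinP.
move=> u v u0 uv; have [u' [v' [u0' uv' hu' hv' I]]] := log_half_interval tE u0 uv.
apply: le_trans (H u' v' u0' uv' hu' hv').
rewrite [leLHS]integral_mkcond [leRHS]integral_mkcond; apply: ge0_le_integralT => y.
  by rewrite patchE; case: ifP.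
have pos : (0 <= ((fun y => (g y / y)%:E) \_ `[u', v']) y)%E.
  rewrite patchE; case: ifPn => //; rewrite inE /= in_itv/= => /andP[h1 h2].
  by rewrite lee_fin divr_ge0// (le_trans (ltW u0')).
rewrite patchE; case: ifPn => [|_]; last exact: pos.
rewrite inE /= in_itv/= => yuv; rewrite /k indicE.
have [hy|hy] := pselect (log_half t y); last by rewrite memNset// mulr0 mul0e; exact: pos.
have y0 := log_half_gt0 hy; have yI := I y yuv hy.
rewrite mem_set// mulr1 patchE mem_set; last by rewrite /= in_itv.
rewrite -EFinM lee_fin /w_density (_ : _ + 1 = -1); last by ring.
by rewrite (gtr0_norm y0) powR_inv1 ?(ltW y0).
Qed.

Lemma integral_log_half_ge t (k : mT -> \bar R) (g : R -> R) u v : t = 1 \/ t = -1 ->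
  (forall y, 0 <= k y)%E -> (forall y, 0 <= g y) -> measurable_fun setT g ->
  log_half t u -> log_half t v -> (forall y, log_half t y -> (g y)%:E <= k y)%E ->
  (\int[leb]_(y in `[u, v]) (g y / y)%:E <= \int[mu]_y k y)%E.
Proof.
move=> tE k0 g0 mg hu hv gk; rewrite -integral_mu_itv ?(log_half_gt0 hu)//.
rewrite [leLHS]integral_mkcond; apply: ge0_le_integralT => y; rewrite patchE.
  by case: ifP => // _; rewrite lee_fin.
case: ifPn => // /[!inE] /=; rewrite in_itv/= => yuv.
by apply: gk; exact: log_half_between hu hv yuv.
Qed.

Lemma is_derive_log_affine t y : 0 < y -> is_derive y 1 (fun z : R => 1 + t * ln z) (t / y).
Proof.
move=> y0; refine (rderE (rderD (rder_cst 1 y) (rderM (rder_cst t y) (is_derive1_ln y0))) _).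
by rewrite mulr0 addr0 add0r.
Qed.

Lemma continuous_inv_pos y : 0 < y -> {for y, continuous (fun z : R => z^-1)}.
Proof.
move=> y0; exact: (rder_continuous (rderV (f := fun z : R => z) (lt0r_neq0 y0) (rder_id y))).
Qed.

(** In this form the primitives do not distinguish the two halves. *)
Lemma integral_log_powR t r u v : t * t = 1 -> r != 1 -> 0 < u -> u <= v ->
  (forall y, u <= y <= v -> 0 <= t * ln y) ->
  (\int[leb]_(y in `[u, v]) ((1 + t * ln y) `^ (- r) / y)%:E =
   (t / (1 - r) * ((1 + t * ln v) `^ (1 - r) - (1 + t * ln u) `^ (1 - r)))%:E)%E.
Proof.
move=> tt r1 u0 uv H; rewrite mulrBr.
have r1' : 1 - r != 0 by rewrite subr_eq0 eq_sym.
have pos y : u <= y <= v -> 0 < y /\ 0 < 1 + t * ln y.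
  by move=> yI; split; [case/andP: (yI) => + _; exact: lt_le_trans|have := H y yI; lra].
apply: (@FTC_itv R (fun y => t / (1 - r) * (1 + t * ln y) `^ (1 - r))
  (fun y => (1 + t * ln y) `^ (- r) / y)); first exact: uv.
- move=> y /pos[y0 l0].
  refine (rderE (rderM (rder_cst (t / (1 - r)) y) (rder_comp (is_derive_log_affine t y0) (is_derive_powRl (1 - r) l0))) _).
  rewrite mulr0 addr0 (_ : 1 - r - 1 = - r); last by ring.
  rewrite -[RHS]mul1r -[X in _ = X * _]tt; set z := _ `^ _.
  by field; rewrite r1' gt_eqF.
- move=> y /pos[y0 l0]; apply: continuousM; last exact: continuous_inv_pos.
  exact: (rder_continuous (rder_comp (is_derive_log_affine t y0) (is_derive_powRl (- r) l0))).
Qed.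

Lemma integral_log_inv t u v : t * t = 1 -> 0 < u -> u <= v ->
  (forall y, u <= y <= v -> 0 <= t * ln y) ->
  (\int[leb]_(y in `[u, v]) ((1 + t * ln y) `^ (- 1) / y)%:E =
   (t * (ln (1 + t * ln v) - ln (1 + t * ln u)))%:E)%E.
Proof.
move=> tt u0 uv H; rewrite mulrBr.
have pos y : u <= y <= v -> 0 < y /\ 0 < 1 + t * ln y.
  by move=> yI; split; [case/andP: (yI) => + _; exact: lt_le_trans|have := H y yI; lra].
apply: (@FTC_itv R (fun y => t * ln (1 + t * ln y))
  (fun y => (1 + t * ln y) `^ (- 1) / y)); first exact: uv.
- move=> y /pos[y0 l0].
  refine (rderE (rderM (rder_cst t y) (rder_comp (is_derive_log_affine t y0) (is_derive1_ln l0))) _).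
  rewrite mulr0 addr0 powR_inv1 ?(ltW l0)//.
  rewrite -[RHS]mul1r -[X in _ = X * _]tt; set z := (1 + t * ln y)^-1.
  by field; rewrite gt_eqF.
- move=> y /pos[y0 l0]; apply: continuousM; last exact: continuous_inv_pos.
  exact: (rder_continuous (rder_comp (is_derive_log_affine t y0) (is_derive_powRl (- 1) l0))).
Qed.

Lemma integral_powR_inv e u v : e != 0 -> 0 < u -> u <= v ->
  (\int[leb]_(y in `[u, v]) (y `^ e / y)%:E = ((v `^ e - u `^ e) / e)%:E)%E.
Proof.
move=> e0 u0 uv; rewrite mulrBl.
have pos y : u <= y <= v -> 0 < y by move=> /andP[+ _]; exact: lt_le_trans.
apply: (@FTC_itv R (fun y => y `^ e / e) (fun y => y `^ e / y)) => //.
- move=> y /pos y0; refine (rderE (rderM (is_derive_powRl e y0) (rder_cst e^-1 y)) _).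
  rewrite mulr0 add0r mulrA mulVf// mul1r powRD ?(gt_eqF y0) ?implybT//.
  by rewrite powR_inv1 ?(ltW y0).
- move=> y /pos y0; apply: continuousM; last exact: continuous_inv_pos.
  exact: continuous_powR_pos.
Qed.

(** [e] is the slack of the condition on [a] that belongs to the half: large [y] test the lower bound
    for [a], small [y] the upper one. *)
Lemma kernel_ge_log_half al s a p t e : -1 < al -> 0 < s -> s < al + 1 ->
  (t = 1 /\ e = a + (2 * al + 2) * rcp p - 2 * s) \/
  (t = -1 /\ e = 2 * al + 2 - (a + (2 * al + 2) * rcp p)) ->
  exists2 c : R, 0 < c & forall x y, 1 <= x <= 2 -> log_half t y ->
    ((c * y `^ (- (t * e)))%:E <=
     (`|y| `^ (2 * al + 2 - (a + (2 * al + 2) * rcp p)))%:E * potentialK al s x y)%E.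
Proof.
move=> a1 s0 sa H; have [c c0 Hc] := potentialK_ge_power a1 s0 sa.
exists (c * 5 `^ (s - al - 1)); first by rewrite mulr_gt0 ?powR_gt0.
move=> x y /andP[x1 x2] hy; have y0 := log_half_gt0 hy; rewrite (gtr0_norm y0).
have x0 : 0 < x by lra.
have p5 := powR_ge0 (5 : R) (s - al - 1).
case: H => -[tE eE]; case: hy => _ /=; rewrite tE ?mul1r ?mulN1r => ly.
  have y1 : 1 <= y by rewrite -(lnK y0) -expR0 ler_expR.
  apply: (@le_trans _ _ ((y `^ (2 * al + 2 - (a + (2 * al + 2) * rcp p)))%:E *
     (c * (5 * y ^+ 2) `^ (s - al - 1))%:E)%E).
    rewrite -EFinM lee_fin powRM ?sqr_ge0// -(powR_mulrn 2 (ltW y0)) -powRrM.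
    rewrite [leRHS](_ : _ = c * 5 `^ (s - al - 1) * (y `^ (2 * al + 2 - (a + (2 * al + 2) * rcp p)) *
      y `^ (2 * (s - al - 1)))); last by ring.
    rewrite -powRD ?(gt_eqF y0) ?implybT// le_eqVlt; apply/orP; left; apply/eqP.
    by congr (_ * _ `^ _); rewrite eE; ring.
  apply: lee_wpmul2l; first by rewrite lee_fin powR_ge0.
  by apply: Hc => //; nra.
rewrite oppr_ge0 in ly; have y1 : y <= 1 by rewrite -(lnK y0) -expR0 ler_expR.
rewrite opprK -eE mulrC EFinM; apply: lee_wpmul2l; first by rewrite lee_fin powR_ge0.
by apply: Hc => //; nra.
Qed.

(** An interval of the half, with endpoint 1 and logarithmic length [T]. *)
Lemma log_half_span t T : t = 1 \/ t = -1 -> 0 <= T -> exists u v,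
  [/\ 0 < u, u <= v, log_half t u, log_half t v &
    t * ((1 + t * ln v) - (1 + t * ln u)) = T /\
    t * (ln (1 + t * ln v) - ln (1 + t * ln u)) = ln (1 + T)].
Proof.
move=> tE T0; have I1 : log_half t 1 by split; rewrite /= ?in_itv/= ?andbT ?ln1 ?mulr0.
have IT : log_half t (expR (t * T)).
  split; first by rewrite /= in_itv/= expR_gt0.
  by rewrite /= expRK; case: tE => ->; rewrite ?mul1r ?mulN1r ?opprK.
case: tE => tE; rewrite tE ?mul1r ?mulN1r in I1 IT *.
  exists 1, (expR T); split; rewrite ?expRK ?ln1//; first by rewrite -expR0 ler_expR.
  by rewrite !mul1r addr0 ln1 subr0; split => //; ring.
exists (expR (- T)), 1; split; rewrite ?expRK ?ln1 ?expR_gt0//.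
  by rewrite -expR0 ler_expR oppr_le0.
by rewrite !mulN1r oppr0 addr0 ln1 sub0r !opprK; split => //; ring.
Qed.

Lemma log_half_ge_powR t y e : log_half t y -> e <= 0 -> 1 <= y `^ (- (t * e)).
Proof.
move=> hy e0; have y0 := log_half_gt0 hy; case: hy => _ /= ly.
rewrite /powR gt_eqF// -expR0 ler_expR (_ : _ * _ = (- e) * (t * ln y)); last by ring.
by rewrite mulr_ge0// oppr_ge0.
Qed.

(** [g] is the test function; the potential at the point provided by [dom_test] bounds the integrals of
    the minorant [h] uniformly. *)
Lemma dom_integral_bound al s a p t e : -1 < al -> 0 < s -> s < al + 1 -> (1 <= p)%E ->
  (t = 1 /\ e = a + (2 * al + 2) * rcp p - 2 * s) \/
  (t = -1 /\ e = 2 * al + 2 - (a + (2 * al + 2) * rcp p)) ->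
  weighted_Lp al a p `<=` potential_dom al s ->
  forall (g h : R -> R) N, 0 < N -> measurable_fun setT g -> (forall y, 0 <= g y) ->
    measurable_fun setT h -> (forall y, 0 <= h y) ->
    norm_le p (EFin \o (fun y : mT => g y * \1_(log_half t) y)) N ->
    (forall y, log_half t y -> h y <= y `^ (- (t * e)) * g y) ->
  exists M : R, forall u v, log_half t u -> log_half t v ->
    (\int[leb]_(y in `[u, v]) (h y / y)%:E <= M%:E)%E.
Proof.
move=> a1 s0 sa p1 te dom g h N N0 mg g0 mh h0 gN hg.
have [c c0 Hc] := kernel_ge_log_half a1 s0 sa te.
have tE : t = 1 \/ t = -1 by case: te => -[->]; [left|right].
have mH := measurable_log_half t.
have mF : measurable_fun setT (fun y : mT => g y * \1_(log_half t) y) by exact: measurable_funM.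
have F0 y : 0 <= g y * \1_(log_half t) y by rewrite mulr_ge0.
have hF : half_line (fun y : mT => g y * \1_(log_half t) y).
  move=> y y0; rewrite indicE memNset ?mulr0// => /log_half_gt0.
  by rewrite ltNge y0.
have [x x12] := dom_test a1 s0 sa p1 dom N0 mF F0 hF gN.
set J := (\int[mu]_y _)%E => Jfin.
have x0 : 0 < x by case/andP: x12; lra.
have k0 (y : mT) : (0 <= (`|y| `^ (2 * al + 2 - (a + (2 * al + 2) * rcp p)))%:E *
    potentialK al s x y * (g y * \1_(log_half t) y)%:E)%E.
  have [y0|y0] := leP y 0; first by rewrite hF// mule0.
  apply: mule_ge0; last by rewrite lee_fin.
  by apply: mule_ge0; [rewrite lee_fin powR_ge0|exact: potentialK_ge0].
have J0 : (0 <= J)%E by exact: integral_ge0.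
have Jf : J \is a fin_num by rewrite ge0_fin_numE.
exists (c^-1 * fine J) => u v hu hv.
have u0 := log_half_gt0 hu.
have mch : measurable_fun setT (fun y : R => c * h y) by exact: measurable_funM.
have ch0 y : 0 <= c * h y by rewrite mulr_ge0 ?(ltW c0).
have : (\int[leb]_(y in `[u, v]) ((c * h y) / y)%:E <= J)%E.
  apply: (integral_log_half_ge tE k0 ch0 mch hu hv) => y hy.
  rewrite indicE mem_set// mulr1.
  apply: (@le_trans _ _ ((c * y `^ (- (t * e)))%:E * (g y)%:E)%E).
    by rewrite -EFinM lee_fin -mulrA ler_pM2l// hg.
  by apply: lee_wpmul2r; [rewrite lee_fin|exact: Hc].
rewrite -integral_mu_itv// -[X in _ -> (X <= _)%E]integral_mu_itv//.
under eq_integral do rewrite EFinM.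
rewrite ge0_integralZl_EFin ?(ltW c0)//; last 2 first.
- by move=> y _; rewrite lee_fin.
- by apply: measurable_funTS; exact/measurable_EFinP.
by rewrite EFinM fineK// lee_pdivlMl.
Qed.

(** The function $1/(1+|\ln y|)$ is in $L^p(\mu)$ for $p > 1$, but its integral diverges
    logarithmically; with $e \le 0$ the kernel would not compensate for this. *)
Lemma dom_necessity_strict al s a p t e : -1 < al -> 0 < s -> s < al + 1 -> (1 <= p)%E ->
  (t = 1 /\ e = a + (2 * al + 2) * rcp p - 2 * s) \/
  (t = -1 /\ e = 2 * al + 2 - (a + (2 * al + 2) * rcp p)) ->
  weighted_Lp al a p `<=` potential_dom al s -> p != 1%E -> 0 < e.
Proof.
move=> a1 s0 sa p1 te dom pn1; rewrite ltNge; apply/negP => e0.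
have tE : t = 1 \/ t = -1 by case: te => -[->]; [left|right].
have tt : t * t = 1 by case: tE => ->; ring.
pose g r (y : R) := (1 + t * ln y) `^ (- r).
have mg r : measurable_fun setT (g r).
  apply: (measurableT_comp (measurable_powR _)); apply: measurable_funD => //.
  by apply: measurable_funM => //; exact: measurable_ln.
have g0 r y : 0 <= g r y by exact: powR_ge0.
have g1 y : log_half t y -> g 1 y <= 1.
  move=> [_ /= ly]; rewrite /g powR_inv1; last by lra.
  by rewrite invf_le1; lra.
have [N N0 gN] : exists2 N : R, 0 < N &
    norm_le p (EFin \o (fun y : mT => g 1 y * \1_(log_half t) y)) N.
  case: p p1 pn1 {te dom} => [r||//]; last first.
    move=> _ _; exists 1 => //=; apply: aeW => y; rewrite lee_fin indicE.
    by have [hy|hy] := pselect (log_half t y); [rewrite mem_set// mulr1 g1|rewrite memNset// mulr0].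
  rewrite lee_fin eqe => r1 rn1; have {rn1}r1 : 1 < r by rewrite lt_neqAle eq_sym rn1.
  have rp : 0 < (r - 1)^-1 by rewrite invr_gt0; lra.
  exists ((r - 1)^-1 `^ r^-1); first by rewrite powR_gt0.
  rewrite /= -powRrM mulVf ?powRr1 ?(ltW rp)//; last by apply/eqP; lra.
  apply: (@le_trans _ _ (\int[mu]_y (g r y * \1_(log_half t) y)%:E)%E).
    apply: ge0_le_integralT => y; first by rewrite lee_fin powR_ge0.
    rewrite lee_fin indicE; case: (y \in _); rewrite ?mulr1 ?mulr0.
      by rewrite /g -powRrM mulN1r.
    by rewrite powR0//; apply/eqP; lra.
  apply: (integral_log_half_le tE (g0 r) (mg r)) => u v u0 uv hu hv.
  rewrite integral_log_powR//; last 2 first.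
  - by apply/eqP; lra.
  - by move=> y yI; have [] := log_half_between tE hu hv yI.
  rewrite lee_fin; case: hu => _ /= lu; case: hv => _ /= lv.
  have le1 z : 0 <= t * ln z -> 0 <= (1 + t * ln z) `^ (1 - r) <= 1.
    move=> lz; rewrite powR_ge0/= -opprB powRN invf_le1; last by rewrite powR_gt0; lra.
    have h1 : 1 `^ (r - 1) = 1 :> R by rewrite powR1.
    by rewrite -[leLHS]h1 ge0_ler_powR ?nnegrE; lra.
  have /andP[pu0 pu1] := le1 u lu; have /andP[pv0 pv1] := le1 v lv.
  have -> : t / (1 - r) = - t * (r - 1)^-1 by field; apply/andP; split; apply/eqP; lra.
  rewrite mulrAC -[leRHS]mul1r ler_pM2r//.
  move: ((1 + t * ln v) `^ _) ((1 + t * ln u) `^ _) pu0 pu1 pv0 pv1 => x y *.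
  by case: tE => ->; lra.
have [|M HM] := dom_integral_bound a1 s0 sa p1 te dom N0 (mg 1) (g0 1) (mg 1) (g0 1) gN.
  by move=> y hy; rewrite -[leLHS]mul1r ler_wpM2r// log_half_ge_powR.
have [u [v [u0 uv hu hv [_ H]]]] := log_half_span tE (ltW (expR_gt0 `|M|)).
have := HM u v hu hv; rewrite integral_log_inv//; last first.
  by move=> y yI; have [] := log_half_between tE hu hv yI.
rewrite H lee_fin; apply/negP; rewrite -ltNge (le_lt_trans (ler_norm M))//.
have E0 := expR_gt0 `|M|; rewrite -[X in X < _]expRK ltr_ln ?posrE//; lra.
Qed.

(** What remains is $p = 1$, $e < 0$, where $y^{te}$ is integrable on the half while its product with the
    kernel is bounded below. *)
Lemma dom_necessity al s a p t e : -1 < al -> 0 < s -> s < al + 1 -> (1 <= p)%E ->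
  (t = 1 /\ e = a + (2 * al + 2) * rcp p - 2 * s) \/
  (t = -1 /\ e = 2 * al + 2 - (a + (2 * al + 2) * rcp p)) ->
  weighted_Lp al a p `<=` potential_dom al s -> 0 <= e.
Proof.
move=> a1 s0 sa p1 te dom; have [pE|pn1] := eqVneq p 1%E; last first.
  exact: ltW (dom_necessity_strict a1 s0 sa p1 te dom pn1).
rewrite leNgt; apply/negP => e0.
have tE : t = 1 \/ t = -1 by case: te => -[->]; [left|right].
have tt : t * t = 1 by case: tE => ->; ring.
have ten0 : t * e != 0 by case: tE => ->; apply/eqP; lra.
pose g (y : R) := y `^ (t * e).
(* the constant 1, in the form that has a primitive at hand *)
pose h (y : R) := (1 + t * ln y) `^ (- 0).
have mg : measurable_fun setT g by exact: measurable_powR.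
have g0 y : 0 <= g y by exact: powR_ge0.
have mh : measurable_fun setT h.
  apply: (measurableT_comp (measurable_powR _)); apply: measurable_funD => //.
  by apply: measurable_funM => //; exact: measurable_ln.
have h0 y : 0 <= h y by exact: powR_ge0.
have N0 : 0 < (- e)^-1 by rewrite invr_gt0; lra.
have gN : norm_le p (EFin \o (fun y : mT => g y * \1_(log_half t) y)) (- e)^-1.
  rewrite pE /= powRr1 ?(ltW N0)//.
  apply: (@le_trans _ _ (\int[mu]_y (g y * \1_(log_half t) y)%:E)%E).
    apply: ge0_le_integralT => y; first by rewrite lee_fin powR_ge0.
    by rewrite lee_fin powRr1// mulr_ge0.
  apply: (integral_log_half_le tE g0 mg) => u v u0 uv hu hv.
  rewrite integral_powR_inv// lee_fin.
  have v0 : 0 < v by exact: lt_le_trans uv.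
  have le1 z : log_half t z -> 0 <= z `^ (t * e) <= 1.
    move=> hz; rewrite powR_ge0/= -[t * e]opprK powRN invf_le1.
      by apply: log_half_ge_powR => //; exact: ltW.
    by rewrite powR_gt0// (log_half_gt0 hz).
  have /andP[pu0 pu1] := le1 u hu; have /andP[pv0 pv1] := le1 v hv.
  have -> : (t * e)^-1 = - t * (- e)^-1.
    by case: tE => ->; rewrite ?mul1r ?mulN1r ?invrN ?opprK ?mul1r ?mulN1r ?opprK.
  rewrite mulrA -[leRHS]mul1r ler_pM2r//.
  move: (v `^ _) (u `^ _) pu0 pu1 pv0 pv1 => x y *.
  by case: (tE) => ->; lra.
have [|M HM] := dom_integral_bound a1 s0 sa p1 te dom N0 mg g0 mh h0 gN.
  move=> y hy; rewrite /h /g oppr0 powRr0 powRN mulVf// gt_eqF// powR_gt0//.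
  exact: log_half_gt0 hy.
have [|u [v [u0 uv hu hv [H _]]]] := @log_half_span t (`|M| + 1) tE; first by rewrite addr_ge0.
have ly y : u <= y <= v -> 0 <= t * ln y by move=> yI; have [] := log_half_between tE hu hv yI.
have := HM u v hu hv; rewrite integral_log_powR//; last by rewrite eq_sym oner_eq0.
have lv : 0 <= t * ln v by apply: ly; rewrite uv lexx.
have lu : 0 <= t * ln u by apply: ly; rewrite lexx uv.
rewrite subr0 !powRr1 ?addr_ge0//.
by rewrite divr1 H lee_fin; apply/negP; rewrite -ltNge; have := ler_norm M; lra.
Qed.

End necessity_domain.

(** * The two equivalences *)
Section main_lemmas.
Context {R : realType}.
Implicit Types (al s a b : R) (p q : \bar R).

(** For $p > 1$ the sufficiency is the first component of the estimate with $q = p$ and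
    $b = 2s - a$, which satisfy the equation between $1/p$ and $1/q$ and, strictly, the
    local condition. *)
Lemma domain_iff al s a p : -1 < al -> 0 < s -> s < al + 1 -> (1 <= p)%E ->
  weighted_Lp al a p `<=` potential_dom al s <->
  (2 * s - (2 * al + 2) * rcp p < a ?<= if (p == 1%E)) /\
  (a < (2 * al + 2) * (1 - rcp p) ?<= if (p == 1%E)).
Proof.
move=> a1 s0 sa p1; split=> [dom|].
  have L := dom_necessity a1 s0 sa p1 (or_introl (conj erefl erefl)) dom.
  have U := dom_necessity a1 s0 sa p1 (or_intror (conj erefl erefl)) dom.
  have [pE|pn1] := eqVneq p 1%E; first by rewrite !lteifT; lra.
  have L' := dom_necessity_strict a1 s0 sa p1 (or_introl (conj erefl erefl)) dom pn1.
  have U' := dom_necessity_strict a1 s0 sa p1 (or_intror (conj erefl erefl)) dom pn1.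
  by rewrite !lteifF; lra.
have D0 : 0 < 2 * al + 2 by lra.
have [->|pn1] := eqVneq p 1%E.
  rewrite !lteifT rcp1 mulr1 subrr mulr0 => -[h1 h2].
  exact: potential_dom_L1.
rewrite !lteifF => -[h1 h2] f fp.
have r1 := rcp_lt1 p1 pn1; have r0 := rcp_ge0 p1.
have [|||||C _ est] := @two_weight_suff_strict R al s a (2 * s - a) p p a1 s0 sa p1 (lexx p).
- by rewrite (_ : a + _ - _ = 0) ?mul0r ?addr0//; ring.
- exact: h2.
- lra.
- lra.
- lra.
by have [] := est f fp.
Qed.

(** Equality in the local condition is only allowed for $p > 1$ and $q < \infty$, where it forces
    $p < q$. *)
Lemma estimate_sufficiency al s a b p q : -1 < al -> 0 < s -> s < al + 1 -> (1 <= p)%E ->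
  (p <= q)%E -> rcp q = rcp p + (a + b - 2 * s) / (2 * al + 2) ->
  (a < (2 * al + 2) * (1 - rcp p) ?<= if ((p == 1%E) && (q == +oo%E))) ->
  (b < (2 * al + 2) * rcp q ?<= if ((p == 1%E) && (q == +oo%E))) ->
  (rcp p - 2 * s < rcp q ?<= if (~~ ((p == 1%E) || (q == +oo%E)))) ->
  two_weight_estimate al s a b p q.
Proof.
move=> a1 s0 sa p1 pq hb; have q1 : (1 <= q)%E by exact: le_trans pq.
have D0 : 0 < 2 * al + 2 by lra.
have p0 := rcp_ge0 p1; have q0 := rcp_ge0 q1; have p1' := rcp_le1 p1.
have [pE|pn1] := eqVneq p 1%E; have [qE|qny] := eqVneq q +oo%E => /=; rewrite ?lteifT ?lteifF.
- rewrite pE qE in hb *; rewrite rcp1 rcp_pinfty subrr !mulr0 in hb * => hc hd he.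
  apply: two_weight_suff_bounded => //; last by lra.
  have /eqP := hb; rewrite eq_sym addrC addr_eq0 => /eqP h.
  have : a + b - 2 * s = - 1 * (2 * al + 2) by rewrite -h divfK ?gt_eqF.
  by lra.
- move=> hc hd he; apply: two_weight_suff_strict => //.
  by have := rcp_gt0 q1 qny; lra.
- move=> hc hd he; apply: two_weight_suff_strict => //.
  by have := rcp_lt1 p1 pn1; lra.
move=> hc hd; rewrite le_eqVlt => /predU1P[he|he]; last first.
  apply: two_weight_suff_strict => //.
  by have := rcp_lt1 p1 pn1; lra.
case: q q1 pq hb hc hd he q0 qny => [v||//] v1 pv hb hc hd he _; last by rewrite eqxx.
case: p p1 pv pn1 hb hc he {p0 p1'} => [u||//] u1 uv un1 hb hc he _; last by rewrite leye_eq in uv.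
rewrite !lee_fin in u1 v1 uv; rewrite eqe in un1.
have {}u1 : 1 < u by rewrite lt_neqAle eq_sym un1.
have [u0 v0] : u != 0 /\ v != 0 by split; apply/eqP; lra.
rewrite !rcp_EFin// in hb hc he hd.
by apply: two_weight_suff_endpoint => //; rewrite he.
Qed.

(** For $q = \infty$ the test intervals give nothing on [A] and [B]; the bounds on [a] imposed by the
    domain take over, since then $A = a + D/p - 2s$ by homogeneity. *)
Lemma estimate_necessity al s a b p q : -1 < al -> 0 < s -> s < al + 1 -> (1 <= p)%E ->
  (1 <= q)%E -> two_weight_estimate al s a b p q ->
  [/\ (p <= q)%E,
      rcp q = rcp p + (a + b - 2 * s) / (2 * al + 2),
      a < (2 * al + 2) * (1 - rcp p) ?<= if ((p == 1%E) && (q == +oo%E)),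
      b < (2 * al + 2) * rcp q ?<= if ((p == 1%E) && (q == +oo%E))
    & rcp p - 2 * s < rcp q ?<= if (~~ ((p == 1%E) || (q == +oo%E)))].
Proof.
move=> a1 s0 sa p1 q1 est.
have D0 : 0 < 2 * al + 2 by lra.
have dom : weighted_Lp al a p `<=` potential_dom al s.
  by case: est => C _ est f /est[].
have sc := necessity_scaling a1 s0 sa p1 q1 est.
have loc := necessity_local a1 s0 sa p1 q1 est.
have L := dom_necessity a1 s0 sa p1 (or_introl (conj erefl erefl)) dom.
have U := dom_necessity a1 s0 sa p1 (or_intror (conj erefl erefl)) dom.
have S1 := dom_necessity_strict a1 s0 sa p1 (or_introl (conj erefl erefl)) dom.
have S2 := dom_necessity_strict a1 s0 sa p1 (or_intror (conj erefl erefl)) dom.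
have st := necessity_strict a1 s0 sa p1 q1 est.
split.
- exact: necessity_pq a1 s0 sa p1 q1 est.
- apply: (mulfI (lt0r_neq0 D0)); rewrite mulrDr mulrC -(mulrC (_ / _)) divfK ?gt_eqF//.
  by lra.
- have [pE|pn1] := eqVneq p 1%E; have [qE|qny] := eqVneq q +oo%E => /=; rewrite ?lteifT ?lteifF.
  + by lra.
  + by have [] := st qny; lra.
  + by have := S2 pn1; lra.
  + by have := S2 pn1; lra.
- have [pE|pn1] := eqVneq p 1%E; have [qE|qny] := eqVneq q +oo%E => /=; rewrite ?lteifT ?lteifF.
  + by lra.
  + by have [] := st qny; lra.
  + by have := S1 pn1; lra.
  + by have := S1 pn1; lra.
have [pE|pn1] := eqVneq p 1%E; have [qE|qny] := eqVneq q +oo%E => /=; rewrite ?lteifT ?lteifF.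
- by have := necessity_bounded a1 s0 sa p1 q1 est pE qE; rewrite pE qE rcp1 rcp_pinfty; lra.
- by rewrite lt_neqAle loc eq_sym (necessity_local_strict1 a1 s0 sa p1 q1 est pE qny).
- by rewrite lt_neqAle loc eq_sym (necessity_local_strict_infty a1 s0 sa p1 q1 est pn1 qE).
- exact: loc.
Qed.

End main_lemmas.

Theorem theorem2p15 (R : realType) (alpha sigma a b : R) (p q : \bar R)
    (halpha : -1 < alpha) (hsigma0 : 0 < sigma) (hsigma1 : sigma < alpha + 1)
    (hp : (1 <= p)%E) (hq : (1 <= q)%E) :
  let p' := hoelder_conjugate p in
  let q' := hoelder_conjugate q in
  let D := 2 * alpha + 2 in
  (weighted_Lp alpha a p `<=` potential_dom alpha sigma <->
     (2 * sigma - D * rcp p < a ?<= if (p == 1%E)) /\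
     (a < D * rcp p' ?<= if (p == 1%E)))
  /\
  (two_weight_estimate alpha sigma a b p q <->
     [/\ (p <= q)%E,
         rcp q = rcp p + (a + b - 2 * sigma) / D,
         a < D * rcp p' ?<= if ((p == 1%E) && (q' == 1%E)),
         b < D * rcp q ?<= if ((p == 1%E) && (q' == 1%E))
       & rcp p - 2 * sigma < rcp q ?<= if (~~ ((p == 1%E) || (q == +oo%E)))]).
Proof.
move=> p' q' D; rewrite /p' /q' /D hoelder_conjugate_eq1// rcp_conjugate//.
split; first exact: domain_iff.
split; first exact: estimate_necessity.
by case=> *; exact: estimate_sufficiency.
Qed.
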